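(* Let $\mu$ be a $\Gamma_d(\alpha,\beta)$ distribution on $\mathbb{R}^d$ (with respect to a norm $\|\cdot\|$). (i) If there is $\kappa>0$ such that $\beta(v)\ge\kappa$ for $\alpha$-almost every $v\in\mathbf{S}_{\mathbb{R}^d,\|\cdot\|}$, then the Fourier-Laplace transform $\hat\mu(z)$ exists for all $z$ in a neighbourhood $U\subseteq\mathbb{C}^d$ of zero; $\hat\mu$ is analytic there and given by $$\hat\mu(z)=\exp\left(\int_{\mathbf{S}_{\mathbb{R}^d,\|\cdot\|}}\ln\left(\frac{\beta(v)}{\beta(v)-iv^\top z}\right)\alpha(\mathrm{d}v)\right),$$ where $\ln$ is the main branch of the complex logarithm. (ii) If there exists a sequence $(v_n)_{n\in\mathbb{N}}$ in $\mathbf{S}_{\mathbb{R}^d,\|\cdot\|}$ with $\lim_{n\to\infty}\beta(v_n)=0$ and $\alpha(\{v_n\})>0$ for all $n\in\mathbb{N}$, then the Fourier-Laplace transform $\hat\mu$ exists in no neighbourhood $U\subseteq\mathbb{C}^d$ of zero.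
   Context: $\mathbb{R}_+=[0,\infty)$ and $\mathbf{S}_{\mathbb{R}^d,\|\cdot\|}=\{v\in\mathbb{R}^d:\|v\|=1\}$. For a finite Borel measure $\alpha$ on $\mathbf{S}_{\mathbb{R}^d,\|\cdot\|}$ and a Borel function $\beta:\mathbf{S}_{\mathbb{R}^d,\|\cdot\|}\to\mathbb{R}_+$, an infinitely divisible probability measure $\mu$ on $\mathbb{R}^d$ is called a $d$-dimensional Gamma distribution $\Gamma_d(\alpha,\beta)$ if for all $z\in\mathbb{R}^d$ $$\hat\mu(z)=\exp\left(\int_{\mathbf{S}_{\mathbb{R}^d,\|\cdot\|}}\int_{\mathbb{R}_+}\left(e^{irv^\top z}-1\right)\frac{e^{-\beta(v)r}}{r}\,\mathrm{d}r\,\alpha(\mathrm{d}v)\right).$$ The Fourier-Laplace transform of $\mu$ at $z\in\mathbb{C}^d$ is $\hat\mu(z)=\int_{\mathbb{R}^d}e^{iz^\top x}\mu(\mathrm{d}x)$ (with the bilinear product $z^\top x=\sum_j z_jx_j$); it exists at $z$ if this integral is absolutely convergent. *)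

(* Defs.v *)
From HB Require Import structures.
From mathcomp Require Import all_boot all_order all_algebra.
From mathcomp Require Import all_classical all_reals all_analysis.
From mathcomp Require Import complex.

Set Implicit Arguments.
Unset Strict Implicit.
Unset Printing Implicit Defensive.
Import Order.TTheory GRing.Theory Num.Theory.
Import numFieldNormedType.Exports.
Import ComplexField.Normc.
Local Open Scope classical_set_scope.
Local Open Scope ring_scope.
Local Open Scope complex_scope.

(* The modulus topology on R[i]; through the matrix instances, 'rV[R[i]]_d
   then carries the usual topology of C^d. *)
HB.instance Definition _ (R : rcfType) := NormedModule.copy R[i] R[i]^o.

(* R^d with its Borel sigma-algebra, generated by the open sets. *)
Notation borel R d := (g_sigma_algebraType (@open 'rV[R]_d)).

Section complex_functions.
Context {R : realType}.
Implicit Types z : R[i].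

Definition cexp z : R[i] :=
  let r := expR (complex.Re z) in
  (r * cos (complex.Im z)) +i* (r * sin (complex.Im z)).

(* Principal argument of z != 0, with values in ]-pi, pi]. *)
Definition cArg z : R :=
  let t := acos (complex.Re z / normc z) in
  if 0 <= complex.Im z then t else - t.

(* Main branch of the logarithm; cLn 0 is a junk value. *)
Definition cLn z : R[i] := ln (normc z) +i* cArg z.

End complex_functions.

Section complex_integral.
Context {d : measure_display} {T : measurableType d} {R : realType}.
Variables (mu : {measure set T -> \bar R}) (D : set T) (f : T -> R[i]).

Definition cintegrable : Prop :=
  [/\ measurable_fun D (fun x => complex.Re (f x)),
      measurable_fun D (fun x => complex.Im (f x)) &
      (\int[mu]_(x in D) (normc (f x))%:E < +oo)%E].

(* Meaningful only under [cintegrable]. *)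
Definition cintegral : R[i] :=
  (\int[mu]_(x in D) complex.Re (f x)) +i*
  (\int[mu]_(x in D) complex.Im (f x)).

End complex_integral.

Section analytic.
Context {R : realType} {d : nat}.

Definition monomial (m : {ffun 'I_d -> nat}) (h : 'rV[R[i]]_d) : R[i] :=
  \prod_j h 0 j ^+ m j.

(* On some polydisc around z0, f is the sum of an absolutely convergent power
   series; the sum is computed as the limit over the boxes {0,...,n-1}^d of
   multi-indices. *)
Definition analytic_at (f : 'rV[R[i]]_d -> R[i]) (z0 : 'rV[R[i]]_d) : Prop :=
  exists (c : {ffun 'I_d -> nat} -> R[i]) (r : R), 0 < r /\
    forall h : 'rV[R[i]]_d, (forall j, normc (h 0 j) < r) ->
      summable [set: {ffun 'I_d -> nat}]
        (fun m => (normc (c m * monomial m h))%:E) /\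
      \sum_(m : {ffun 'I_d -> 'I_n})
         (let k := [ffun j => m j : nat] in c k * monomial k h)
        @[n --> \oo] --> f (z0 + h).

End analytic.

Section gamma.
Context {R : realType} {d : nat}.

Record is_norm (N : 'rV[R]_d -> R) : Prop := IsNorm {
  is_norm_triangle : forall x y, N (x + y) <= N x + N y ;
  is_normZ : forall (a : R) x, N (a *: x) = `|a| * N x ;
  is_norm0_eq0 : forall x, N x = 0 -> x = 0 }.

Definition unit_sphere (N : 'rV[R]_d -> R) : set 'rV[R]_d := [set v | N v = 1].

(* The bilinear (not sesquilinear) product v^T z. *)
Definition cdot (v : 'rV[R]_d) (z : 'rV[R[i]]_d) : R[i] :=
  \sum_j (v 0 j)%:C * z 0 j.

Definition FL_exists (mu : probability (borel R d) R) (z : 'rV[R[i]]_d) : Prop :=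
  cintegrable mu setT (fun x => cexp ('i%C * cdot x z)).

Definition FL (mu : probability (borel R d) R) (z : 'rV[R[i]]_d) : R[i] :=
  cintegral mu setT (fun x => cexp ('i%C * cdot x z)).

(* The n-fold convolution power of nu, from
   (nu * rho)(A) = \int rho(A - x) nu(dx). *)
Fixpoint conv_pow (nu : probability (borel R d) R) (n : nat)
    (A : set 'rV[R]_d) : \bar R :=
  if n is n'.+1 then
    (\int[nu]_x conv_pow nu n' [set y : 'rV[R]_d | A (y + (x : 'rV[R]_d))%R])%E
  else \d_((0 : 'rV[R]_d) : borel R d) A.

Definition infinitely_divisible (mu : probability (borel R d) R) : Prop :=
  forall n : nat, (0 < n)%N ->
    exists nu : probability (borel R d) R,
      forall A : set (borel R d), measurable A -> mu A = conv_pow nu n A.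

Definition gamma_integrand (beta : 'rV[R]_d -> R) (z : 'rV[R]_d)
    (v : 'rV[R]_d) (r : R) : R[i] :=
  (cexp ('i%C * r%:C * cdot v (map_mx (real_complex R) z)) - 1)
    * (expR (- beta v * r) / r)%:C.

Definition gamma_inner (beta : 'rV[R]_d -> R) (z v : 'rV[R]_d) : R[i] :=
  cintegral lebesgue_measure `[0, +oo[ (gamma_integrand beta z v).

(* The two integrability clauses say that the iterated integral in the exponent
   exists; the totalised integral would otherwise return a junk value, e.g.
   when beta vanishes on a set of positive alpha-measure. *)
Definition is_gamma (N : 'rV[R]_d -> R)
    (alpha : {finite_measure set (borel R d) -> \bar R})
    (beta : 'rV[R]_d -> R) (mu : probability (borel R d) R) : Prop :=
  infinitely_divisible mu /\
  forall z : 'rV[R]_d,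
    [/\ {ae alpha, forall v, unit_sphere N v ->
           cintegrable lebesgue_measure `[0, +oo[ (gamma_integrand beta z v)},
        cintegrable alpha (unit_sphere N) (gamma_inner beta z) &
        FL mu (map_mx (real_complex R) z) =
          cexp (cintegral alpha (unit_sphere N) (gamma_inner beta z))].

End gamma.

(* Main.v *)
(* Everything is reduced to power series in one variable along complex lines.

   (i) For small real z, Frullani's integral turns the exponent into the
   integral of the logarithms, and this integral is a power series in w along
   every small line x + w y; so is its exponential. An even-moment argument
   (expand 1 - cos(t X) in t and compare with the power series) bounds the
   2n-th moments of the coordinates of mu by K q^(2n) (2n)! with q < 1, so mu has
   exponential moments, its transform exists and is analytic near 0, and it is
   again a power series along small lines. The two series agree for real w,
   hence at w = i, which reaches every small complex z.

   (ii) If the transform exists near 0, mu has exponential moments and the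
   logarithm of the transform is a power series in t along each axis. Minus its
   real part is the integral of 1 - cos(t delta r v_j) against the Levy measure
   e^(-beta(v) r)/r dr alpha(dv), so the even-moment argument, applied to this
   infinite measure, bounds its 2n-th moments by K q^(2n) (2n)!. An atom v alone
   contributes alpha{v} (delta v_j / beta(v))^(2n) (2n-1)!, which forces
   delta |v_j| <= beta(v) for all j. Then beta(v_n) -> 0 would drive the unit
   vectors v_n to 0. *)

Require Import Defs.
From HB Require Import structures.
From mathcomp Require Import all_boot all_order all_algebra.
From mathcomp Require Import all_classical all_reals all_analysis.
From mathcomp Require Import measurable_realfun.
From mathcomp Require Import complex.
From mathcomp Require Import ring lra zify.

Set Implicit Arguments.
Unset Strict Implicit.
Unset Printing Implicit Defensive.
Import Order.TTheory GRing.Theory Num.Theory.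
Import numFieldNormedType.Exports.
Import ComplexField.Normc.
Local Open Scope classical_set_scope.
Local Open Scope ring_scope.
Local Open Scope complex_scope.

(** * Geometrically bounded power series *)

Section geometric_sequences.
Context {R : realType}.
Implicit Types a b : nat -> R.

(** Restricting to complex lines means that the only identity theorem needed is uniqueness of the
    coefficients of a real power series, applied to real and imaginary parts. Arguments are rescaled
    so that coefficients are at most K q^k with q < 1: the radius exceeds 1, which makes w = i a
    legitimate point although only w in (0, 1] is compared.

    The obstacle in (i) is that a Gamma distribution is specified by its transform at real z only,
    so exponential moments have to be extracted from a characteristic function. Even moments do this
    because 1 - cos and its suitably signed Taylor remainders are nonnegative: Fatou's lemma then
    yields integrability with no prior moment. Finiteness of the measure does not enter, so the same
    argument serves the Levy measure in (ii).

    Branches of the logarithm are avoided wherever one would have to be chosen: e = exp b is encoded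
    by the recursion that e' = b' e imposes on coefficients, and in (ii) only the moduli of two
    expressions for the transform are compared, which already fixes the real part of the
    exponent. *)

Definition geo a := exists K q : R,
  [/\ 0 <= K, 0 < q, q < 1 & forall k, `|a k| <= K * q ^+ k].

Lemma geo_leq a b : (forall k, `|b k| <= `|a k|) -> geo a -> geo b.
Proof.
move=> ba [K [q [K0 q0 q1 aK]]]; exists K, q; split => // k.
exact: le_trans (ba k) (aK k).
Qed.

Lemma geo_cvg_norm a : geo a -> cvgn (series (fun k => `|a k|)).
Proof.
move=> [K [q [K0 q0 q1 aK]]].
apply: (@series_le_cvg _ _ (geometric K q)) => //.
- by move=> n; rewrite mulr_ge0// exprn_ge0// ltW.
- by apply: is_cvg_geometric_series; rewrite ger0_norm// ltW.
Qed.

Lemma geo_cvg a : geo a -> cvgn (series a).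
Proof. by move=> /geo_cvg_norm; exact: normed_cvg. Qed.

Lemma geo_scale a (t : R) : `|t| <= 1 -> geo a -> geo (fun k => a k * t ^+ k).
Proof.
move=> t1; apply: geo_leq => k; rewrite normrM normrX ler_piMr//.
by rewrite exprn_ile1.
Qed.

Lemma linear_geo (q : R) : 0 < q -> q < 1 ->
  exists C q' : R, [/\ 0 <= C, q <= q', q' < 1 &
    forall k, (k.+1)%:R * q ^+ k <= C * q' ^+ k].
Proof.
move=> q0 q1; exists (2 / (1 - q)), ((1 + q) / 2) => //.
have p0 : 0 < 1 - q by rewrite subr_gt0.
have q'0 : 0 < (1 + q) / 2 by rewrite divr_gt0// addr_gt0.
split => //.
- by rewrite divr_ge0// ltW.
- by rewrite ler_pdivlMr//; lra.
- by rewrite ltr_pdivrMr//; lra.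
move=> k.
(* Bernoulli's inequality for q' / q = 1 + (1 - q) / (2 q), multiplied by q^n, where q' is the
   midpoint of q and 1. *)
have bern : forall n, q ^+ n + n%:R * (q ^+ n * ((1 - q) / 2 / q)) <=
    ((1 + q) / 2) ^+ n.
  elim=> [|n IHn]; first by rewrite !expr0 mul0r addr0.
  rewrite [leRHS]exprS.
  apply: le_trans (ler_wpM2l (ltW q'0) IHn).
  rewrite -subr_ge0.
  have -> : (1 + q) / 2 * (q ^+ n + n%:R * (q ^+ n * ((1 - q) / 2 / q))) -
     (q ^+ n.+1 + n.+1%:R * (q ^+ n.+1 * ((1 - q) / 2 / q))) =
     n%:R * q ^+ n * ((1 - q) / 2) ^+ 2 / q.
    by rewrite exprS -natr1; field; rewrite gt_eqF.
  by rewrite divr_ge0 ?(ltW q0)// mulr_ge0 ?sqr_ge0// mulr_ge0// exprn_ge0// ltW.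
rewrite mulrAC ler_pdivlMr// -ler_pdivrMl//.
apply: le_trans (bern k).
have qk0 : 0 <= q ^+ k by rewrite exprn_ge0// ltW.
rewrite -[k.+1%:R]natr1 -subr_ge0.
have -> : q ^+ k + k%:R * (q ^+ k * ((1 - q) / 2 / q)) -
   2^-1 * ((k%:R + 1) * q ^+ k * (1 - q)) =
   q ^+ k * ((1 + q) / 2 + k%:R * (1 - q) * (1 - q) / 2 / q).
  by field; rewrite gt_eqF.
rewrite mulr_ge0// addr_ge0 ?(ltW q'0)//.
by rewrite divr_ge0 ?(ltW q0)// divr_ge0// !mulr_ge0// ltW.
Qed.

Lemma geo_diffs a : geo a -> geo (pseries_diffs a).
Proof.
move=> [K [q [K0 q0 q1 aK]]].
have [C [q' [C0 qq' q'1 Cq]]] := linear_geo q0 q1.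
exists (K * q * C), q'; split => //.
- by rewrite mulr_ge0// mulr_ge0// ltW.
- exact: lt_le_trans qq'.
move=> k; rewrite /pseries_diffs normrM ger0_norm//.
apply: le_trans (ler_wpM2l (ler0n _ _) (aK _)) _.
rewrite exprS.
have -> : k.+1%:R * (K * (q * q ^+ k)) = K * q * (k.+1%:R * q ^+ k) by ring.
by rewrite -[leRHS]mulrA ler_wpM2l// mulr_ge0// ltW.
Qed.

Lemma geo_mono a (K q K' q' : R) : 0 <= K -> 0 <= q -> K <= K' -> q <= q' ->
  (forall k, `|a k| <= K * q ^+ k) -> forall k, `|a k| <= K' * q' ^+ k.
Proof.
move=> K0 q0 KK' qq' aK k; apply: le_trans (aK k) _.
by rewrite ler_pM// ?exprn_ge0// lerXn2r// nnegrE// (le_trans q0).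
Qed.

Lemma geo_common a b : geo a -> geo b -> exists K q : R,
  [/\ 0 <= K, 0 < q, q < 1, forall k, `|a k| <= K * q ^+ k &
      forall k, `|b k| <= K * q ^+ k].
Proof.
move=> [K [q [K0 q0 q1 aK]]] [K' [q' [K'0 q'0 q'1 bK]]].
exists (Num.max K K'), (Num.max q q'); split.
- by rewrite le_max K0.
- by rewrite lt_max q0.
- by rewrite gt_max q1.
- by apply: (geo_mono K0 (ltW q0) _ _ aK); rewrite le_max lexx.
- by apply: (geo_mono K'0 (ltW q'0) _ _ bK); rewrite le_max lexx orbT.
Qed.

Lemma geo_lin a b (x y : R) : geo a -> geo b ->
  geo (fun k => x * a k + y * b k).
Proof.
move=> ga gb; have [K [q [K0 q0 q1 aK bK]]] := geo_common ga gb.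
exists (`|x| * K + `|y| * K), q; split => //.
  by rewrite addr_ge0// mulr_ge0.
move=> k; apply: le_trans (ler_normD _ _) _.
by rewrite mulrDl !normrM -!mulrA lerD// ler_wpM2l.
Qed.

(** With r = 2 / (1 + q) the ratio r q is still below 1. This room beyond 1 makes the sums
    differentiable at |x| = 1 as well. *)
Lemma geo_radius a : geo a ->
  exists2 r : R, 1 < r & geo (fun k => a k * r ^+ k).
Proof.
move=> [K [q [K0 q0 q1 aK]]].
exists (2 / (1 + q)).
  by rewrite ltr_pdivlMr; lra.
have q'0 : 0 < q + 1 by lra.
exists K, (2 / (1 + q) * q); split => //.
- by rewrite mulr_gt0// divr_gt0//; lra.
- by rewrite mulrAC ltr_pdivrMr//; lra.
have r0 : 0 <= 2 / (1 + q) by rewrite divr_ge0//; lra.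
move=> k; rewrite normrM [(_ * q) ^+ _]exprMn mulrCA [leLHS]mulrC normrX (ger0_norm r0).
by rewrite ler_wpM2l// exprn_ge0.
Qed.

(** [pseries_snd_diffs] wants the series and its first two formal derivatives to converge at one
    point beyond |x|. A common geometric bound on all three supplies that point. *)
Lemma geo_is_derive a (x : R) : geo a -> `|x| <= 1 ->
  is_derive x (1 : R) (fun y : R => limn (pseries a y))
    (limn (pseries (pseries_diffs a) x)).
Proof.
move=> ga x1; have gd := geo_diffs ga; have gdd := geo_diffs gd.
have [K [q [K0 q0 q1 aK dK]]] := geo_common ga gd.
have gm : geo (fun k => K * q ^+ k).
  by exists K, q; split => // k; rewrite ger0_norm// mulr_ge0// exprn_ge0// ltW.
have [K' [q' [K'0 q'0 q'1 mK ddK]]] := geo_common gm gdd.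
have [|r r1 gr] := @geo_radius (fun k => K' * q' ^+ k).
  by exists K', q'; split => // k; rewrite ger0_norm// mulr_ge0// exprn_ge0// ltW.
have r0 : 0 < r by exact: lt_trans r1.
have q'k k : 0 <= q' ^+ k by rewrite exprn_ge0// ltW.
have pc (c : nat -> R) : (forall k, `|c k| <= K' * q' ^+ k) -> cvgn (pseries c r).
  move=> cK; apply: geo_cvg; apply: geo_leq gr => k.
  rewrite !normrM ler_wpM2r// (le_trans (cK k))// ger0_norm//.
  by rewrite (ger0_norm (q'k k)).
have mK' k : K * q ^+ k <= K' * q' ^+ k.
  by apply: le_trans (mK k); rewrite ler_norm.
apply: (@pseries_snd_diffs R a r x).
- by apply: pc => k; exact: le_trans (mK' k).
- by apply: pc => k; exact: le_trans (mK' k).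
- exact: pc.
- by rewrite (le_lt_trans x1)// gtr0_norm.
Qed.

Lemma sum_triangle (V : zmodType) (f : nat -> nat -> V) n :
  \sum_(k < n) \sum_(i < k.+1) f i (k - i)%N =
  \sum_(i < n) \sum_(j < n - i) f i j.
Proof.
elim: n => [|n IHn]; first by rewrite !big_ord0.
rewrite big_ord_recr/= IHn [RHS]big_ord_recr/= big_ord_recr/= subnn.
rewrite subSnn big_ord_recl big_ord0 addr0 addrA; congr (_ + _).
rewrite -big_split/=; apply: eq_bigr => i _.
by rewrite subSn ?(ltnW (ltn_ord i))// big_ord_recr.
Qed.

(** Up to the factor q^2, n^2 q^n is below (n+1) (n+2) q^(n+2), the general term of the twice
    differentiated geometric series, which converges. *)
Lemma geo_sqr_cvg0 (q : R) : 0 < q -> q < 1 ->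
  (fun n : nat => n%:R * n%:R * q ^+ n) @ \oo --> (0 : R).
Proof.
move=> q0 q1.
have : geo (pseries_diffs (pseries_diffs (fun k => q ^+ k))).
  apply: geo_diffs; apply: geo_diffs; exists 1, q; split => // k.
  by rewrite mul1r ger0_norm// exprn_ge0// ltW.
move=> /geo_cvg /cvg_series_cvg_0 h.
have {}h : (fun n => pseries_diffs (pseries_diffs (fun k => q ^+ k)) n * q ^- 2) @ \oo --> (0:R).
  by rewrite -[X in _ --> X](mul0r (q ^- 2)); apply: cvgMl.
apply: squeeze_cvgr (cvg_cst 0) h.
near=> n; rewrite !mulr_ge0//=; last by rewrite exprn_ge0// ltW.
rewrite /pseries_diffs -addn2 exprD.
have -> : n.+1%:R * ((n + 2)%:R * (q ^+ n * q ^+ 2)) / q ^+ 2 =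
   n.+1%:R * (n + 2)%:R * q ^+ n :> R.
  by field; rewrite gt_eqF.
rewrite ler_wpM2r//; first by rewrite exprn_ge0// ltW.
by rewrite -!natrM ler_nat leq_mul ?leq_addr.
Unshelve. all: by end_near. Qed.

Lemma cauchy_product a b : geo a -> geo b ->
  series (fun k => \sum_(j < k.+1) a j * b (k - j)%N) @ \oo -->
    limn (series a) * limn (series b).
Proof.
move=> ga gb; have [K [q [K0 q0 q1 aK bK]]] := geo_common ga gb.
have ab : (fun n => series a n * series b n) @ \oo -->
    limn (series a) * limn (series b).
  by apply: cvgM; exact: geo_cvg.
apply: (@cvg_trans _ ((fun n => series a n * series b n -
  (series a n * series b n -
   series (fun k => \sum_(j < k.+1) a j * b (k - j)%N) n)) @ \oo)).
  by apply: near_eq_cvg; near=> n; rewrite /= subKr.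
have -> : limn (series a) * limn (series b) =
    limn (series a) * limn (series b) - 0 by rewrite subr0.
apply: cvgB => //.
have h : (fun n : nat => K ^+ 2 * (n%:R * n%:R * q ^+ n)) @ \oo --> (0:R).
  rewrite -[X in _ --> X](mulr0 (K ^+ 2)).
  by apply: cvgMr; exact: geo_sqr_cvg0.
apply: norm_cvg0; apply: squeeze_cvgr (cvg_cst 0) h.
near=> n; rewrite normr_ge0/=.
(* The product of partial sums exceeds the partial Cauchy product by the terms with i, j < n and i +
   j >= n: at most n^2 of them, each at most K^2 q^n. *)
rewrite /series/= !big_mkord mulr_suml.
rewrite (sum_triangle (fun i j => a i * b j)) -sumrB.
apply: le_trans (ler_norm_sum _ _ _) _.
have -> : K ^+ 2 * (n%:R * n%:R * q ^+ n) = \sum_(i < n) (K ^+ 2 * n%:R * q ^+ n).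
  by rewrite sumr_const card_ord -[RHS]mulr_natr; ring.
apply: ler_sum => i _.
have le_in : (n - i <= n)%N by rewrite leq_subr.
rewrite mulr_sumr -(big_mkord xpredT (fun j => a i * b j)).
rewrite -(big_mkord xpredT (fun j => a i * b j)).
rewrite (big_cat_nat _ le_in)//= addrAC subrr add0r.
apply: le_trans (ler_norm_sum _ _ _) _.
apply: (@le_trans _ _ (\sum_(n - i <= j < n) K ^+ 2 * q ^+ n)).
  rewrite big_nat_cond [leRHS]big_nat_cond; apply: ler_sum => j.
  rewrite andbT => /andP[nij jn].
  rewrite normrM; apply: le_trans (ler_pM _ _ (aK _) (bK _)) _ => //.
  have -> : K * q ^+ i * (K * q ^+ j) = K ^+ 2 * q ^+ (i + j).
    by rewrite exprD; ring.
  rewrite ler_wpM2l ?sqr_ge0// ler_wiXn2l ?ltW//.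
  by move: nij (ltn_ord i); lia.
rewrite sumr_const_nat -[leLHS]mulr_natr mulrAC.
rewrite ler_wpM2r//; first by rewrite exprn_ge0// ltW.
rewrite ler_wpM2l ?sqr_ge0// ler_nat.
by move: (ltn_ord i); lia.
Unshelve. all: by end_near. Qed.

Lemma geo_series_bound a (K q : R) : 0 <= K -> 0 < q -> q < 1 ->
  (forall k, `|a k| <= K * q ^+ k) -> forall m,
  `|limn (series a) - series a m| <= K * q ^+ m / (1 - q).
Proof.
move=> K0 q0 q1 aK m.
have ga : geo a by exists K, q.
have h : (fun n => `|series a n - series a m|) @ \oo --> `|limn (series a) - series a m|.
  apply: cvg_norm; apply: cvgB; [exact: geo_cvg|exact: cvg_cst].
rewrite -(cvg_lim (@Rhausdorff R) h).
apply: limr_le; first by apply: cvgP h.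
near=> n.
have mn : (m <= n)%N by near: n; exact: nbhs_infty_ge.
rewrite sub_series_geq//.
apply: le_trans (ler_norm_sum _ _ _) _.
apply: (@le_trans _ _ (\sum_(m <= k < n) K * q ^+ k)).
  by apply: ler_sum => k _; exact: aK.
have -> : \sum_(m <= k < n) K * q ^+ k = K * (q ^+ m - q ^+ n) / (1 - q).
  have : forall d, \sum_(m <= k < m + d) K * q ^+ k = K * (q ^+ m - q ^+ (m + d)) / (1 - q).
    have q1' : 1 - q != 0 by rewrite subr_eq0 gt_eqF.
    elim=> [|d IHd]; first by rewrite addn0 big_geq// subrr mulr0 mul0r.
    rewrite addnS big_nat_recr ?leq_addr//= IHd exprS.
    by field.
  by move=> /(_ (n - m)%N); rewrite subnKC.
rewrite ler_pdivrMr ?subr_gt0// divfK ?subr_eq0 ?gt_eqF// ler_wpM2l//.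
by rewrite gerBl exprn_ge0// ltW.
Unshelve. all: by end_near. Qed.

(** If a k is the first nonzero coefficient, the vanishing sum equates |a k| t^k with a tail of
    order t^(k+1); hence |a k| <= C t for all t in (0, 1], which fails for small t. *)
Lemma pseries_eq0 a : geo a ->
  (forall t : R, 0 < t <= 1 -> limn (pseries a t) = 0) -> forall k, a k = 0.
Proof.
move=> [K [q [K0 q0 q1 aK]]] a0.
elim/ltn_ind => k IHk.
apply/eqP/contraT => ak0.
have [C C0 hC] : exists2 C : R, 0 < C & forall t, 0 < t <= 1 -> `|a k| <= C * t.
  exists (K / (1 - q) + 1); first by rewrite ltr_pwDr// divr_ge0// subr_ge0 ltW.
  move=> t /andP[t0 t1].
  have tp n : 0 <= t ^+ n by rewrite exprn_ge0// ltW.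
  have tk k' : `|a k' * t ^+ k'| <= K * (q * t) ^+ k'.
    rewrite normrM exprMn mulrA [`|t ^+ _|]ger0_norm//.
    by rewrite ler_wpM2r.
  have qt : q * t <= q by rewrite ler_piMr// ltW.
  have qt1 : q * t < 1 by exact: le_lt_trans q1.
  have := geo_series_bound K0 (mulr_gt0 q0 t0) qt1 tk k.+1.
  have := a0 t; rewrite t0 t1 /pseries => -> //.
  rewrite sub0r normrN /series/= big_nat_recr//= big_nat_cond big1 ?add0r; last first.
    by move=> i; rewrite andbT => /IHk ->; rewrite mul0r.
  rewrite normrM [`|t ^+ _|]ger0_norm//.
  rewrite -ler_pdivlMr ?exprn_gt0// => /le_trans; apply.
  have -> : K * (q * t) ^+ k.+1 / (1 - q * t) / t ^+ k =
    K * q ^+ k.+1 * t / (1 - q * t).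
    by rewrite exprMn (exprS t); field; rewrite expf_neq0 ?gt_eqF// subr_gt0.
  rewrite mulrAC (ler_wpM2r (ltW t0))//.
  apply: (@le_trans _ _ (K / (1 - q))); last by rewrite lerDl.
  rewrite -mulrA ler_wpM2l// -[leRHS]mul1r ler_pM//.
  - by rewrite exprn_ge0// ltW.
  - by rewrite invr_ge0 subr_ge0 ltW.
  - by rewrite exprn_ile1// ltW.
  - by rewrite lef_pV2// ?posrE ?subr_gt0// lerB.
have ak : 0 < `|a k| by rewrite normr_gt0.
pose t := Num.min 1 (`|a k| / (2 * C)).
have t0 : 0 < t by rewrite lt_min ltr01/= divr_gt0// mulr_gt0.
have := hC t; rewrite t0 ge_min lexx => /(_ isT).
rewrite leNgt => /negP; case.
apply: (@le_lt_trans _ _ (C * (`|a k| / (2 * C)))).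
  by rewrite ler_pM2l// ge_min lexx orbT.
have -> : C * (`|a k| / (2 * C)) = `|a k| / 2 by field; rewrite gt_eqF.
by rewrite ltr_pdivrMr//; lra.
Qed.

End geometric_sequences.

(** * Complex exponential and logarithm *)

Section complex_numbers.
Context {R : realType}.
Implicit Types z w : R[i].
Local Notation Re := complex.Re.
Local Notation Im := complex.Im.

Lemma Re_add z w : Re (z + w) = Re z + Re w. Proof. by case: z w => ? ? []. Qed.
Lemma Im_add z w : Im (z + w) = Im z + Im w. Proof. by case: z w => ? ? []. Qed.
Lemma Re_opp z : Re (- z) = - Re z. Proof. by case: z. Qed.
Lemma Im_opp z : Im (- z) = - Im z. Proof. by case: z. Qed.
Lemma Re_mul z w : Re (z * w) = Re z * Re w - Im z * Im w.
Proof. by case: z w => ? ? []. Qed.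
Lemma Im_mul z w : Im (z * w) = Re z * Im w + Im z * Re w.
Proof. by case: z w => ? ? []. Qed.

Lemma Re_sum (I : Type) (r : seq I) (P : pred I) (F : I -> R[i]) :
  Re (\sum_(i <- r | P i) F i) = \sum_(i <- r | P i) Re (F i).
Proof. exact: (big_morph _ Re_add). Qed.

Lemma Im_sum (I : Type) (r : seq I) (P : pred I) (F : I -> R[i]) :
  Im (\sum_(i <- r | P i) F i) = \sum_(i <- r | P i) Im (F i).
Proof. exact: (big_morph _ Im_add). Qed.

Lemma eqcP z w : Re z = Re w -> Im z = Im w -> z = w.
Proof. by case: z w => a b [c d] /= -> ->. Qed.

Lemma natC (n : nat) : n%:R = (n%:R)%:C :> R[i].
Proof. by rewrite rmorph_nat. Qed.

Lemma normc_sqrt z : normc z = Num.sqrt (Re z ^+ 2 + Im z ^+ 2).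
Proof. by case: z. Qed.

Lemma normc_ge0 z : 0 <= normc z.
Proof. by rewrite normc_sqrt sqrtr_ge0. Qed.

Lemma Re_le_normc z : `|Re z| <= normc z.
Proof. by rewrite normc_sqrt -sqrtr_sqr ler_wsqrtr// lerDl sqr_ge0. Qed.

Lemma Im_le_normc z : `|Im z| <= normc z.
Proof. by rewrite normc_sqrt -sqrtr_sqr ler_wsqrtr// lerDr sqr_ge0. Qed.

Lemma normc_le_ReIm z : normc z <= `|Re z| + `|Im z|.
Proof.
rewrite normc_sqrt -[leRHS]ger0_norm ?addr_ge0// -sqrtr_sqr ler_wsqrtr//.
rewrite sqrrD !real_normK ?num_real// -addrA lerD2l lerDr.
by rewrite mulrn_wge0// mulr_ge0.
Qed.

Lemma normcD z w : normc (z + w) <= normc z + normc w.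
Proof. exact: le_normcD. Qed.

Lemma normc_sum (I : Type) (r : seq I) (P : pred I) (F : I -> R[i]) :
  normc (\sum_(i <- r | P i) F i) <= \sum_(i <- r | P i) normc (F i).
Proof.
elim/big_ind2 : _ => [|x y u v|//]; first by rewrite normc0.
by move=> xy uv; rewrite (le_trans (normcD _ _))// lerD.
Qed.

Lemma normcX z n : normc (z ^+ n) = normc z ^+ n.
Proof. by elim: n => [|n IHn]; rewrite ?expr0 ?normc1// !exprS normcM IHn. Qed.

Lemma normc_real (x : R) : normc x%:C = `|x|.
Proof. by rewrite normc_sqrt/= expr0n/= addr0 sqrtr_sqr. Qed.

Lemma normc_i : normc ('i%C : R[i]) = 1.
Proof. by rewrite normc_sqrt/= expr0n/= add0r expr1n sqrtr1. Qed.

Lemma normc_nat n : normc (n%:R : R[i]) = n%:R.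
Proof. by rewrite natC normc_real ger0_norm. Qed.

Lemma cexp0 : cexp (0 : R[i]) = 1.
Proof. by rewrite /cexp/= expR0 cos0 sin0 mulr0 mul1r. Qed.

Lemma cexpD z w : cexp (z + w) = cexp z * cexp w.
Proof.
apply: eqcP; rewrite ?Re_mul ?Im_mul /cexp/= Re_add Im_add expRD ?cosD ?sinD; ring.
Qed.

Lemma cexpN z : cexp (- z) * cexp z = 1.
Proof. by rewrite -cexpD addNr cexp0. Qed.

Lemma normc_cexp z : normc (cexp z) = expR (Re z).
Proof.
rewrite normc_sqrt /cexp/= !exprMn -mulrDr cos2Dsin2 mulr1 sqrtr_sqr.
by rewrite ger0_norm// expR_ge0.
Qed.

Lemma cexp_real (x : R) : cexp x%:C = (expR x)%:C.
Proof. by rewrite /cexp/= cos0 sin0 mulr0 mulr1. Qed.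

Lemma cLn_cexp z : `|Im z| < pi -> cLn (cexp z) = z.
Proof.
move=> zpi; apply: eqcP.
  by rewrite -[LHS]/(ln (normc (cexp z))) normc_cexp expRK.
rewrite -[LHS]/(cArg (cexp z)) /cArg normc_cexp.
rewrite -[Re (cexp z)]/(expR (Re z) * cos (Im z)).
rewrite -[Im (cexp z)]/(expR (Re z) * sin (Im z)).
rewrite mulrAC divff ?gt_eqF ?expR_gt0// mul1r.
rewrite pmulr_rge0 ?expR_gt0//.
move: zpi; rewrite ltr_norml => /andP[piz zpi].
have [z0|z0] := leP 0 (Im z).
  rewrite sin_ge0_pi ?z0 ?(ltW zpi)//.
  by rewrite cosK// in_itv/= z0 ltW.
have sz : sin (Im z) < 0.
  by rewrite -oppr_gt0 -sinN sin_gt0_pi// oppr_gt0 z0 ltrNl.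
by rewrite leNgt sz/= cosKN ?opprK// !ltW.
Qed.

End complex_numbers.

(** * Complex power series and the equation e' = b' e *)

Section complex_series.
Context {R : realType}.
Implicit Types (a b e : nat -> R[i]).
Local Notation Re := complex.Re.
Local Notation Im := complex.Im.

Definition cgeo a := exists K q : R,
  [/\ 0 <= K, 0 < q, q < 1 & forall k, normc (a k) <= K * q ^+ k].

(** Summed by components, so that the theory of real series applies directly. *)
Definition csum a : R[i] :=
  limn (series (fun k => Re (a k))) +i* limn (series (fun k => Im (a k))).

Lemma cgeo_Re a : cgeo a -> geo (fun k => Re (a k)).
Proof.
move=> [K [q [K0 q0 q1 aK]]]; exists K, q; split => // k.
exact: le_trans (Re_le_normc _) (aK k).
Qed.

Lemma cgeo_Im a : cgeo a -> geo (fun k => Im (a k)).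
Proof.
move=> [K [q [K0 q0 q1 aK]]]; exists K, q; split => // k.
exact: le_trans (Im_le_normc _) (aK k).
Qed.

Lemma cgeo_leq a b : (forall k, normc (b k) <= normc (a k)) -> cgeo a -> cgeo b.
Proof.
move=> ba [K [q [K0 q0 q1 aK]]]; exists K, q; split => // k.
exact: le_trans (ba k) (aK k).
Qed.

Lemma cgeo_scale a (w : R[i]) : normc w <= 1 -> cgeo a ->
  cgeo (fun k => a k * w ^+ k).
Proof.
move=> w1; apply: cgeo_leq => k.
by rewrite normcM normcX ler_piMr ?normc_ge0// exprn_ile1// normc_ge0.
Qed.

Lemma series_pseries1 (c : nat -> R) : series c = pseries c 1.
Proof.
rewrite /pseries; have -> // : (fun i => c i * 1 ^+ i) = c.
by apply/funext => k; rewrite expr1n mulr1.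
Qed.

(** The recursion says e' = b' e for the power series with coefficients e and b. Along the real
    segment from 0 to 1 the derivative of e exp(-b) therefore vanishes, and its value at 0 is 1 by
    the initial condition. *)
Lemma csum_cexp e b : cgeo e -> cgeo b -> e 0%N = cexp (b 0%N) ->
  (forall k, k.+1%:R * e k.+1 = \sum_(j < k.+1) j.+1%:R * b j.+1 * e (k - j)%N) ->
  csum e = cexp (csum b).
Proof.
move=> ge gb e0 rec.
pose e1 k := Re (e k); pose e2 k := Im (e k).
pose b1 k := Re (b k); pose b2 k := Im (b k).
have ge1 : geo e1 by exact: cgeo_Re.
have ge2 : geo e2 by exact: cgeo_Im.
have gb1 : geo b1 by exact: cgeo_Re.
have gb2 : geo b2 by exact: cgeo_Im.
pose S c x : R := limn (pseries c x).
(* [d1] and [d2] are the real and imaginary parts of e' = b' e at real x; the Cauchy product turns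
   the recursion into an equation between sums. *)
have d1 (x : R) : `|x| <= 1 -> S (pseries_diffs e1) x =
    S (pseries_diffs b1) x * S e1 x - S (pseries_diffs b2) x * S e2 x.
  move=> x1.
  have h1 := cauchy_product (geo_scale x1 (geo_diffs gb1)) (geo_scale x1 ge1).
  have h2 := cauchy_product (geo_scale x1 (geo_diffs gb2)) (geo_scale x1 ge2).
  apply: cvg_lim => //; apply: cvg_trans (cvgB h1 h2).
  apply: near_eq_cvg; near=> n => /=.
  rewrite fctE /pseries /series/= -sumrB; apply: eq_bigr => k _.
  rewrite -sumrB /pseries_diffs.
  have := congr1 (@complex.Re R) (rec k); rewrite Re_sum !natC Re_mul/= mul0r subr0 /e1 => ->.
  rewrite mulr_suml; apply: eq_bigr => j _.
  have -> : x ^+ k = x ^+ j * x ^+ (k - j).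
    by rewrite -exprD subnKC// -ltnS.
  by rewrite !natC !Re_mul !Im_mul/= /b1 /b2 /e2; ring.
have d2 (x : R) : `|x| <= 1 -> S (pseries_diffs e2) x =
    S (pseries_diffs b1) x * S e2 x + S (pseries_diffs b2) x * S e1 x.
  move=> x1.
  have h1 := cauchy_product (geo_scale x1 (geo_diffs gb1)) (geo_scale x1 ge2).
  have h2 := cauchy_product (geo_scale x1 (geo_diffs gb2)) (geo_scale x1 ge1).
  apply: cvg_lim => //; apply: cvg_trans (cvgD h1 h2).
  apply: near_eq_cvg; near=> n => /=.
  rewrite fctE /pseries /series/= -big_split/=; apply: eq_bigr => k _.
  rewrite -big_split/= /pseries_diffs.
  have := congr1 (@complex.Im R) (rec k); rewrite Im_sum !natC Im_mul/= mul0r addr0 /e2 => ->.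
  rewrite mulr_suml; apply: eq_bigr => j _.
  have -> : x ^+ k = x ^+ j * x ^+ (k - j).
    by rewrite -exprD subnKC// -ltnS.
  by rewrite !natC !Im_mul !Re_mul/= /b1 /b2 /e1; ring.
(* [H1] and [H2] are the real and imaginary parts of e exp(-b). *)
pose H1 (x : R) := expR (- S b1 x) * (S e1 x * cos (S b2 x) + S e2 x * sin (S b2 x)).
pose H2 (x : R) := expR (- S b1 x) * (S e2 x * cos (S b2 x) - S e1 x * sin (S b2 x)).
have D c (x : R) : geo c -> `|x| <= 1 -> is_derive x (1:R) (S c) (S (pseries_diffs c) x).
  by move=> gc x1; exact: geo_is_derive.
have dH1 (x : R) : `|x| <= 1 -> is_derive x (1:R) H1 0.
  move=> x1.
  have De1 := D _ _ ge1 x1; have De2 := D _ _ ge2 x1.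
  have Db1 := D _ _ gb1 x1; have Db2 := D _ _ gb2 x1.
  have Dc := is_derive1_comp (is_derive_cos (S b2 x)) Db2.
  have Ds := is_derive1_comp (is_derive_sin (S b2 x)) Db2.
  have Dx := @is_derive1_comp _ expR (- S b1) x _ _
    (is_derive_expR ((- S b1) x)) (is_deriveN Db1).
  apply: is_derive_eq.
  rewrite (d1 _ x1) (d2 _ x1) /GRing.scale/= -[(- S b1) x]/(- S b1 x).
  ring.
have dH2 (x : R) : `|x| <= 1 -> is_derive x (1:R) H2 0.
  move=> x1.
  have De1 := D _ _ ge1 x1; have De2 := D _ _ ge2 x1.
  have Db1 := D _ _ gb1 x1; have Db2 := D _ _ gb2 x1.
  have Dc := is_derive1_comp (is_derive_cos (S b2 x)) Db2.
  have Ds := is_derive1_comp (is_derive_sin (S b2 x)) Db2.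
  have Dx := @is_derive1_comp _ expR (- S b1) x _ _
    (is_derive_expR ((- S b1) x)) (is_deriveN Db1).
  apply: is_derive_eq.
  rewrite (d1 _ x1) (d2 _ x1) /GRing.scale/= -[(- S b1) x]/(- S b1 x).
  ring.
have cst (H : R -> R) : (forall x : R, `|x| <= 1 -> is_derive x (1:R) H 0) -> H 1 = H 0.
  move=> dH.
  have [||c _] := @MVT R H (fun=> 0) 0 1 ltr01; last first.
  - by rewrite mul0r => /eqP; rewrite subr_eq0 => /eqP.
  - apply: derivable_within_continuous => x; rewrite in_itv/= => /andP[x0 x1].
    by have [] : is_derive x (1:R) H 0 by apply: dH; rewrite ger0_norm.
  - move=> x; rewrite in_itv/= => /andP[x0 x1].
    by apply: dH; rewrite ger0_norm ltW.
have S0 c : S c 0 = c 0%N.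
  apply: cvg_lim => //; apply: cvg_near_cst; near=> n.
  have n0 : (0 < n)%N by near: n; exact: nbhs_infty_gt.
  rewrite /pseries /series/= big_ltn// big_nat_cond big1 ?addr0 ?expr0 ?mulr1//.
  by move=> i /andP[/andP[i0 _] _]; rewrite expr0n gtn_eqF// mulr0.
have := cst _ dH1; have := cst _ dH2; rewrite /H1 /H2 !S0.
have -> : expR (- b1 0%N) * (e2 0%N * cos (b2 0%N) - e1 0%N * sin (b2 0%N)) = 0.
  by rewrite /e1 /e2 e0 /cexp/= -/(b1 0%N) -/(b2 0%N); ring.
have -> : expR (- b1 0%N) * (e1 0%N * cos (b2 0%N) + e2 0%N * sin (b2 0%N)) = 1.
  rewrite /e1 /e2 e0 /cexp/= -/(b1 0%N) -/(b2 0%N).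
  transitivity (expR (- b1 0%N) * expR (b1 0%N) * (cos (b2 0%N) ^+ 2 + sin (b2 0%N) ^+ 2)); first by ring.
  by rewrite -expRD addNr expR0 cos2Dsin2 mul1r.
move=> h2 h1.
have hh : csum e * cexp (- csum b) = 1.
  apply: eqcP; rewrite ?Re_mul ?Im_mul /csum /cexp/= cosN sinN.
  - by rewrite !series_pseries1 -[RHS]h1 /S; ring.
  - by rewrite !series_pseries1 -[RHS]h2 /S; ring.
by rewrite -[LHS]mulr1 -(cexpN (csum b)) mulrA hh mul1r.
Unshelve. all: by end_near. Qed.

End complex_series.

(** * Exponential and logarithm of a power series *)

Section exponential_logarithm_series.
Context {R : realType}.
Implicit Types (a b e : nat -> R[i]) (z w u : R[i]).
Local Notation Re := complex.Re.
Local Notation Im := complex.Im.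

Lemma inv2_gt0 : 0 < 2^-1 :> R. Proof. by rewrite invr_gt0. Qed.
Lemma inv2_lt1 : 2^-1 < 1 :> R. Proof. by rewrite invf_lt1// ltr1n. Qed.

Lemma pow_fact_le (x : R) k : 0 <= x -> x ^+ k / k`!%:R <= expR x.
Proof.
move=> x0; have h : cvgn (series (exp_coeff x)) := is_cvg_series_exp_coeff x.
apply: (@le_trans _ _ (series (exp_coeff x) k.+1)).
  rewrite /series/= big_nat_recr//= /exp_coeff/= lerDr sumr_ge0// => i _.
  by rewrite divr_ge0// exprn_ge0.
apply: nondecreasing_cvgn_le => //.
apply: nondecreasing_series => n _ _.
by rewrite /exp_coeff/= divr_ge0// exprn_ge0.
Qed.

(** The bound is a single term of the exponential series at 2 |z|, divided by 2^k. *)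
Lemma cgeo_exp z : cgeo (fun k => z ^+ k / k`!%:R).
Proof.
exists (expR (2 * normc z)), 2^-1; split.
- by rewrite expR_ge0.
- exact: inv2_gt0.
- exact: inv2_lt1.
move=> k; have z0 : 0 <= 2 * normc z by rewrite mulr_ge0// normc_ge0.
have := pow_fact_le k z0; rewrite normcM normcV normc_nat normcX exprVn.
rewrite ler_pdivlMr ?exprn_gt0//; congr (_ <= _).
by rewrite exprMn; ring.
Qed.

Lemma csum_exp z : csum (fun k => z ^+ k / k`!%:R) = cexp z.
Proof.
(* The exponential series is the case of [csum_cexp] in which b is the single monomial z w. *)
pose b k : R[i] := if k == 1%N then z else 0.
have gb : cgeo b.
  exists (2 * normc z), 2^-1; split.
  - by rewrite mulr_ge0// normc_ge0.
  - exact: inv2_gt0.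
  - exact: inv2_lt1.
  have pos k : 0 <= 2 * normc z * 2^-1 ^+ k.
    by rewrite !mulr_ge0 ?exprn_ge0 ?invr_ge0 ?normc_ge0.
  move=> k; rewrite /b; case: eqP => [->|_]; last by rewrite normc0.
  by rewrite expr1 mulrAC divff ?mul1r.
have cb (f : R[i] -> R) : f 0 = 0 -> limn (series (fun k => f (b k))) = f z.
  move=> f0; apply: cvg_lim => //; apply: cvg_near_cst; near=> n.
  have n0 : (1 < n)%N by near: n; exact: nbhs_infty_gt.
  rewrite /series/= big_ltn ?(ltnW n0)// big_ltn// /b/= f0 add0r.
  rewrite big_nat_cond big1 ?addr0// => i /andP[/andP[i0 _] _].
  by rewrite (gtn_eqF i0).
rewrite (csum_cexp (cgeo_exp z) gb).
- congr cexp; apply: eqcP; rewrite /csum /=; exact: cb.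
- by rewrite /b/= expr0 fact0 divr1 cexp0.
move=> k; rewrite big_ord_recl/= big1; last by move=> i _; rewrite /b/= mulr0 mul0r.
rewrite /b/= subn0 mul1r addr0 factS natrM exprS invfM.
have k0 : k.+1%:R != 0 :> R[i] by rewrite pnatr_eq0.
have f0 : k`!%:R != 0 :> R[i] by rewrite pnatr_eq0 -lt0n fact_gt0.
transitivity (k.+1%:R / k.+1%:R * (z * (z ^+ k / k`!%:R))).
  by move: (k.+1%:R) => c; ring.
by rewrite divff// mul1r.
Unshelve. all: by end_near. Qed.

(** The series of - ln (1 - u). At k = 0 the quotient by zero is 0, so there is no constant term to
    treat apart. *)
Definition log_coeff u (k : nat) : R[i] := u ^+ k / k%:R.

Lemma log_coeff_le u k : normc (log_coeff u k) <= normc u ^+ k.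
Proof.
rewrite /log_coeff normcM normcX normcV normc_nat.
case: k => [|k]; first by rewrite invr0 mulr0 expr0.
by rewrite ler_piMr ?exprn_ge0 ?normc_ge0// invf_le1 ?ltr0n// ler1n.
Qed.

Lemma log_coeff0 u : log_coeff u 0 = 0.
Proof. by rewrite /log_coeff invr0 mulr0. Qed.

Lemma inv4_gt0 : 0 < 4^-1 :> R. Proof. by rewrite invr_gt0. Qed.
Lemma inv4_lt1 : 4^-1 < 1 :> R. Proof. by rewrite invf_lt1// ltr1n. Qed.

Lemma log_coeff_quarter u k : normc u <= 4^-1 ->
  normc (log_coeff u k) <= 1 * 4^-1 ^+ k.
Proof.
move=> u4; rewrite mul1r; apply: le_trans (log_coeff_le _ _) _.
by rewrite lerXn2r// nnegrE ?normc_ge0// invr_ge0.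
Qed.

Lemma cgeo_log u : normc u <= 4^-1 -> cgeo (log_coeff u).
Proof.
move=> u4; exists 1, 4^-1; split => //.
- exact: inv4_lt1.
- by move=> k; exact: log_coeff_quarter.
Qed.

Lemma normc_quarter_neq1 u : normc u <= 4^-1 -> 1 - u != 0.
Proof.
move=> u4; rewrite subr_eq0; apply/eqP => u1.
by move: u4; rewrite -u1 normc1 leNgt inv4_lt1.
Qed.

(** For b = [log_coeff u] one has (k+1) b_(k+1) = u^(k+1), so the sequence u^k solves the recursion
    of [csum_cexp]; its sum is 1 / (1 - u). *)
Lemma cexp_log u : normc u <= 4^-1 -> cexp (csum (log_coeff u)) = (1 - u)^-1.
Proof.
move=> u4; have u1 := normc_quarter_neq1 u4.
have ge : cgeo (fun k => u ^+ k).
  exists 1, 4^-1; split => //; first exact: inv4_lt1.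
  move=> k; rewrite mul1r normcX lerXn2r// nnegrE ?normc_ge0//.
rewrite -(csum_cexp ge (cgeo_log u4)).
- apply: (mulIf u1); rewrite mulVf//.
  have p (n : nat) : (\sum_(0 <= k < n) u ^+ k) * (1 - u) = 1 - u ^+ n.
    rewrite big_mkord -[1 in RHS](expr1n _ n) subrXX mulrC.
    by congr (_ * _); apply: eq_bigr => i _; rewrite expr1n mul1r.
  have R1 := geo_cvg (cgeo_Re ge); have I1 := geo_cvg (cgeo_Im ge).
  have R0 := cvg_series_cvg_0 R1; have I0 := cvg_series_cvg_0 I1.
  pose sR n : R := series (fun k => Re (u ^+ k)) n.
  pose sI n : R := series (fun k => Im (u ^+ k)) n.
  apply: eqcP; rewrite ?Re_mul ?Im_mul /csum /= ?Re_add ?Im_add ?Re_opp ?Im_opp /=.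
  + have h : (sR n * (1 - Re u) - sI n * (0 - Im u)) @[n --> \oo] -->
       limn (series (fun k => Re (u ^+ k))) * (1 - Re u) -
       limn (series (fun k => Im (u ^+ k))) * (0 - Im u).
      by apply: cvgB; apply: cvgMl; [exact: R1|exact: I1].
    rewrite -(cvg_lim (@Rhausdorff R) h); apply: cvg_lim => //.
    have h2 : (1 - Re (u ^+ n)) @[n --> \oo] --> (1 - 0 : R).
      by apply: cvgB => //; exact: cvg_cst.
    rewrite subr0 in h2.
    apply: cvg_trans h2; apply: near_eq_cvg; near=> n.
    have := congr1 (@complex.Re R) (p n); rewrite Re_mul Re_sum Im_sum.
    by rewrite !Re_add !Im_add !Re_opp !Im_opp => <-.
  + have h : (sR n * (0 - Im u) + sI n * (1 - Re u)) @[n --> \oo] -->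
       limn (series (fun k => Re (u ^+ k))) * (0 - Im u) +
       limn (series (fun k => Im (u ^+ k))) * (1 - Re u).
      by apply: cvgD; apply: cvgMl; [exact: R1|exact: I1].
    rewrite -(cvg_lim (@Rhausdorff R) h); apply: cvg_lim => //.
    have h2 : (0 - Im (u ^+ n)) @[n --> \oo] --> (0 - 0 : R).
      by apply: cvgB => //; exact: cvg_cst.
    rewrite subr0 in h2.
    apply: cvg_trans h2; apply: near_eq_cvg; near=> n.
    have := congr1 (@complex.Im R) (p n); rewrite Im_mul Re_sum Im_sum.
    by rewrite !Re_add !Im_add !Re_opp !Im_opp => <-.
- by rewrite expr0 log_coeff0 cexp0.
- move=> k; rewrite (eq_bigr (fun=> u ^+ k.+1)); last first.
    move=> j _; rewrite /log_coeff mulrCA divff ?mulr1 ?pnatr_eq0//.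
    by rewrite -exprD addSn subnKC// -ltnS.
  by rewrite sumr_const card_ord -[RHS]mulr_natl.
Unshelve. all: by end_near. Qed.

(** The tail after the zero constant term is at most (1/4) / (1 - 1/4) = 1/3. With the bound 1/2,
    even two imaginary parts add up to less than pi, which makes the main branch additive in
    [cLn_log]. *)
Lemma Re_Im_log u : normc u <= 4^-1 ->
  `|Re (csum (log_coeff u))| <= 2^-1 /\ `|Im (csum (log_coeff u))| <= 2^-1.
Proof.
move=> u4.
have H (g : R[i] -> R) : g 0 = 0 -> (forall z, `|g z| <= normc z) ->
    `|limn (series (fun k => g (log_coeff u k)))| <= 2^-1.
  move=> g0 gn; have h k : `|g (log_coeff u k)| <= 1 * 4^-1 ^+ k.
    exact: le_trans (gn _) (log_coeff_quarter k u4).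
  have := geo_series_bound ler01 inv4_gt0 inv4_lt1 h 1.
  rewrite /series/= big_nat1 log_coeff0 g0 subr0 => /le_trans; apply.
  by rewrite expr1 mul1r ler_pdivrMr ?subr_gt0 ?inv4_lt1//; lra.
by split; apply: H => //; [exact: Re_le_normc|exact: Im_le_normc].
Qed.

Lemma cLn_log1 u : normc u <= 4^-1 -> cLn (1 - u)^-1 = csum (log_coeff u).
Proof.
move=> u4; rewrite -cexp_log// cLn_cexp//.
by have [_ /le_lt_trans] := Re_Im_log u4; apply; have := pi_ge2 R; lra.
Qed.

Lemma cLn_log u0 u1 : normc u0 <= 4^-1 -> normc u1 <= 4^-1 ->
  cLn ((1 - u0)^-1 * (1 - u1)^-1) = csum (log_coeff u0) + csum (log_coeff u1).
Proof.
move=> u04 u14; rewrite -!cexp_log// -cexpD cLn_cexp// Im_add.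
rewrite (le_lt_trans (ler_normD _ _))//.
apply: (@le_lt_trans _ _ (2^-1 + 2^-1)); first by rewrite lerD//; apply: (Re_Im_log _).2.
by have := pi_ge2 R; lra.
Qed.

(** Only real points are compared: t^k is then real, and real and imaginary parts reduce to
    [pseries_eq0]. Equal coefficients give equal sums at complex points too. *)
Lemma csum_pseries_inj a b : cgeo a -> cgeo b ->
  (forall t : R, 0 < t <= 1 ->
    csum (fun k => a k * t%:C ^+ k) = csum (fun k => b k * t%:C ^+ k)) ->
  a =1 b.
Proof.
move=> ga gb ab k.
have rc (t : R) j : t%:C ^+ j = (t ^+ j)%:C by rewrite rmorphXn.
have H (f : R[i] -> R) : geo (fun k => f (a k)) -> geo (fun k => f (b k)) ->
  (forall t : R, 0 < t <= 1 ->
    limn (series (fun k => f (a k) * t ^+ k)) = limn (series (fun k => f (b k) * t ^+ k))) ->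
  f (a k) = f (b k).
  move=> gfa gfb fab; apply/eqP; rewrite -subr_eq0; apply/eqP.
  pose c k := 1 * f (a k) + (-1) * f (b k).
  have -> : f (a k) - f (b k) = c k by rewrite /c mul1r mulN1r.
  apply: (pseries_eq0 (geo_lin 1 (-1) gfa gfb)) => t t01.
  have t1 : `|t| <= 1 by case/andP: t01 => t0 ?; rewrite gtr0_norm.
  have h : series (fun k => f (a k) * t ^+ k) n - series (fun k => f (b k) * t ^+ k) n @[n --> \oo] -->
     limn (series (fun k => f (a k) * t ^+ k)) - limn (series (fun k => f (b k) * t ^+ k)).
    by apply: cvgB; apply: geo_cvg; exact: geo_scale.
  rewrite (fab _ t01) subrr in h.
  apply: cvg_lim => //; apply: cvg_trans h; apply: near_eq_cvg; near=> n.
  rewrite /pseries /series/= -sumrB; apply: eq_bigr => j _.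
  by rewrite mul1r mulN1r mulrBl.
apply: eqcP; apply: H.
- exact: cgeo_Re.
- exact: cgeo_Re.
- move=> t t01; have := congr1 (@complex.Re R) (ab t t01); rewrite /csum/=.
  have E (c : nat -> R[i]) : (fun k => Re (c k * t%:C ^+ k)) = (fun k => Re (c k) * t ^+ k).
    by apply/funext => j; rewrite rc Re_mul/= mulr0 subr0.
  by rewrite !E.
- exact: cgeo_Im.
- exact: cgeo_Im.
- move=> t t01; have := congr1 (@complex.Im R) (ab t t01); rewrite /csum/=.
  have E (c : nat -> R[i]) : (fun k => Im (c k * t%:C ^+ k)) = (fun k => Im (c k) * t ^+ k).
    by apply/funext => j; rewrite rc Im_mul/= mulr0 add0r.
  by rewrite !E.
Unshelve. all: by end_near. Qed.

Lemma strong_recursion (T : Type) (x0 : T) (F : nat -> (nat -> T) -> T) :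
  exists e : nat -> T,
    forall k, e k = F k (fun j => if (j < k)%N then e j else x0).
Proof.
(* [g n] tabulates the first n values, with x0 beyond them; the solution reads its j-th value off
   the table of length j + 1. *)
pose g := fix g n : nat -> T := if n is m.+1 then
  (fun j => if j == m then F m (g m) else g m j) else (fun=> x0).
have gE n : g n = (fun j => if (j < n)%N then g j.+1 j else x0).
  elim: n => [//|n IHn]; apply/funext => j /=.
  rewrite eqxx ltnS; have [->|jn] := eqVneq j n; first by rewrite leqnn.
  by rewrite IHn [LHS]/= eqxx ltn_neqAle jn.
by exists (fun j => g j.+1 j) => k /=; rewrite eqxx -gE.
Qed.

(* The coefficients come from e' = b' e, read as a recursion. *)
Lemma exp_pseries b (A B : R) : 0 <= A -> 0 < B -> B * (1 + A) < 1 ->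
  (forall k, k.+1%:R * normc (b k.+1) <= A * B ^+ k.+1) ->
  exists2 e, cgeo e & forall w, normc w <= 1 ->
    csum (fun k => e k * w ^+ k) = cexp (csum (fun k => b k * w ^+ k)).
Proof.
move=> A0 B0 BA1 bAB.
have L0 : 0 < B * (1 + A) by rewrite mulr_gt0// ltr_wpDr.
have [e eE] := @strong_recursion R[i] 0 (fun k g => if k is k'.+1 then
  k'.+1%:R^-1 * (\sum_(j < k'.+1) j.+1%:R * b j.+1 * g (k' - j)%N)
  else cexp (b 0%N)).
have e0 : e 0%N = cexp (b 0%N) by rewrite eE.
have rec k : k.+1%:R * e k.+1 = \sum_(j < k.+1) j.+1%:R * b j.+1 * e (k - j)%N.
  rewrite eE mulrA divff ?pnatr_eq0// mul1r; apply: eq_bigr => j _.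
  by rewrite ltnS leq_subr.
pose M := normc (e 0%N).
have eM k : normc (e k) <= M * (B * (1 + A)) ^+ k.
  elim/ltn_ind: k => -[_|k IHk]; first by rewrite expr0 mulr1.
  rewrite -(ler_pM2l (ltr0Sn R k)).
  have -> : k.+1%:R * normc (e k.+1) = normc (k.+1%:R * e k.+1).
    by rewrite normcM normc_nat.
  rewrite rec; apply: le_trans (normc_sum _ _ _) _.
  apply: (@le_trans _ _ (\sum_(j < k.+1) A * B ^+ j.+1 * (M * (B * (1 + A)) ^+ (k - j)))).
    apply: ler_sum => j _; rewrite normcM normcM normc_nat.
    by apply: ler_pM => //; rewrite ?normc_ge0// ?mulr_ge0 ?normc_ge0// IHk// ltnS leq_subr.
  (* The sum telescopes because B (1 + A) - B = A B; this is the origin of the ratio B (1 + A). *)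
  have -> : \sum_(j < k.+1) A * B ^+ j.+1 * (M * (B * (1 + A)) ^+ (k - j)) =
    M * ((B * (1 + A)) ^+ k.+1 - B ^+ k.+1).
    rewrite subrXX mulrA mulr_sumr; apply: eq_bigr => j _.
    by rewrite exprS -pred_Sn; ring.
  rewrite mulrCA ler_wpM2l ?normc_ge0//.
  apply: (@le_trans _ _ ((B * (1 + A)) ^+ k.+1)).
    by rewrite gerBl exprn_ge0// ltW.
  by rewrite ler_peMl ?ler1n// exprn_ge0// ltW.
have ge : cgeo e.
  by exists M, (B * (1 + A)); split => //; rewrite /M normc_ge0.
have B1 : B < 1 by apply: le_lt_trans BA1; rewrite ler_peMr ?(ltW B0)// lerDl.
have gb : cgeo b.
  exists (A + normc (b 0%N)), B; split => //; first by rewrite addr_ge0// normc_ge0.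
  move=> [|k]; first by rewrite expr0 mulr1 lerDr.
  apply: (@le_trans _ _ (A * B ^+ k.+1)).
    apply: le_trans (bAB k); rewrite ler_peMl ?normc_ge0// ler1n//.
  by rewrite ler_wpM2r ?exprn_ge0 ?(ltW B0)// lerDl normc_ge0.
exists e => // w w1.
apply: csum_cexp; [exact: cgeo_scale|exact: cgeo_scale|by rewrite !expr0 !mulr1|].
move=> k; rewrite mulrA rec mulr_suml; apply: eq_bigr => j _.
have -> : w ^+ k.+1 = w ^+ j.+1 * w ^+ (k - j).
  by rewrite -exprD addSn subnKC// -ltnS.
ring.
Qed.

(** The recursion for e' = b' e solved for b: since e 0 = 1, its top term isolates (k+1) b_(k+1).
    This produces a logarithm as a power series without choosing a branch. *)
Lemma log_pseries e (M Q : R) : 0 <= M -> 0 < Q -> Q * (2 + M) < 1 ->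
  e 0%N = 1 -> (forall k, normc (e k) <= M * Q ^+ k) ->
  exists b, [/\ b 0%N = 0, cgeo b & forall w, normc w <= 1 ->
    csum (fun k => e k * w ^+ k) = cexp (csum (fun k => b k * w ^+ k))].
Proof.
move=> M0 Q0 QM1 e0 eM.
have L0 : 0 < Q * (2 + M) by rewrite mulr_gt0// ltr_wpDr.
have [b bE] := @strong_recursion R[i] 0 (fun k g => if k is k'.+1 then
  k'.+1%:R^-1 * (k'.+1%:R * e k'.+1 - \sum_(j < k') j.+1%:R * g j.+1 * e (k' - j)%N)
  else 0).
have b0 : b 0%N = 0 by rewrite bE.
have bS k : k.+1%:R * b k.+1 = k.+1%:R * e k.+1 - \sum_(j < k) j.+1%:R * b j.+1 * e (k - j)%N.
  rewrite bE mulrA divff ?pnatr_eq0// mul1r; congr (_ - _); apply: eq_bigr => j _.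
  by rewrite ltnS ltn_ord.
have rec k : k.+1%:R * e k.+1 = \sum_(j < k.+1) j.+1%:R * b j.+1 * e (k - j)%N.
  by rewrite big_ord_recr/= bS subnn e0 mulr1 addrCA subrr addr0.
(* Closes the growth estimate of b with ratio Q (2 + M): the M pays for the sum over earlier
   coefficients, the 2 absorbs the factor k+1 of e_(k+1). *)
have num k : k.+1%:R + M * \sum_(j < k) (2 + M) ^+ j.+1 <= (2 + M) ^+ k.+1.
  elim: k => [|k IHk]; first by rewrite big_ord0 mulr0 addr0 expr1; lra.
  rewrite big_ord_recr/= -[k.+2%:R]natr1 mulrDr [leRHS]exprS.
  have := exprn_ege1 k.+1 (_ : 1 <= 2 + M).
  have -> : 1 <= 2 + M by lra.
  by move=> /(_ isT); nra.
have bM k : k.+1%:R * normc (b k.+1) <= M * (Q * (2 + M)) ^+ k.+1.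
  elim/ltn_ind: k => k IHk.
  have -> : k.+1%:R * normc (b k.+1) = normc (k.+1%:R * b k.+1).
    by rewrite normcM normc_nat.
  rewrite bS; apply: le_trans (normcD _ _) _; rewrite normcN.
  apply: (@le_trans _ _ (k.+1%:R * (M * Q ^+ k.+1) +
      \sum_(j < k) M * (Q * (2 + M)) ^+ j.+1 * (M * Q ^+ (k - j)))).
    apply: lerD; first by rewrite normcM normc_nat ler_wpM2l.
    apply: le_trans (normc_sum _ _ _) _; apply: ler_sum => j _.
    rewrite normcM normcM normc_nat.
    by apply: ler_pM => //; rewrite ?normc_ge0// ?mulr_ge0 ?normc_ge0// IHk.
  have -> : \sum_(j < k) M * (Q * (2 + M)) ^+ j.+1 * (M * Q ^+ (k - j)) =
     M * Q ^+ k.+1 * (M * \sum_(j < k) (2 + M) ^+ j.+1).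
    rewrite !mulr_sumr; apply: eq_bigr => j _.
    have -> : Q ^+ k.+1 = Q ^+ j.+1 * Q ^+ (k - j).
      by rewrite -exprD addSn subnKC// ltnW.
    by rewrite exprMn; ring.
  rewrite [k.+1%:R * _]mulrC -mulrDr exprMn mulrA ler_wpM2l//.
  by rewrite mulr_ge0// exprn_ge0// ltW.
have ge : cgeo e.
  exists M, Q; split => //.
  by apply: le_lt_trans QM1; rewrite ler_peMr ?(ltW Q0)//; lra.
have gb : cgeo b.
  exists M, (Q * (2 + M)); split => //.
  move=> [|k]; first by rewrite b0 normc0 expr0 mulr1.
  by apply: le_trans (bM k); rewrite ler_peMl ?normc_ge0// ler1n.
exists b; split => // w w1.
apply: csum_cexp; [exact: cgeo_scale|exact: cgeo_scale| |].
  by rewrite !expr0 !mulr1 b0 cexp0.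
move=> k; rewrite mulrA rec mulr_suml; apply: eq_bigr => j _.
have -> : w ^+ k.+1 = w ^+ j.+1 * w ^+ (k - j).
  by rewrite -exprD addSn subnKC// -ltnS.
ring.
Qed.

(** Odd powers cancel in the average over t and -t. Applied to the exponential series, the identity
    produces partial sums of cosh. *)
Lemma even_part_sum (p : nat -> R) (t : R) n :
  \sum_(k < n) p (2 * k.+1)%N * t ^+ (2 * k.+1) =
    (series (fun k => p k * t ^+ k) (2 * n.+1)%N +
     series (fun k => p k * (- t) ^+ k) (2 * n.+1)%N) / 2 - p 0%N.
Proof.
elim: n => [|n IHn].
  by rewrite big_ord0 /series/= muln1 !big_nat_recr//= !big_geq//; field.
have E : (2 * n.+2)%N = (2 * n.+1).+2 by rewrite mulnS.
rewrite big_ord_recr/= IHn E.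
have : (- t) ^+ (2 * n.+1) = t ^+ (2 * n.+1) by rewrite !exprM sqrrN.
move: (2 * n.+1)%N => m tm.
by rewrite /series/= ![in RHS]big_nat_recr//= !exprS tm; field.
Qed.

(* An even sum has vanishing odd coefficients; averaging over [t] and [-t] avoids proving it. *)
Lemma even_pseries_approx (p : nat -> R) (f : R -> R) (K q : R) :
  0 <= K -> 0 < q -> q < 1 -> (forall k, `|p k| <= K * q ^+ k) -> p 0%N = 0 ->
  (forall t : R, `|t| <= 1 -> f t = limn (pseries p t)) ->
  (forall t, f (- t) = f t) ->
  forall (n : nat) (t : R), 0 < t <= 1 ->
  `|f t - \sum_(k < n) p (2 * k.+1)%N * t ^+ (2 * k.+1)| <=
    K / (1 - q) * q ^+ (2 * n.+1) * t ^+ (2 * n.+1).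
Proof.
move=> K0 q0 q1 pK p0 fp fN n t /andP[t0 t1].
have bnd (s : R) : `|s| = t -> `|f s - series (fun k => p k * s ^+ k) (2 * n.+1)%N| <=
    K / (1 - q) * q ^+ (2 * n.+1) * t ^+ (2 * n.+1).
  move=> st; rewrite fp ?st//.
  have tk k : `|p k * s ^+ k| <= K * (q * t) ^+ k.
    by rewrite normrM normrX st exprMn mulrA ler_wpM2r// exprn_ge0// ltW.
  have qt : q * t <= q by rewrite ler_piMr// ltW.
  have qt1 : q * t < 1 by exact: le_lt_trans q1.
  apply: le_trans (geo_series_bound K0 (mulr_gt0 q0 t0) qt1 tk _) _.
  rewrite exprMn mulrAC -[leRHS]mulrA ler_wpM2r//.
    by rewrite mulr_ge0// exprn_ge0// ltW.
  by rewrite ler_wpM2l// lef_pV2 ?posrE ?subr_gt0// lerB.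
rewrite even_part_sum p0 subr0.
have -> : f t = (f t + f (- t)) / 2 by rewrite fN; field.
have h1 := bnd t (gtr0_norm t0).
have h2 := bnd (- t); rewrite normrN gtr0_norm// in h2; have {}h2 := h2 erefl.
rewrite -mulrBl opprD addrACA normrM [`|2^-1|]gtr0_norm ?inv2_gt0// ler_pdivrMr//.
rewrite (le_trans (ler_normD _ _))//; lra.
Qed.

End exponential_logarithm_series.

(** * Integrals of complex-valued functions *)

Section complex_integrals.
Context {dd : measure_display} {T : measurableType dd} {R : realType}.
Variables (mu : {measure set T -> \bar R}) (D : set T) (mD : measurable D).
Implicit Types (f g : T -> R[i]) (h : T -> R).
Local Notation Re := complex.Re.
Local Notation Im := complex.Im.

(** Writes 1/h as h times 1/h^2 = exp (- ln (h^2)), a composition of measurable functions; where h =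
    0 the prefactor gives 0, which is also the value of the inverse. *)
Lemma measurable_inv h : measurable_fun D h -> measurable_fun D (fun x => (h x)^-1).
Proof.
move=> mh.
have -> : (fun x => (h x)^-1) = (fun x => h x * expR (- ln (h x ^+ 2))).
  apply/funext => x; have [->|h0] := eqVneq (h x) 0; first by rewrite invr0 mul0r.
  rewrite expRN lnK; last by rewrite posrE exprn_even_gt0.
  by rewrite expr2 invfM mulrA divff// mul1r.
apply: measurable_funM => //; apply: measurableT_comp => //.
have m2 : measurable_fun D (fun x => h x ^+ 2) by exact: measurable_funX.
have m3 : measurable_fun D (fun x => ln (h x ^+ 2)) :=
  measurableT_comp (@measurable_ln R) m2.
exact: measurable_funN m3.
Qed.

Definition cmeasurable f :=
  measurable_fun D (fun x => Re (f x)) /\ measurable_fun D (fun x => Im (f x)).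

Lemma cmeasurable_cst (c : R[i]) : cmeasurable (fun=> c).
Proof. by split; exact: measurable_cst. Qed.

Lemma cmeasurable_real h : measurable_fun D h -> cmeasurable (fun x => (h x)%:C).
Proof. by split => //=; exact: measurable_cst. Qed.

Lemma cmeasurableD f g : cmeasurable f -> cmeasurable g ->
  cmeasurable (fun x => f x + g x).
Proof.
move=> [f1 f2] [g1 g2]; split.
- have -> : (fun x => Re (f x + g x)) = (fun x => Re (f x) + Re (g x)).
    by apply/funext => x; rewrite Re_add.
  exact: measurable_funD.
- have -> : (fun x => Im (f x + g x)) = (fun x => Im (f x) + Im (g x)).
    by apply/funext => x; rewrite Im_add.
  exact: measurable_funD.
Qed.

Lemma cmeasurableM f g : cmeasurable f -> cmeasurable g ->
  cmeasurable (fun x => f x * g x).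
Proof.
move=> [f1 f2] [g1 g2]; split.
- have -> : (fun x => Re (f x * g x)) =
      (fun x => Re (f x) * Re (g x) - Im (f x) * Im (g x)).
    by apply/funext => x; rewrite Re_mul.
  by apply: measurable_funB; exact: measurable_funM.
- have -> : (fun x => Im (f x * g x)) =
      (fun x => Re (f x) * Im (g x) + Im (f x) * Re (g x)).
    by apply/funext => x; rewrite Im_mul.
  by apply: measurable_funD; exact: measurable_funM.
Qed.

Lemma cmeasurableN f : cmeasurable f -> cmeasurable (fun x => - f x).
Proof.
move=> mf; have -> : (fun x => - f x) = (fun x => (-1) * f x).
  by apply/funext => x; rewrite mulN1r.
by apply: cmeasurableM => //; exact: cmeasurable_cst.
Qed.

Lemma cmeasurableB f g : cmeasurable f -> cmeasurable g ->
  cmeasurable (fun x => f x - g x).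
Proof. by move=> mf mg; apply: cmeasurableD => //; exact: cmeasurableN. Qed.

Lemma cmeasurableX f n : cmeasurable f -> cmeasurable (fun x => f x ^+ n).
Proof.
move=> mf; elim: n => [|n IHn]; first exact: cmeasurable_cst.
under eq_fun do rewrite exprS; exact: cmeasurableM.
Qed.

Lemma cmeasurable_sum (I : Type) (s : seq I) (F : I -> T -> R[i]) :
  (forall i, cmeasurable (F i)) -> cmeasurable (fun x => \sum_(i <- s) F i x).
Proof.
move=> mF; elim: s => [|i s IHs].
  by under eq_fun do rewrite big_nil; exact: cmeasurable_cst.
by under eq_fun do rewrite big_cons; exact: cmeasurableD.
Qed.

Lemma cmeasurable_prod (I : Type) (s : seq I) (F : I -> T -> R[i]) :
  (forall i, cmeasurable (F i)) -> cmeasurable (fun x => \prod_(i <- s) F i x).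
Proof.
move=> mF; elim: s => [|i s IHs].
  by under eq_fun do rewrite big_nil; exact: cmeasurable_cst.
by under eq_fun do rewrite big_cons; exact: cmeasurableM.
Qed.

Lemma cmeasurableV f : cmeasurable f -> cmeasurable (fun x => (f x)^-1).
Proof.
move=> [f1 f2].
have mn : measurable_fun D (fun x => (Re (f x) ^+ 2 + Im (f x) ^+ 2)^-1).
  apply: measurable_inv; apply: measurable_funD; exact: measurable_funX.
split.
- have -> : (fun x => Re (f x)^-1) =
      (fun x => Re (f x) * (Re (f x) ^+ 2 + Im (f x) ^+ 2)^-1).
    by apply/funext => x; case: (f x).
  exact: measurable_funM.
- have -> : (fun x => Im (f x)^-1) =
      (fun x => - (Im (f x) * (Re (f x) ^+ 2 + Im (f x) ^+ 2)^-1)).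
    by apply/funext => x; case: (f x) => a b /=.
  by apply: measurable_funN; exact: measurable_funM.
Qed.

Lemma cmeasurable_cexp f : cmeasurable f -> cmeasurable (fun x => cexp (f x)).
Proof.
move=> [f1 f2]; split; apply: measurable_funM.
- exact: measurableT_comp.
- apply: (measurableT_comp _ f2); apply: continuous_measurable_fun.
  exact: continuous_cos.
- exact: measurableT_comp.
- apply: (measurableT_comp _ f2); apply: continuous_measurable_fun.
  exact: continuous_sin.
Qed.

Lemma measurable_normc f : cmeasurable f -> measurable_fun D (fun x => normc (f x)).
Proof.
move=> [f1 f2]; under eq_fun do rewrite normc_sqrt.
have ms : measurable_fun [set: R] (@Num.sqrt R).
  by apply: continuous_measurable_fun => x; exact: sqrt_continuous.
have m2 : measurable_fun D (fun x => Re (f x) ^+ 2 + Im (f x) ^+ 2).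
  by apply: measurable_funD; exact: measurable_funX.
exact: measurableT_comp ms m2.
Qed.

Lemma cmeasurable_cLn f : cmeasurable f -> cmeasurable (fun x => cLn (f x)).
Proof.
move=> mf; have mn := measurable_normc mf; have [f1 f2] := mf; split.
  by apply: (measurableT_comp (f := @ln R)) => //; exact: measurable_ln.
(* [acos] is monotone only on [-1, 1]; after clipping it is nonincreasing on the whole line, hence
   measurable. The quotient Re z / |z| already lies in [-1, 1], also at z = 0, where it is 0. *)
pose clip (x : R) := Num.max (-1) (Num.min 1 x).
have clip_itv x : clip x \in `[(-1), 1].
  by rewrite in_itv/= /clip le_max lexx/= ge_max ge_min lexx/= andbT; lra.
have macos : measurable_fun [set: R] (fun x : R => acos (clip x)).
  apply: nonincreasing_measurable => // x y xy.
  have cxy : clip x <= clip y.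
    by rewrite /clip ge_max !le_max !lexx/= le_min !ge_min !lexx xy !orbT.
  rewrite leNgt; apply/negP => acxy.
  have := @ltr_cos R (acos (clip x)) (acos (clip y)).
  have a_itv z : acos (clip z) \in `[0, pi].
    have := clip_itv z; rewrite in_itv/= => cz.
    by rewrite in_itv/= acos_ge0//= acos_lepi.
  move=> /(_ (a_itv x) (a_itv y)); rewrite !acosK// acxy.
  by rewrite ltNge cxy.
have mt : measurable_fun D (fun x => acos (Re (f x) / normc (f x))).
  have -> : (fun x => acos (Re (f x) / normc (f x))) =
     (fun x => acos (clip (Re (f x) / normc (f x)))).
    apply/funext => x; congr acos; set r := _ / _.
    have : `|r| <= 1.
      rewrite /r normrM normfV (ger0_norm (normc_ge0 _)).
      have [->|n0] := eqVneq (normc (f x)) 0; first by rewrite invr0 mulr0.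
      rewrite ler_pdivrMr ?mul1r ?Re_le_normc//.
      by rewrite lt_neqAle eq_sym n0 normc_ge0.
    rewrite ler_norml => /andP[r1 r2]; rewrite /clip.
    by rewrite (min_idPr r2) (max_idPr r1).
  apply: (measurableT_comp macos); apply: measurable_funM => //.
  exact: measurable_inv.
apply: measurable_fun_if => //.
- exact: measurable_fun_ler.
- by apply: measurable_funS mt.
- by apply: measurable_funN; apply: measurable_funS mt.
Qed.

Lemma cintegrable_cmeasurable f : cintegrable mu D f -> cmeasurable f.
Proof. by case. Qed.

Lemma cintegrable_ReIm f : cintegrable mu D f ->
  mu.-integrable D (EFin \o (fun x => Re (f x))) /\
  mu.-integrable D (EFin \o (fun x => Im (f x))).
Proof.
move=> [f1 f2 fi]; have mn := measurable_normc (conj f1 f2).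
have ni : mu.-integrable D (EFin \o (fun x => normc (f x))).
  apply/integrableP; split; first exact/measurable_EFinP.
  apply: le_lt_trans fi; rewrite le_eqVlt; apply/orP; left; apply/eqP.
  by apply: eq_integral => x _ /=; rewrite ger0_norm// normc_ge0.
split; apply: le_integrable ni => //; try exact/measurable_EFinP.
- move=> x Dx /=; rewrite lee_fin (ger0_norm (normc_ge0 _)).
  exact: Re_le_normc.
- move=> x Dx /=; rewrite lee_fin (ger0_norm (normc_ge0 _)).
  exact: Im_le_normc.
Qed.

Lemma cintegrable_le f h : cmeasurable f -> mu.-integrable D (EFin \o h) ->
  {ae mu, forall x, D x -> normc (f x) <= h x} -> cintegrable mu D f.
Proof.
move=> mf ih fh; have [f1 f2] := mf; split => //.
have /integrableP[mh hoo] := ih.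
apply: le_lt_trans hoo.
apply: ae_ge0_le_integral => //.
- by move=> x _; rewrite lee_fin normc_ge0.
- by apply/measurable_EFinP; exact: measurable_normc.
- exact: measurableT_comp.
apply: filterS fh => x fh Dx; rewrite lee_fin.
by rewrite (le_trans (fh Dx))// ler_norm.
Qed.

Lemma cintegrable_sum (I : Type) (s : seq I) (F : I -> T -> R[i]) :
  (forall i, cintegrable mu D (F i)) -> cintegrable mu D (fun x => \sum_(i <- s) F i x).
Proof.
move=> iF.
have ni i : mu.-integrable D (EFin \o (fun x => normc (F i x))).
  have [F1 F2 Fi] := iF i.
  apply/integrableP; split.
    by apply/measurable_EFinP; exact: measurable_normc.
  apply: le_lt_trans Fi; rewrite le_eqVlt; apply/orP; left; apply/eqP.
  by apply: eq_integral => x _ /=; rewrite ger0_norm// normc_ge0.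
apply: (@cintegrable_le _ (fun x => \sum_(i <- s) normc (F i x))).
- by apply: cmeasurable_sum => i; exact: cintegrable_cmeasurable.
- rewrite (_ : _ \o _ = (fun x => \sum_(i <- s) (normc (F i x))%:E)%E); last first.
    by apply/funext => x /=; rewrite sumEFin.
  by apply: integrable_sum => // i _; exact: ni.
- by apply: aeW => x _; exact: normc_sum.
Qed.

Lemma cintegral_sum (I : Type) (s : seq I) (F : I -> T -> R[i]) :
  (forall i, cintegrable mu D (F i)) ->
  cintegral mu D (fun x => \sum_(i <- s) F i x) = \sum_(i <- s) cintegral mu D (F i).
Proof.
move=> iF; elim: s => [|i s IHs].
  rewrite big_nil; apply: eqcP; rewrite /cintegral/=.
  - by under eq_Rintegral do rewrite big_nil; rewrite /Rintegral/= integral0.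
  - by under eq_Rintegral do rewrite big_nil; rewrite /Rintegral/= integral0.
rewrite big_cons -IHs.
have [i1 i2] := cintegrable_ReIm (iF i).
have [s1 s2] := cintegrable_ReIm (cintegrable_sum s iF).
apply: eqcP; rewrite ?Re_add ?Im_add /cintegral/=.
- by rewrite -RintegralD//; apply: eq_Rintegral => x _; rewrite big_cons Re_add.
- by rewrite -RintegralD//; apply: eq_Rintegral => x _; rewrite big_cons Im_add.
Qed.

Lemma cintegralZl (c : R[i]) f : cintegrable mu D f ->
  cintegral mu D (fun x => c * f x) = c * cintegral mu D f.
Proof.
move=> /cintegrable_ReIm[f1 f2].
have z (k : R) (g : T -> R) : mu.-integrable D (EFin \o g) ->
    mu.-integrable D (EFin \o (fun x => k * g x)).
  by move=> ig; apply: eq_integrable (integrableZl mD k ig).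
apply: eqcP; rewrite ?Re_mul ?Im_mul /cintegral/=.
- rewrite -!RintegralZl// -RintegralB//; [|exact: z|exact: z].
  by apply: eq_Rintegral => x _; rewrite Re_mul.
- rewrite -!RintegralZl// -RintegralD//; [|exact: z|exact: z].
  by apply: eq_Rintegral => x _; rewrite Im_mul.
Qed.

Lemma cintegrableZl (c : R[i]) f : cintegrable mu D f ->
  cintegrable mu D (fun x => c * f x).
Proof.
move=> cf; have [f1 f2 fi] := cf.
have ni : mu.-integrable D (EFin \o (fun x => normc c * normc (f x))).
  have n1 : mu.-integrable D (EFin \o (fun x => normc (f x))).
    apply/integrableP; split.
      by apply/measurable_EFinP; exact: measurable_normc.
    apply: le_lt_trans fi; rewrite le_eqVlt; apply/orP; left; apply/eqP.
    by apply: eq_integral => x _ /=; rewrite ger0_norm// normc_ge0.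
  by apply: eq_integrable (integrableZl mD (normc c) n1).
apply: (cintegrable_le _ ni).
  by apply: cmeasurableM => //; exact: cmeasurable_cst.
by apply: aeW => x _; rewrite normcM.
Qed.

Lemma Rintegral_sum (I : Type) (s : seq I) (F : I -> T -> R) :
  (forall i, mu.-integrable D (EFin \o F i)) ->
  mu.-integrable D (EFin \o (fun x => \sum_(i <- s) F i x)) /\
  \int[mu]_(x in D) (\sum_(i <- s) F i x) = \sum_(i <- s) \int[mu]_(x in D) F i x.
Proof.
move=> iF; have iS t : mu.-integrable D (EFin \o (fun x => \sum_(i <- t) F i x)).
  rewrite (_ : _ \o _ = (fun x => \sum_(i <- t) (F i x)%:E)%E); last first.
    by apply/funext => x /=; rewrite sumEFin.
  by apply: integrable_sum => // i _; exact: iF.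
split => //; elim: s => [|i s IHs].
  by rewrite big_nil; under eq_Rintegral do rewrite big_nil; rewrite /Rintegral integral0.
rewrite big_cons -IHs -RintegralD//.
by apply: eq_Rintegral => x _; rewrite big_cons.
Qed.

Lemma cintegral_ae_eq f g : cmeasurable f -> cmeasurable g ->
  {ae mu, forall x, D x -> f x = g x} -> cintegral mu D f = cintegral mu D g.
Proof.
move=> [f1 f2] [g1 g2] fg; apply: eqcP; rewrite /cintegral/=; congr fine.
- apply: ae_eq_integral => //; try exact/measurable_EFinP.
  by apply: filterS fg => x fgx Dx; rewrite fgx.
- apply: ae_eq_integral => //; try exact/measurable_EFinP.
  by apply: filterS fg => x fgx Dx; rewrite fgx.
Qed.

Lemma aeS (P Q : T -> Prop) : {ae mu, forall x, P x} -> (forall x, P x -> Q x) ->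
  {ae mu, forall x, Q x}.
Proof. by move=> aP PQ; apply: filterS aP. Qed.

Lemma integrable_scale (c : R) h : mu.-integrable D (EFin \o h) ->
  mu.-integrable D (EFin \o (fun x => c * h x)).
Proof. by move=> ih; apply: eq_integrable (integrableZl mD c ih). Qed.

Lemma cintegral_real h : cintegral mu D (fun x => (h x)%:C) = (\int[mu]_(x in D) h x)%:C.
Proof. by apply: eqcP; rewrite /cintegral/= // /Rintegral integral0. Qed.

Lemma cintegrable_real h : mu.-integrable D (EFin \o h) ->
  cintegrable mu D (fun x => (h x)%:C).
Proof.
move=> ih; have [/measurable_EFinP mh _] := integrableP _ _ _ ih.
have ia := integrable_norm ih.
apply: (cintegrable_le (cmeasurable_real mh) ia).
by apply: aeW => x _; rewrite normc_real.
Qed.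

Lemma Rintegral_cvg (u : nat -> T -> R) (l h : T -> R) :
  (forall n, measurable_fun D (u n)) -> measurable_fun D l ->
  mu.-integrable D (EFin \o h) ->
  {ae mu, forall x, D x -> u n x @[n --> \oo] --> l x} ->
  {ae mu, forall x, forall n, D x -> `|u n x| <= h x} ->
  \int[mu]_(x in D) u n x @[n --> \oo] --> \int[mu]_(x in D) l x.
Proof.
move=> mu_ ml ih ul uh.
have [] := @dominated_convergence _ _ _ mu _ mD (fun n x => (u n x)%:E)
  (fun x => (l x)%:E) (EFin \o h).
- by move=> n; exact/measurable_EFinP.
- exact/measurable_EFinP.
- by apply: filterS ul => x ulx Dx; apply: cvg_EFin; [exact: nearW|exact: ulx].
- exact: ih.
- by apply: filterS uh => x uhx n Dx; rewrite lee_fin uhx.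
move=> il _ c; apply: fine_cvg.
by rewrite fineK//; exact: integrable_fin_num.
Qed.

(** The factor 2 comes from bounding the real and imaginary parts separately. *)
Lemma normc_cintegral_le f h : cmeasurable f -> mu.-integrable D (EFin \o h) ->
  {ae mu, forall x, D x -> normc (f x) <= h x} ->
  normc (cintegral mu D f) <= 2 * \int[mu]_(x in D) h x.
Proof.
move=> mf ih fh; have [f1 f2] := cintegrable_ReIm (cintegrable_le mf ih fh).
have [/measurable_EFinP mh _] := integrableP _ _ _ ih.
have bd (g : T -> R) : mu.-integrable D (EFin \o g) ->
    (forall x, `|g x| <= normc (f x)) -> `|\int[mu]_(x in D) g x| <= \int[mu]_(x in D) h x.
  move=> ig gf; apply: le_trans (le_normr_Rintegral mD ig) _.
  have [/measurable_EFinP mg _] := integrableP _ _ _ ig.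
  have ing := integrable_norm ig.
  rewrite -lee_fin /Rintegral !fineK; try exact: integrable_fin_num.
  have h0 : {ae mu, forall x, D x -> `|g x| <= h x}.
    by apply: filterS fh => x fhx Dx; exact: le_trans (fhx Dx).
  (* h dominates |g| only almost everywhere; the maximum has the same integral and dominates
     everywhere. *)
  have -> : (\int[mu]_(x in D) (h x)%:E = \int[mu]_(x in D) (Num.max `|g x| (h x))%:E)%E.
    apply: ae_eq_integral => //.
    - exact/measurable_EFinP.
    - apply/measurable_EFinP; apply: measurable_maxr => //.
      exact: measurableT_comp.
    - by apply: filterS h0 => x h0 Dx; congr EFin; rewrite (max_idPr (h0 Dx)).
  apply: ge0_le_integral => //.
  - by apply/measurable_EFinP; exact: measurableT_comp.
  - apply/measurable_EFinP; apply: measurable_maxr => //.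
    exact: measurableT_comp.
  - by move=> x _; rewrite lee_fin le_max lexx.
apply: le_trans (normc_le_ReIm _) _.
rewrite mulr_natl mulr2n lerD// bd// => x; [exact: Re_le_normc|exact: Im_le_normc].
Qed.

(** Dominated convergence for the partial sums, by components: h bounds the sums of norms, hence
    every partial sum at once, and 2 h bounds the limit. *)
Lemma cintegral_csum (a : nat -> T -> R[i]) f h :
  (forall k, cmeasurable (a k)) -> cmeasurable f -> mu.-integrable D (EFin \o h) ->
  {ae mu, forall x, D x -> cgeo (a ^~ x) /\ csum (a ^~ x) = f x} ->
  {ae mu, forall x, forall n, D x -> \sum_(k < n) normc (a k x) <= h x} ->
  [/\ forall k, cintegrable mu D (a k), cintegrable mu D f,
      \sum_(k < n) Re (cintegral mu D (a k)) @[n --> \oo] --> Re (cintegral mu D f),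
      \sum_(k < n) Im (cintegral mu D (a k)) @[n --> \oo] --> Im (cintegral mu D f) &
      csum (fun k => cintegral mu D (a k)) = cintegral mu D f].
Proof.
move=> ma mf ih af ah.
have ia k : cintegrable mu D (a k).
  apply: (cintegrable_le (ma k) ih); apply: filterS ah => x ahx Dx.
  apply: le_trans (ahx k.+1 Dx); rewrite big_ord_recr/= lerDr.
  by apply: sumr_ge0 => i _; exact: normc_ge0.
have mS n : cmeasurable (fun x => \sum_(k < n) a k x) by exact: cmeasurable_sum.
have cR (g : R[i] -> R) : (forall z, `|g z| <= normc z) ->
    (forall n x, g (\sum_(k < n) a k x) = \sum_(k < n) g (a k x)) ->
    (forall n, measurable_fun D (fun x => g (\sum_(k < n) a k x))) ->
    measurable_fun D (fun x => g (f x)) ->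
    (forall x, cgeo (a ^~ x) -> geo (fun k => g (a k x))) ->
    (forall x, g (csum (a ^~ x)) = limn (series (fun k => g (a k x)))) ->
    \int[mu]_(x in D) g (\sum_(k < n) a k x) @[n --> \oo] --> \int[mu]_(x in D) g (f x).
  move=> gn gs mg mgf gg gc.
  apply: (Rintegral_cvg mg mgf ih).
    apply: filterS af => x afx Dx; have [cg <-] := afx Dx.
    rewrite gc; apply: cvg_trans (geo_cvg (gg x cg)).
    by apply: near_eq_cvg; apply: nearW => n; rewrite gs /series/= big_mkord.
  apply: filterS ah => x ahx n Dx; apply: le_trans (gn _) _.
  exact: le_trans (normc_sum _ _ _) (ahx n Dx).
have hR : \sum_(k < n) Re (cintegral mu D (a k)) @[n --> \oo] --> Re (cintegral mu D f).
  have := cR (@complex.Re R) (@Re_le_normc R) (fun n x => Re_sum _ _ _)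
    (fun n => (mS n).1) mf.1 (fun x => @cgeo_Re R _) (fun x => erefl).
  apply: cvg_trans; apply: near_eq_cvg; apply: nearW => n.
  by rewrite -Re_sum -cintegral_sum.
have hI : \sum_(k < n) Im (cintegral mu D (a k)) @[n --> \oo] --> Im (cintegral mu D f).
  have := cR (@complex.Im R) (@Im_le_normc R) (fun n x => Im_sum _ _ _)
    (fun n => (mS n).2) mf.2 (fun x => @cgeo_Im R _) (fun x => erefl).
  apply: cvg_trans; apply: near_eq_cvg; apply: nearW => n.
  by rewrite -Im_sum -cintegral_sum.
split => //.
- have h0 : {ae mu, forall x, D x -> normc (f x) <= 2 * h x}.
    apply: filterS2 af ah => x afx ahx Dx; have [cg <-] := afx Dx.
    apply: le_trans (normc_le_ReIm _) _; rewrite mulr_natl mulr2n.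
    have B (g : R[i] -> R) : (forall z, `|g z| <= normc z) ->
      geo (fun k => g (a k x)) -> `|limn (series (fun k => g (a k x)))| <= h x.
      move=> gn gg.
      have gcv := geo_cvg gg.
      have cn : `|series (fun k => g (a k x)) n| @[n --> \oo] -->
         `|limn (series (fun k => g (a k x)))| by apply: cvg_norm.
      rewrite -(cvg_lim (@Rhausdorff R) cn); apply: limr_le.
        by apply: cvgP cn.
      apply: nearW => n; rewrite /series/= big_mkord.
      apply: le_trans (ler_norm_sum _ _ _) _.
      by apply: le_trans (ahx n Dx); apply: ler_sum.
    apply: lerD; rewrite /csum/=; apply: B.
    - exact: Re_le_normc.
    - exact: cgeo_Re.
    - exact: Im_le_normc.
    - exact: cgeo_Im.
  apply: cintegrable_le h0 => //.
  by apply: eq_integrable (integrableZl mD 2 ih).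
- apply: eqcP; rewrite /csum/=.
  + by apply: cvg_lim => //; rewrite /series/=; under eq_fun do rewrite big_mkord.
  + by apply: cvg_lim => //; rewrite /series/=; under eq_fun do rewrite big_mkord.
Qed.

End complex_integrals.

(** * Even moments *)

Section cosine_remainder.
Context {R : realType}.
Implicit Types y t : R.

(* Up to sign, the Taylor remainders of cos and sin at order 2n and 2n - 1;
   the sign is chosen so that they are nonnegative for y >= 0. *)
Fixpoint cosrem n y : R :=
  if n is m.+1 then y ^+ (2 * m.+1) / (2 * m.+1)`!%:R - cosrem m y else 1 - cos y.

Fixpoint sinrem n y : R :=
  if n is m.+1 then y ^+ (2 * m).+1 / (2 * m).+1`!%:R - sinrem m y else sin y.

Lemma cosremS n y : cosrem n.+1 y = y ^+ (2 * n.+1) / (2 * n.+1)`!%:R - cosrem n y.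
Proof. by []. Qed.

Lemma sinremS n y : sinrem n.+1 y = y ^+ (2 * n).+1 / (2 * n).+1`!%:R - sinrem n y.
Proof. by []. Qed.

Lemma is_derive_monomial n y :
  is_derive y (1:R) (fun x : R => x ^+ n.+1 / n.+1`!%:R) (y ^+ n / n`!%:R).
Proof.
have h : is_derive y (1:R) (fun x : R => x ^+ n.+1) (n.+1%:R * y ^+ n).
  have := is_deriveX n.+1 (@is_derive_id R _ y 1).
  rewrite -[n.+1.-1]/n => hh.
  have -> : (fun x : R => x ^+ n.+1) = id ^+ n.+1 by apply/funext => x; rewrite fctE.
  by apply: is_derive_eq; rewrite /GRing.scale/= mulr1.
have h2 := is_deriveZ (n.+1`!%:R)^-1 h.
have -> : (fun x : R => x ^+ n.+1 / n.+1`!%:R) =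
    ((n.+1`!%:R)^-1 \*: (fun x : R => x ^+ n.+1)).
  by apply/funext => x; rewrite mulrC.
apply: is_derive_eq; rewrite /GRing.scale/= factS natrM.
by rewrite invfM mulrACA mulVf ?mul1r 1?mulrC// pnatr_eq0.
Qed.

Lemma is_derive_cosrem n y : is_derive y (1:R) (cosrem n) (sinrem n y).
Proof.
elim: n => [|n IHn].
  have h := is_deriveB (is_derive_cst (1:R) y (1:R)) (is_derive_cos y).
  have -> : cosrem 0 = cst 1 - cos by apply/funext => x.
  by apply: is_derive_eq; rewrite sub0r opprK.
have E : (2 * n.+1)%N = (2 * n).+2 by rewrite mulnS.
have h := is_deriveB (is_derive_monomial (2 * n).+1 y) IHn.
have -> : cosrem n.+1 = (fun x : R => x ^+ (2 * n).+2 / (2 * n).+2`!%:R) - cosrem n.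
  by apply/funext => x; rewrite cosremS E.
exact: h.
Qed.

Lemma is_derive_sinrem n y : is_derive y (1:R) (sinrem n.+1) (cosrem n y).
Proof.
elim: n => [|n IHn].
  have h := is_deriveB (is_derive_monomial 0 y) (is_derive_sin y).
  have -> : sinrem 1 = (fun x : R => x ^+ 1 / 1`!%:R) - sin.
    by apply/funext => x; rewrite sinremS muln0.
  by apply: is_derive_eq; rewrite expr0 fact0 divr1.
have E : (2 * n.+1)%N = (2 * n).+2 by rewrite mulnS.
have h := is_deriveB (is_derive_monomial (2 * n.+1) y) IHn.
have -> : sinrem n.+2 = (fun x : R => x ^+ (2 * n.+1).+1 / (2 * n.+1).+1`!%:R) - sinrem n.+1.
  by apply/funext => x.
exact: h.
Qed.

Lemma ge0_of_derive (f df : R -> R) : f 0 = 0 ->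
  (forall y, is_derive y (1:R) f (df y)) ->
  (forall y, 0 <= y -> 0 <= df y) -> forall y, 0 <= y -> 0 <= f y.
Proof.
move=> f0 fd d0 y; rewrite le_eqVlt => /orP[/eqP <-|y0]; first by rewrite f0.
have [|c] := MVT y0 (fun x _ => fd x).
  by apply: derivable_within_continuous => x _; have [] := fd x.
rewrite in_itv/= => /andP[c0 _]; rewrite f0 !subr0 => ->.
by rewrite mulr_ge0 ?d0// ltW.
Qed.

Lemma cosrem0 n : cosrem n 0 = 0.
Proof.
elim: n => [|n IHn]; first by rewrite /= cos0 subrr.
by rewrite cosremS IHn expr0n muln_eq0/= mul0r subr0.
Qed.

Lemma sinrem0 n : sinrem n 0 = 0.
Proof.
elim: n => [|n IHn]; first by rewrite /= sin0.
by rewrite sinremS IHn expr0n mul0r subr0.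
Qed.

Lemma cosremN n y : cosrem n (- y) = cosrem n y.
Proof.
elim: n => [|n IHn]; first by rewrite /= cosN.
by rewrite !cosremS IHn !exprM sqrrN.
Qed.

(** Two integrations from 0 lead from [cosrem n] through [sinrem n.+1] to [cosrem n.+1], both
    vanishing at 0, so the sign is inherited for y >= 0; evenness covers y < 0. *)
Lemma cosrem_ge0 n y : 0 <= cosrem n y.
Proof.
have pos z : 0 <= z -> 0 <= cosrem n z.
  elim: n z => [z _|n IHn]; first by rewrite /= subr_ge0 cos_le1.
  apply: (ge0_of_derive (cosrem0 _) (is_derive_cosrem _)).
  by apply: (ge0_of_derive (sinrem0 _) (is_derive_sinrem _)).
have [y0|/ltW y0] := leP 0 y; first exact: pos.
by rewrite -cosremN pos// oppr_ge0.
Qed.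

Lemma cosrem_le n y : cosrem n y <= y ^+ (2 * n.+1) / (2 * n.+1)`!%:R.
Proof. by rewrite -subr_ge0 -cosremS cosrem_ge0. Qed.

Lemma continuous_cosrem n : continuous (cosrem n).
Proof.
move=> y; apply: differentiable_continuous; apply/derivable1_diffP.
by have [] := is_derive_cosrem n y.
Qed.

End cosine_remainder.

Section even_moments.
Context {dd : measure_display} {T : measurableType dd} {R : realType}.
Variables (mu : {measure set T -> \bar R}) (W X : T -> R).
Hypothesis mW : measurable_fun setT W.
Hypothesis mX : measurable_fun setT X.
Hypothesis W0 : forall x, 0 <= W x.

Let G n x : R := W x * (X x ^+ (2 * n.+1) / (2 * n.+1)`!%:R).

Let mG n : measurable_fun setT (G n).
Proof.
apply: measurable_funM => //; apply: measurable_funM => //.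
exact: measurable_funX.
Qed.

Let G0 n x : 0 <= G n x.
Proof. by rewrite mulr_ge0// divr_ge0// exprM exprn_ge0// sqr_ge0. Qed.

Let mcosrem n t : measurable_fun setT (fun x => W x * cosrem n (t * X x)).
Proof.
have m1 : measurable_fun setT (fun x => t * X x) by exact: measurable_funM.
have mc : measurable_fun [set: R] (@cosrem R n).
  by apply: continuous_measurable_fun; exact: continuous_cosrem.
by apply: measurable_funM => //; exact: measurableT_comp mc m1.
Qed.

Variables (f : R -> R) (c : nat -> R) (K q : R).
Hypothesis fint : forall t, 0 < t <= 1 ->
  mu.-integrable setT (EFin \o (fun x => W x * (1 - cos (t * X x)))) /\
  \int[mu]_x (W x * (1 - cos (t * X x))) = f t.
Hypothesis fapprox : forall (n : nat) (t : R), 0 < t <= 1 ->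
  `|f t - \sum_(k < n) c k * t ^+ (2 * k.+1)| <=
    K * q ^+ (2 * n.+1) * t ^+ (2 * n.+1).

(** Consecutive remainders are linked by a single moment term, so the integral of the n-th one is
    known as soon as the moments below n are. *)
Let cosrem_int n t : 0 < t <= 1 ->
  (forall k, (k < n)%N -> mu.-integrable setT (EFin \o G k) /\
     \int[mu]_x G k x = (-1) ^+ k * c k) ->
  mu.-integrable setT (EFin \o (fun x => W x * cosrem n (t * X x))) /\
  \int[mu]_x (W x * cosrem n (t * X x)) =
    (-1) ^+ n * (f t - \sum_(k < n) c k * t ^+ (2 * k.+1)).
Proof.
move=> t01; elim: n => [_|n IHn H].
  have [h1 h2] := fint t01; rewrite big_ord0 subr0 mul1r; split.
    exact: h1.
  exact: h2.
have [|I1 I2] := IHn; first by move=> k kn; apply: H; rewrite ltnW.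
have [J1 J2] := H n (leqnn _).
have E x : W x * cosrem n.+1 (t * X x) = t ^+ (2 * n.+1) * G n x - W x * cosrem n (t * X x).
  by rewrite cosremS /G exprMn; ring.
have J1' : mu.-integrable setT (EFin \o (fun x => t ^+ (2 * n.+1) * G n x)).
  by apply: eq_integrable (integrableZl measurableT (t ^+ (2 * n.+1)) J1).
split.
  apply: (@eq_integrable _ _ _ _ _ measurableT (fun x => (t ^+ (2 * n.+1) * G n x)%:E - (W x * cosrem n (t * X x))%:E)%E).
    by move=> x _; rewrite /= E EFinB.
  exact: integrableB.
under eq_Rintegral do rewrite E.
rewrite RintegralB// RintegralZl// I2 J2 big_ord_recr/= exprS; ring.
Qed.

(* Induction on n: after division by t^(2n+2), letting t -> 0 in the integral of
   the n-th cosine remainder, Fatou's lemma gives integrability of the moment and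
   dominated convergence its value. *)
Lemma even_moment n : [/\ mu.-integrable setT (EFin \o G n),
  \int[mu]_x G n x = (-1) ^+ n * c n & \int[mu]_x G n x <= K * q ^+ (2 * n.+1)].
Proof.
elim/ltn_ind: n => n IH.
have IHn k : (k < n)%N -> mu.-integrable setT (EFin \o G k) /\
    \int[mu]_x G k x = (-1) ^+ k * c k by move=> /IH[].
pose t (j : nat) : R := j.+1%:R^-1.
have t01 j : 0 < t j <= 1 by rewrite invr_gt0 ltr0n/= invf_le1 ?ltr0n// ler1n.
have t0 j : 0 < t j by case/andP: (t01 j).
have tne j m : t j ^+ m != 0 by rewrite expf_neq0// gt_eqF.
have tcvg : t @ \oo --> (0 : R) by exact: cvg_harmonic.
have t2cvg : t j ^+ 2 @[j --> \oo] --> (0 : R).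
  under eq_fun do rewrite expr2.
  have -> : 0 = 0 * 0 :> R by rewrite mulr0.
  exact: cvgM.
pose u j x := W x * cosrem n (t j * X x) / t j ^+ (2 * n.+1).
have tp j m : 0 < t j ^+ m by rewrite exprn_gt0.
have u0 j x : 0 <= u j x by rewrite divr_ge0 ?(ltW (tp _ _))// mulr_ge0// cosrem_ge0.
have uG j x : u j x <= G n x.
  rewrite ler_pdivrMr// /G -mulrA ler_wpM2l//.
  apply: le_trans (cosrem_le _ _) _.
  by rewrite exprMn [X in X / _]mulrC mulrAC.
have mu_ j : measurable_fun setT (u j) by apply: measurable_funM.
(* A squeeze: [uG] bounds from above, and nonnegativity of [cosrem n.+2] bounds from below with an
   error [G n.+1 x] times t^2. *)
have ucvg x : u j x @[j --> \oo] --> G n x.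
  have h : (G n x - G n.+1 x * t j ^+ 2) @[j --> \oo] --> G n x - G n.+1 x * 0.
    apply: cvgB; first exact: cvg_cst.
    by apply: cvgMr; exact: t2cvg.
  rewrite mulr0 subr0 in h.
  apply: squeeze_cvgr h (cvg_cst _).
  apply: nearW => j; rewrite uG andbT.
  rewrite ler_pdivlMr// /G -subr_ge0.
  have -> : W x * cosrem n (t j * X x) - (W x * (X x ^+ (2 * n.+1) / (2 * n.+1)`!%:R) -
     W x * (X x ^+ (2 * n.+2) / (2 * n.+2)`!%:R) * t j ^+ 2) * t j ^+ (2 * n.+1) =
     W x * ((t j * X x) ^+ (2 * n.+2) / (2 * n.+2)`!%:R -
       ((t j * X x) ^+ (2 * n.+1) / (2 * n.+1)`!%:R - cosrem n (t j * X x))).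
    have -> : (t j * X x) ^+ (2 * n.+2) = X x ^+ (2 * n.+2) * (t j ^+ 2 * t j ^+ (2 * n.+1)).
      by rewrite -exprD -mulnS exprMn mulrC.
    by rewrite [(_ * _) ^+ (2 * n.+1)]exprMn; ring.
  by rewrite mulr_ge0// -cosremS -cosremS cosrem_ge0.
have uint j : mu.-integrable setT (EFin \o u j) /\
    \int[mu]_x u j x = (-1) ^+ n * (f (t j) - \sum_(k < n) c k * t j ^+ (2 * k.+1)) / t j ^+ (2 * n.+1).
  have [I1 I2] := cosrem_int (t01 j) IHn.
  have -> : u j = (fun x => (t j ^+ (2 * n.+1))^-1 * (W x * cosrem n (t j * X x))).
    by apply/funext => x; rewrite /u mulrC.
  split; last by rewrite RintegralZl// I2 mulrC.
  by apply: eq_integrable (integrableZl measurableT (t j ^+ (2 * n.+1))^-1 I1).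
have ubd j : (\int[mu]_x (u j x)%:E <= (K * q ^+ (2 * n.+1))%:E)%E.
  have [I1 I2] := uint j.
  rewrite -[leLHS]fineK; last exact: integrable_fin_num.
  rewrite -[fine _]/(\int[mu]_x u j x) I2 lee_fin ler_pdivrMr//.
  apply: le_trans (fapprox n (t01 j)).
  by apply: le_trans (ler_norm _) _; rewrite normrM normrX normrN1 expr1n mul1r.
have iG : mu.-integrable setT (EFin \o G n).
  apply/integrableP; split; first exact/measurable_EFinP.
  have -> : (\int[mu]_x `|(EFin \o G n) x| = \int[mu]_x limn_einf (fun j => (u j x)%:E))%E.
    apply: eq_integral => x _; rewrite /= ger0_norm//.
    have h : (u j x)%:E @[j --> \oo] --> (G n x)%:E.
      by apply: cvg_EFin; [exact: nearW|exact: ucvg].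
    by rewrite (cvg_limn_einf_sup h).1.
  apply: le_lt_trans (fatou mu measurableT _ _) _.
  - by move=> j; exact/measurable_EFinP.
  - by move=> j x _; rewrite lee_fin.
  apply: (@le_lt_trans _ _ (K * q ^+ (2 * n.+1))%:E); last by rewrite ltry.
  rewrite limn_einf_lim.
  apply: lime_le; first exact: is_cvg_einfs.
  apply: nearW => j; apply: le_trans (ubd j).
  by apply: ereal_inf_lbound; exists j => //=.
have c1 : \int[mu]_x u j x @[j --> \oo] --> \int[mu]_x G n x.
  apply: (Rintegral_cvg measurableT mu_ (mG n) iG).
  - by apply: aeW => x _; exact: ucvg.
  - by apply: aeW => x j _; rewrite ger0_norm.
(* The expansion of f to order n + 1 leaves, after division by t^(2n+2), an error of order t^2. *)
have c2 : \int[mu]_x u j x @[j --> \oo] --> (-1) ^+ n * c n.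
  have h : (K * q ^+ (2 * n.+2) * t j ^+ 2) @[j --> \oo] --> (0 : R).
    rewrite -[X in _ --> X](mulr0 (K * q ^+ (2 * n.+2))).
    by apply: cvgMr; exact: t2cvg.
  apply/subr_cvg0; apply: norm_cvg0; apply: squeeze_cvgr (cvg_cst 0) h.
  apply: nearW => j; rewrite normr_ge0/= (uint j).2.
  have -> : (-1) ^+ n * (f (t j) - \sum_(k < n) c k * t j ^+ (2 * k.+1)) / t j ^+ (2 * n.+1) -
     (-1) ^+ n * c n = (-1) ^+ n * (f (t j) - \sum_(k < n.+1) c k * t j ^+ (2 * k.+1)) / t j ^+ (2 * n.+1).
    by rewrite big_ord_recr/=; field.
  rewrite !normrM normrX normrN1 expr1n mul1r normfV (ger0_norm (ltW (tp _ _))).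
  rewrite ler_pdivrMr//; apply: le_trans (fapprox _ (t01 j)) _.
  by rewrite -[leRHS]mulrA -exprD -mulnS.
split => //; first by have := cvg_unique _ c1 c2 => ->.
rewrite -(cvg_lim (@Rhausdorff R) c1); apply: limr_le; first exact: cvgP c1.
apply: nearW => j; rewrite -lee_fin; apply: le_trans (ubd j).
by rewrite /Rintegral fineK//; apply: integrable_fin_num => //; case: (uint j).
Qed.

End even_moments.

(** * From even moments to exponential moments *)

Section exponential_moment.
Context {dd : measure_display} {T : measurableType dd} {R : realType}.
Variables (mu : {finite_measure set T -> \bar R}) (X : T -> R).
Hypothesis mX : measurable_fun setT X.

(** Twice the partial sums of cosh X converge to exp X + exp (-X), which is at least exp |X|. The
    geometric moment bounds keep their integrals bounded, and Fatou's lemma concludes. *)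
Lemma integrable_expR_abs (K q : R) : 0 <= K -> 0 < q -> q < 1 ->
  (forall n, mu.-integrable setT (EFin \o (fun x => X x ^+ (2 * n.+1) / (2 * n.+1)`!%:R)) /\
    \int[mu]_x (X x ^+ (2 * n.+1) / (2 * n.+1)`!%:R) <= K * q ^+ (2 * n.+1)) ->
  mu.-integrable setT (EFin \o (fun x => expR `|X x|)).
Proof.
move=> K0 q0 q1 H.
pose s n x : R := 2 * (1 + \sum_(k < n) X x ^+ (2 * k.+1) / (2 * k.+1)`!%:R).
have sE n x : s n x = series (exp_coeff (X x)) (2 * n.+1)%N +
    series (exp_coeff (- X x)) (2 * n.+1)%N.
  have h := even_part_sum (fun k => (k`!%:R)^-1) (X x) n.
  have E (y : R) : exp_coeff y = (fun k => (k`!%:R)^-1 * y ^+ k).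
    by apply/funext => k; rewrite /exp_coeff/= mulrC.
  rewrite !E /s.
  under eq_bigr do rewrite mulrC.
  by rewrite h fact0 invr1; field.
have i1 : mu.-integrable setT (EFin \o cst (1 : R)) by exact: finite_measure_integrable_cst.
have iS n : mu.-integrable setT (EFin \o (fun x => \sum_(k < n) X x ^+ (2 * k.+1) / (2 * k.+1)`!%:R)).
  rewrite (_ : _ \o _ = (fun x => \sum_(k < n) (X x ^+ (2 * k.+1) / (2 * k.+1)`!%:R)%:E)%E); last first.
    by apply/funext => x /=; rewrite sumEFin.
  by apply: integrable_sum => // k _; case: (H k).
have is_ n : mu.-integrable setT (EFin \o s n).
  have h := integrableZl measurableT 2 (integrableD measurableT i1 (iS n)).
  by apply: eq_integrable h.
have sumle n : \int[mu]_x (\sum_(k < n) X x ^+ (2 * k.+1) / (2 * k.+1)`!%:R) <= K / (1 - q).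
  apply: (@le_trans _ _ (\sum_(k < n) K * q ^+ k)).
    elim: n => [|n IHn].
      by under eq_Rintegral do rewrite big_ord0; rewrite /Rintegral integral0 big_ord0.
    have [h1 h2] := H n.
    have -> : \int[mu]_x (\sum_(k < n.+1) X x ^+ (2 * k.+1) / (2 * k.+1)`!%:R) =
        \int[mu]_x (\sum_(k < n) X x ^+ (2 * k.+1) / (2 * k.+1)`!%:R) +
        \int[mu]_x (X x ^+ (2 * n.+1) / (2 * n.+1)`!%:R).
      by rewrite -RintegralD//; apply: eq_Rintegral => x _; rewrite big_ord_recr.
    rewrite big_ord_recr/= lerD//.
    apply: le_trans h2 _; rewrite ler_wpM2l// ler_wiXn2l//; [exact: ltW|exact: ltW|lia].
  rewrite -mulr_sumr ler_wpM2l//.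
  have p0 : 0 < 1 - q by rewrite subr_gt0.
  rewrite -[leRHS]mul1r ler_pdivlMr//.
  have := subrX1 q n; rewrite -opprB => /(congr1 -%R).
  rewrite opprK -mulNr opprB [(1 - q) * _]mulrC => <-.
  by rewrite gerBl exprn_ge0// ltW.
have sbd n : (\int[mu]_x (s n x)%:E <= (2 * (fine (mu setT) + K / (1 - q)))%:E)%E.
  rewrite -(fineK (integrable_fin_num measurableT (is_ n))).
  rewrite -[fine _]/(\int[mu]_x s n x) lee_fin /s.
  have iD : mu.-integrable setT (EFin \o (fun x => 1 + \sum_(k < n) X x ^+ (2 * k.+1) / (2 * k.+1)`!%:R)).
    by apply: eq_integrable (integrableD measurableT i1 (iS n)).
  rewrite RintegralZl// ler_pM2l// RintegralD// lerD//.
  by rewrite Rintegral_cst// mul1r.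
have mexp : measurable_fun setT (fun x => expR `|X x|).
  by apply: measurableT_comp => //; exact: measurableT_comp.
have s0 n x : 0 <= s n x.
  rewrite mulr_ge0// addr_ge0// sumr_ge0// => k _.
  by rewrite divr_ge0// exprM exprn_ge0// sqr_ge0.
apply/integrableP; split; first exact/measurable_EFinP.
apply: (@le_lt_trans _ _ (\int[mu]_x limn_einf (fun j => (s j x)%:E))%E).
  have scvg x : (s n x)%:E @[n --> \oo] --> (expR (X x) + expR (- X x))%:E.
    apply: cvg_EFin; first exact: nearW.
    rewrite (_ : _ \o _ = (fun n => s n x))//.
    under eq_fun do rewrite sE.
    have sub : (2 * n.+1)%N @[n --> \oo] --> \oo.
      apply/cvgnyPge => A; near=> n.
      have : (A <= n)%N by near: n; exact: nbhs_infty_ge.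
      lia.
    by apply: cvgD; apply: (cvg_comp _ _ sub); exact: is_cvg_series_exp_coeff.
  apply: ge0_le_integral => //.
  - by apply: measurableT_comp => //; exact/measurable_EFinP.
  - apply: (@eq_measurable_fun _ _ _ _ _ (fun x => (expR (X x) + expR (- X x))%:E)).
      by move=> x _; rewrite (cvg_limn_einf_sup (scvg x)).1.
    apply/measurable_EFinP; apply: measurable_funD.
      exact: measurableT_comp.
    by apply: measurableT_comp => //; exact: measurable_funN.
  - move=> x _; rewrite (cvg_limn_einf_sup (scvg x)).1 /= lee_fin.
    rewrite ger0_norm ?expR_ge0//.
    by case: (ger0P (X x)) => _; rewrite ?lerDl ?lerDr expR_ge0.
apply: le_lt_trans (fatou mu measurableT _ _) _.
- by move=> j; have [] := integrableP _ _ _ (is_ j).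
- by move=> j x _; rewrite lee_fin.
apply: (@le_lt_trans _ _ (2 * (fine (mu setT) + K / (1 - q)))%:E); last by rewrite ltry.
rewrite limn_einf_lim; apply: lime_le; first exact: is_cvg_einfs.
apply: nearW => j; apply: le_trans (sbd j).
by apply: ereal_inf_lbound; exists j => //=.
Unshelve. all: by end_near. Qed.

End exponential_moment.

(** * Gamma integrals *)

Section gamma_integral.
Context {R : realType}.

(** Half of the exponential decay absorbs the power, by (b x / 2)^n / n! <= exp (b x / 2). *)
Lemma expR_monomial_cvg0 (b : R) n : 0 < b ->
  expR (- b * x) * (x ^+ n / n`!%:R) @[x --> +oo] --> (0 : R).
Proof.
move=> b0; have b2 : 0 < b / 2 by rewrite divr_gt0.
have h : (b / 2) ^- n * expR (- (b / 2 * x)) @[x --> +oo] --> (0 : R).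
  have -> : 0 = (b / 2) ^- n * 0 :> R by rewrite mulr0.
  apply: cvgMr.
  apply: (@cvg_comp _ _ _ (fun x : R => b / 2 * x) (fun z : R => expR (- z)) _ (pinfty_nbhs R)).
    exact: gt0_cvgMry.
  exact: cvgr_expR.
apply: squeeze_cvgr (cvg_cst 0) h.
near=> x.
have x0 : 0 < x by near: x; exact: nbhs_pinfty_gt.
apply/andP; split.
  by rewrite mulr_ge0 ?expR_ge0// divr_ge0// exprn_ge0// ltW.
have := pow_fact_le n (ltW (mulr_gt0 b2 x0)).
have -> : - b * x = - (b / 2 * x) - (b / 2 * x) by field.
move=> hh; rewrite expRD -mulrA [leRHS]mulrC ler_wpM2l ?expR_ge0//.
rewrite expRN ler_pdivrMl ?expR_gt0// ler_pdivlMr ?exprn_gt0//.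
suff -> : x ^+ n / n`!%:R * (b / 2) ^+ n = (b / 2 * x) ^+ n / n`!%:R by [].
by move: (b / 2) => c; rewrite exprMn; ring.
Unshelve. all: by end_near. Qed.

(** A primitive of exp (-b x) x^k / k!, as repeated integration by parts produces it. *)
Fixpoint gamma_primitive (b : R) k (x : R) : R :=
  if k is k'.+1 then
    (gamma_primitive b k' x - expR (- b * x) * (x ^+ k / k`!%:R)) / b
  else - (expR (- b * x) / b).

Lemma is_derive_gamma_primitive (b : R) k x : b != 0 ->
  is_derive x (1:R) (gamma_primitive b k) (expR (- b * x) * (x ^+ k / k`!%:R)).
Proof.
move=> b0.
have de : is_derive x (1:R) (fun x : R => expR (- b * x)) (expR (- b * x) * - b).
  have h := is_deriveZ (- b) (@is_derive_id R _ x 1).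
  have := @is_derive1_comp R expR (fun y => - b * y) x _ _ (is_derive_expR _) _.
  apply; by apply: is_derive_eq h _; rewrite /GRing.scale/= mulr1.
elim: k => [|k IHk].
  have h := is_deriveN (is_deriveZ b^-1 de).
  have -> : gamma_primitive b 0 = - (b^-1 \*: (fun x : R => expR (- b * x))).
    by apply/funext => y; rewrite fctE /= mulrC.
  apply: is_derive_eq h _; rewrite /GRing.scale/= expr0 fact0 divr1 mulr1.
  by field.
have h := is_deriveZ b^-1 (is_deriveB IHk (is_deriveM de (is_derive_monomial k x))).
have -> : gamma_primitive b k.+1 = b^-1 \*: (gamma_primitive b k -
    ((fun x : R => expR (- b * x)) * (fun x : R => x ^+ k.+1 / k.+1`!%:R))).
  by apply/funext => y; rewrite !fctE /= mulrC.
apply: is_derive_eq h _; rewrite /GRing.scale/=.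
move: (x ^+ k / k`!%:R) (x ^+ k.+1 / k.+1`!%:R) => u v; field.
exact: b0.
Qed.

Lemma gamma_primitive_cvg0 (b : R) k : 0 < b ->
  gamma_primitive b k x @[x --> +oo] --> (0 : R).
Proof.
move=> b0; have b1 : b != 0 by rewrite gt_eqF.
elim: k => [|k IHk].
  have := expR_monomial_cvg0 0 b0.
  under eq_fun do rewrite expr0 fact0 divr1 mulr1.
  move=> h; have -> : 0 = - (0 * b^-1) :> R by rewrite mul0r oppr0.
  by apply: cvgN; apply: cvgMl.
have -> : 0 = (0 - 0) * b^-1 :> R by rewrite subr0 mul0r.
by apply: cvgMl; apply: cvgB => //; exact: expR_monomial_cvg0.
Qed.

Lemma gamma_primitive0 (b : R) k : gamma_primitive b k 0 = - (b ^+ k.+1)^-1.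
Proof.
elim: k => [|k IHk]; first by rewrite /= mulr0 expR0 expr1 mul1r.
by rewrite /= IHk expr0n mul0r mulr0 subr0 mulNr [in RHS]exprS invfM mulrC.
Qed.

Lemma gamma_integral (b : R) k : 0 < b ->
  (\int[lebesgue_measure]_(x in `[0%R, +oo[) (expR (- b * x) * (x ^+ k / k`!%:R))%:E =
   ((b ^+ k.+1)^-1)%:E)%E.
Proof.
move=> b0; have b1 : b != 0 by rewrite gt_eqF.
have cf : continuous (fun x : R => expR (- b * x) * (x ^+ k / k`!%:R)).
  move=> x; apply: cvgM.
    apply: continuous_comp; last exact: continuous_expR.
    by apply: cvgMr; exact: cvg_id.
  by apply: cvgMl; exact: exprn_continuous.
rewrite (@ge0_continuous_FTC2y R _ (gamma_primitive b k) 0 0).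
- by rewrite gamma_primitive0 sub0e -EFinN opprK.
- by move=> x x0; rewrite mulr_ge0 ?expR_ge0// divr_ge0// exprn_ge0.
- exact: continuous_subspaceT.
- exact: gamma_primitive_cvg0.
- by move=> x _; have [] := is_derive_gamma_primitive k x b1.
- apply: cvg_at_right_filter; apply: differentiable_continuous.
  by apply/derivable1_diffP; have [] := is_derive_gamma_primitive k 0 b1.
- move=> x _; rewrite derive1E.
  by have [_ ->] := is_derive_gamma_primitive k x b1.
Qed.

End gamma_integral.

(** * Norms and coordinates *)

Section euclidean.
Context {R : realType} {d : nat}.
Implicit Types (v x y : 'rV[R]_d) (z w : 'rV[R[i]]_d).
Local Notation Re := complex.Re.
Local Notation Im := complex.Im.

Lemma measurable_continuous (g : 'rV[R]_d -> R) : continuous g ->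
  measurable_fun [set: borel R d] (g : borel R d -> R).
Proof.
move=> cg; apply: (measurability _ (RGenOpens.measurableE R)).
move=> _ [_ [a [b ->] <-]]; rewrite setTI.
apply: sub_sigma_algebra.
by move/continuousP : cg; apply; exact: interval_open.
Qed.

Lemma measurable_closed (A : set 'rV[R]_d) : closed A ->
  measurable (A : set (borel R d)).
Proof.
move=> cA; rewrite -[A]setCK; apply: measurableC.
by apply: sub_sigma_algebra; exact: closed_openC.
Qed.

Lemma measurable_coord j : measurable_fun [set: borel R d] (fun x : borel R d => (x : 'rV[R]_d) 0 j).
Proof. by apply: measurable_continuous; exact: coord_continuous. Qed.

Variable N : 'rV[R]_d -> R.
Hypothesis N_norm : is_norm N.

Lemma norm_sum_le x : N x <= \sum_j `|x 0 j| * N (delta_mx 0 j).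
Proof.
rewrite {1}(row_sum_delta x).
elim/big_ind2 : _ => [|a b u v au bv|j _].
- by have := is_normZ N_norm 0 0; rewrite scale0r normr0 mul0r => ->.
- exact: le_trans (is_norm_triangle N_norm _ _) (lerD au bv).
- by rewrite (is_normZ N_norm).
Qed.

Lemma norm0 : N 0 = 0.
Proof. by have := is_normZ N_norm 0 0; rewrite scale0r normr0 mul0r. Qed.

Lemma normN x : N (- x) = N x.
Proof. by rewrite -scaleN1r (is_normZ N_norm) normrN1 mul1r. Qed.

Lemma norm_ge0 x : 0 <= N x.
Proof.
have := is_norm_triangle N_norm x (- x).
by rewrite subrr norm0 normN -mulr2n pmulrn_lge0.
Qed.

Lemma coord_le_mx_norm x j : `|x 0 j| <= `|x|.
Proof.
rewrite [leRHS]/Num.Def.normr/= mx_normrE.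
exact: (le_bigmax _ (fun ij : 'I_1 * 'I_d => `|x ij.1 ij.2|) (0, j)).
Qed.

(** N is Lipschitz for the maximum norm, with constant the sum of its values at the unit vectors. *)
Lemma continuous_norm : continuous N.
Proof.
pose C := \sum_j N (delta_mx 0 j : 'rV[R]_d).
have C0 : 0 <= C by apply: sumr_ge0 => j _; exact: norm_ge0.
have NC x : N x <= C * `|x|.
  apply: le_trans (norm_sum_le x) _; rewrite mulr_suml; apply: ler_sum => j _.
  rewrite mulrC ler_wpM2l ?norm_ge0//.
  exact: coord_le_mx_norm.
have lip x y : `|N x - N y| <= C * `|x - y|.
  rewrite ler_norml; apply/andP; split.
    rewrite lerNl opprB lerBlDr; apply: le_trans (_ : N (y - x) + N x <= _).
      by have := is_norm_triangle N_norm (y - x) x; rewrite subrK.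
    by rewrite lerD2r distrC NC.
  rewrite lerBlDr; apply: le_trans (_ : N (x - y) + N y <= _).
    by have := is_norm_triangle N_norm (x - y) y; rewrite subrK.
  by rewrite lerD2r NC.
move=> x; suff h : N y @[y --> x] --> N x by exact: h.
apply/(@cvgrPdist_lt R R _ (nbhs (x : 'rV[R]_d)) (nbhs_filter (x : 'rV[R]_d)) N (N x)) => e e0.
have C1 : 0 < C + 1 by rewrite ltr_wpDl.
near=> y.
apply: le_lt_trans (lip x y) _.
apply: (@le_lt_trans _ _ ((C + 1) * `|x - y|)).
  by rewrite ler_wpM2r// lerDl.
rewrite mulrC -ltr_pdivlMr//.
near: y; apply: cvgr_dist_lt; last by rewrite divr_gt0.
exact: cvg_id.
Unshelve. all: by end_near. Qed.

Lemma closed_unit_sphere : closed (unit_sphere N).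
Proof.
have -> : unit_sphere N = N @^-1` [set 1] by [].
apply: preimage_closed; last exact: closed_eq.
by move=> x _; exact: continuous_norm.
Qed.

Lemma measurable_unit_sphere : measurable (unit_sphere N : set (borel R d)).
Proof. exact: measurable_closed closed_unit_sphere. Qed.

(** N has a positive minimum on the compact unit sphere of the maximum norm, and a vector with N v =
    1 has maximum norm at most the inverse of that minimum. *)
Lemma unit_sphere_bounded : exists2 C : R, 0 < C &
  forall v, unit_sphere N v -> forall j, `|v 0 j| <= C.
Proof.
(* In dimension 0 the sphere is empty, and the compact set below would have no point at which to
   attain a minimum. *)
have [[v0 Sv0]|noS] := pselect (exists v, unit_sphere N v); last first.
  by exists 1 => // v Sv; exfalso; apply: noS; exists v.
pose A := [set v : 'rV[R]_d | `|v| = 1].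
have scaled v : unit_sphere N v -> A (`|v|^-1 *: v) /\ 0 < `|v|.
  move=> Sv; have v0' : 0 < `|v|.
    rewrite normr_gt0; apply/eqP => v00.
    by move: Sv; rewrite /unit_sphere/= v00 norm0 => /eqP; rewrite eq_sym oner_eq0.
  by split => //; rewrite /A/= normrZ normfV normr_id mulVf// gt_eqF.
have cA : compact A.
  apply: bounded_closed_compact.
    by exists 1; split => // x x1 y /= ->; exact: ltW.
  rewrite /A; apply: (@preimage_closed _ _ (@Num.norm _ 'rV[R]_d) [set 1]); last exact: closed_eq.
  by move=> x _; exact: norm_continuous.
have [||c] := @EVT_min_rV R d N A _ cA.
- by exists (`|v0|^-1 *: v0); have [] := scaled v0 Sv0.
- by apply: continuous_subspaceT; exact: continuous_norm.
rewrite inE => Ac cmin.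
have Nc0 : 0 < N c.
  rewrite lt_neqAle norm_ge0 andbT eq_sym; apply/eqP => Nc0.
  move: Ac; rewrite /A/= (is_norm0_eq0 N_norm Nc0) normr0 => /eqP.
  by rewrite eq_sym oner_eq0.
exists (N c)^-1; first by rewrite invr_gt0.
move=> v Sv j; apply: le_trans (coord_le_mx_norm v j) _.
have [Av v0'] := scaled v Sv.
have := cmin _ (mem_set Av).
rewrite (is_normZ N_norm) normfV normr_id Sv mulr1.
by move=> h; rewrite -[leLHS]invrK lef_pV2// posrE// invr_gt0.
Qed.

End euclidean.

Section bilinear_product.
Context {R : realType} {d : nat}.
Implicit Types (v x y : 'rV[R]_d) (z w : 'rV[R[i]]_d).
Local Notation Re := complex.Re.
Local Notation Im := complex.Im.
Local Notation toC := (map_mx (real_complex R)).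

Lemma cdotD v z w : cdot v (z + w) = cdot v z + cdot v w.
Proof. by rewrite /cdot -big_split; apply: eq_bigr => j _; rewrite mxE mulrDr. Qed.

Lemma cdotZ v (a : R[i]) z : cdot v (a *: z) = a * cdot v z.
Proof. by rewrite /cdot mulr_sumr; apply: eq_bigr => j _; rewrite mxE mulrCA. Qed.

Lemma cdot_real v y : cdot v (toC y) = (\sum_j v 0 j * y 0 j)%:C.
Proof.
rewrite /cdot rmorph_sum; apply: eq_bigr => j _.
by rewrite mxE rmorphM.
Qed.

Lemma normc_cdot_le v z (e : R) : (forall j, normc (z 0 j) <= e) ->
  normc (cdot v z) <= e * \sum_j `|v 0 j|.
Proof.
move=> ze; apply: le_trans (normc_sum _ _ _) _; rewrite mulr_sumr.
by apply: ler_sum => j _; rewrite normcM normc_real mulrC ler_wpM2r.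
Qed.

Lemma cdot_delta v (a : R[i]) j : cdot v (a *: delta_mx 0 j) = a * (v 0 j)%:C.
Proof.
rewrite cdotZ /cdot (bigD1 j)//= big1 ?addr0.
  by rewrite mxE !eqxx mulr1.
by move=> k kj; rewrite mxE (negbTE kj) andbF mulr0.
Qed.

Lemma cmeasurable_cdot (D : set (borel R d)) z : measurable D ->
  cmeasurable D (fun v : borel R d => cdot (v : 'rV[R]_d) z).
Proof.
move=> mD; rewrite /cdot.
apply: (@cmeasurable_sum _ _ _ D _ _ (fun j (v : borel R d) => (((v : 'rV[R]_d) 0 j)%:C * z 0 j))) => j.
apply: (cmeasurableM (g := fun=> z 0 j)); last exact: cmeasurable_cst.
by apply: cmeasurable_real; apply: measurable_funTS; exact: measurable_coord.
Qed.

Lemma complex_vector z : z = toC (map_mx (@complex.Re R) z) + 'i%C *: toC (map_mx (@complex.Im R) z).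
Proof. by apply/rowP => j; rewrite !mxE [LHS]complexE. Qed.

(** The sum of the |x_j| is at most d times the largest one, so the exponential is below one of the
    functions assumed integrable. Dividing by d + 1 and adding 1 to the bound keep the case d = 0
    valid. *)
Lemma integrable_expR_sum (mu : {finite_measure set (borel R d) -> \bar R}) (e : R) :
  0 < e ->
  (forall j, mu.-integrable setT (EFin \o (fun x : borel R d => expR (e * `|(x : 'rV[R]_d) 0 j|)))) ->
  exists2 e' : R, 0 < e' &
    mu.-integrable setT (EFin \o (fun x : borel R d => expR (e' * \sum_j `|(x : 'rV[R]_d) 0 j|))).
Proof.
move=> e0 ie; exists (e / d.+1%:R); first by rewrite divr_gt0.
have i1 : mu.-integrable setT (EFin \o cst (1 : R)) by exact: finite_measure_integrable_cst.
have iS : mu.-integrable setT (EFin \o (fun x : borel R d => \sum_j expR (e * `|(x : 'rV[R]_d) 0 j|))).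
  rewrite (_ : _ \o _ = (fun x : borel R d => \sum_j (expR (e * `|(x : 'rV[R]_d) 0 j|))%:E)%E); last first.
    by apply/funext => x /=; rewrite sumEFin.
  by apply: integrable_sum => // j _; exact: ie.
have iD : mu.-integrable setT (EFin \o (fun x : borel R d => 1 + \sum_j expR (e * `|(x : 'rV[R]_d) 0 j|))).
  by apply: eq_integrable (integrableD measurableT i1 iS).
apply: le_integrable iD => //.
  apply/measurable_EFinP; apply: measurableT_comp => //; apply: measurable_funM => //.
  apply: (@measurable_sum _ _ _ _ _ _ (fun j (x : borel R d) => `|(x : 'rV[R]_d) 0 j|)) => j.
  by apply: measurableT_comp => //; exact: measurable_coord.
move=> x _; rewrite /= lee_fin.
have S0 : 0 <= \sum_j expR (e * `|(x : 'rV[R]_d) 0 j|).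
  by apply: sumr_ge0 => j _; exact: expR_ge0.
rewrite !ger0_norm ?expR_ge0 ?addr_ge0//.
have [[j0 _]|nj] := pselect (exists j : 'I_d, True); last first.
  rewrite big1 ?mulr0 ?expR0 ?lerDl// => j _.
  by exfalso; apply: nj; exists j.
pose jm := [arg max_(j > j0) `|(x : 'rV[R]_d) 0 j|]%O.
have jmP j : `|(x : 'rV[R]_d) 0 j| <= `|(x : 'rV[R]_d) 0 jm|.
  by rewrite /jm; case: arg_maxP => // k _ /(_ j); apply.
apply: (@le_trans _ _ (expR (e * `|(x : 'rV[R]_d) 0 jm|))); last first.
  rewrite (bigD1 jm)//= addrCA lerDl addr_ge0//.
  by apply: sumr_ge0 => j _; exact: expR_ge0.
rewrite ler_expR -mulrA ler_pM2l// ler_pdivrMl//.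
apply: (@le_trans _ _ (\sum_(j < d) `|(x : 'rV[R]_d) 0 jm|)).
  by apply: ler_sum.
by rewrite sumr_const card_ord -[leLHS]mulr_natl ler_wpM2r// ler_nat.
Qed.

End bilinear_product.

(** * Limits of complex sequences and exponential sums *)

Section complex_limits.
Context {R : realType}.
Implicit Types (u w : nat -> R[i]) (l z : R[i]).
Local Notation Re := complex.Re.
Local Notation Im := complex.Im.

Lemma normc_prod (I : Type) (s : seq I) (F : I -> R[i]) :
  normc (\prod_(i <- s) F i) = \prod_(i <- s) normc (F i).
Proof. exact: (big_morph _ (@normcM R) (@normc1 R)). Qed.

Definition ccvg u l := Re (u n) @[n --> \oo] --> Re l /\ Im (u n) @[n --> \oo] --> Im l.

Lemma ccvg_cst l : ccvg (fun=> l) l.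
Proof. by split; exact: cvg_cst. Qed.

Lemma ccvgM u w l (m : R[i]) : ccvg u l -> ccvg w m -> ccvg (fun n => u n * w n) (l * m).
Proof.
move=> [u1 u2] [w1 w2]; split.
- under eq_fun do rewrite Re_mul; rewrite Re_mul.
  by apply: cvgB; exact: cvgM.
- under eq_fun do rewrite Im_mul; rewrite Im_mul.
  by apply: cvgD; exact: cvgM.
Qed.

Lemma ccvg_prod (I : Type) (s : seq I) (F : I -> nat -> R[i]) (l : I -> R[i]) :
  (forall i, ccvg (F i) (l i)) -> ccvg (fun n => \prod_(i <- s) F i n) (\prod_(i <- s) l i).
Proof.
move=> Fl; elim: s => [|i s IHs].
  by rewrite big_nil; under [X in ccvg X]eq_fun do rewrite big_nil; exact: ccvg_cst.
by rewrite big_cons; under [X in ccvg X]eq_fun do rewrite big_cons; exact: ccvgM.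
Qed.

Lemma ccvg_csum (a : nat -> R[i]) : cgeo a -> ccvg (fun n => \sum_(k < n) a k) (csum a).
Proof.
move=> ga; split.
- under eq_fun do rewrite Re_sum.
  have := geo_cvg (cgeo_Re ga); rewrite {1}/series/=.
  by under eq_fun do rewrite big_mkord.
- under eq_fun do rewrite Im_sum.
  have := geo_cvg (cgeo_Im ga); rewrite {1}/series/=.
  by under eq_fun do rewrite big_mkord.
Qed.

Lemma csum_unique (a : nat -> R[i]) l : ccvg (fun n => \sum_(k < n) a k) l -> csum a = l.
Proof.
move=> [h1 h2]; apply: eqcP; rewrite /csum/=; apply: cvg_lim => //.
- move: h1; rewrite /series/=; under eq_fun do rewrite Re_sum.
  by under [in X in _ -> X]eq_fun do rewrite big_mkord.
- move: h2; rewrite /series/=; under eq_fun do rewrite Im_sum.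
  by under [in X in _ -> X]eq_fun do rewrite big_mkord.
Qed.

Lemma csumZ (c : R[i]) (a : nat -> R[i]) : cgeo a -> csum (fun k => c * a k) = c * csum a.
Proof.
move=> ga; apply: csum_unique.
have := ccvgM (ccvg_cst c) (ccvg_csum ga).
by under [X in ccvg X]eq_fun do rewrite mulr_sumr.
Qed.

Lemma cgeoZ (c : R[i]) (a : nat -> R[i]) : cgeo a -> cgeo (fun k => c * a k).
Proof.
move=> [K [q [K0 q0 q1 aK]]]; exists (normc c * K), q; split => //.
  by rewrite mulr_ge0// normc_ge0.
by move=> k; rewrite normcM -mulrA ler_wpM2l// normc_ge0.
Qed.

Lemma cvg_complex u l : ccvg u l -> u @ \oo --> l.
Proof.
move=> [h1 h2]; apply/cvgrPdist_lt => e e0.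
move: (e0); rewrite ltcE => /andP[/eqP Ie Re0].
have eE : e = (Re e)%:C by apply: eqcP.
have e2 : 0 < Re e / 2 by rewrite divr_gt0.
rewrite eE; near=> n.
rewrite -[`|_|]/((normc (l - u n))%:C) ltcR.
apply: le_lt_trans (normc_le_ReIm _) _.
rewrite [Re e]splitr Re_add Im_add Re_opp Im_opp.
apply: ltrD; near: n.
- by have /cvgrPdist_lt := h1; apply.
- by have /cvgrPdist_lt := h2; apply.
Unshelve. all: by end_near. Qed.

Lemma partial_exp_le z n : normc (\sum_(k < n) z ^+ k / k`!%:R) <= expR (normc z).
Proof.
apply: le_trans (normc_sum _ _ _) _.
have -> : \sum_(k < n) normc (z ^+ k / k`!%:R) = series (exp_coeff (normc z)) n.
  rewrite /series/= big_mkord; apply: eq_bigr => k _.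
  by rewrite normcM normcX normcV normc_nat.
apply: nondecreasing_cvgn_le; last exact: is_cvg_series_exp_coeff.
apply: nondecreasing_series => k _ _.
by rewrite /exp_coeff/= divr_ge0// exprn_ge0// normc_ge0.
Qed.

(** Finitely many multi-indices fit into a box, over which the sum of products factors into a
    product of partial exponential sums. The bound is uniform in s, as summability over all
    multi-indices requires. *)
Lemma sum_multi_exp (d : nat) (s : seq {ffun 'I_d -> nat}) (y : 'I_d -> R) :
  uniq s -> (forall j, 0 <= y j) ->
  \sum_(m <- s) \prod_j (y j ^+ m j / (m j)`!%:R) <= \prod_j expR (y j).
Proof.
move=> us y0.
pose n := \max_(m <- s) \max_j m j.
have mn (m : {ffun 'I_d -> nat}) j : m \in s -> (m j < n.+1)%N.
  move=> ms; rewrite ltnS; apply: leq_trans (leq_bigmax_seq _ ms isT).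
  exact: leq_bigmax.
pose box (m : {ffun 'I_d -> nat}) : {ffun 'I_d -> 'I_n.+1} := [ffun j => inord (m j)].
pose F (j : 'I_d) (k : 'I_n.+1) : R := y j ^+ k / k`!%:R.
have F0 j k : 0 <= F j k by rewrite divr_ge0// exprn_ge0.
have -> : \sum_(m <- s) \prod_j (y j ^+ m j / (m j)`!%:R) =
    \sum_(f <- map box s) \prod_j F j (f j).
  rewrite big_map big_seq [RHS]big_seq; apply: eq_bigr => m ms.
  by apply: eq_bigr => j _; rewrite /F ffunE inordK// mn.
have ubox : uniq (map box s).
  rewrite map_inj_in_uniq// => m1 m2 m1s m2s /ffunP e; apply/ffunP => j.
  by have := congr1 (@nat_of_ord _) (e j); rewrite !ffunE !inordK// mn.
rewrite big_uniq//=.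
apply: (@le_trans _ _ (\sum_(f : {ffun 'I_d -> 'I_n.+1}) \prod_j F j (f j))).
  rewrite big_mkcond/=; apply: ler_sum => f _; case: ifP => // _.
  by apply: prodr_ge0.
rewrite -(bigA_distr_bigA F).
apply: ler_prod => j _; rewrite sumr_ge0//=.
have -> : \sum_(k < n.+1) F j k = series (exp_coeff (y j)) n.+1.
  by rewrite /series/= big_mkord.
apply: nondecreasing_cvgn_le; last exact: is_cvg_series_exp_coeff.
apply: nondecreasing_series => k _ _.
by rewrite /exp_coeff/= divr_ge0// exprn_ge0.
Qed.

End complex_limits.

(** * The Fourier-Laplace transform *)

Section fourier_laplace.
Context {R : realType} {d : nat}.
Variables (mu : probability (borel R d) R) (eps : R).
Implicit Types (x : 'rV[R]_d) (z y : 'rV[R[i]]_d) (w : R[i]).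
Local Notation Re := complex.Re.
Local Notation Im := complex.Im.
Let S x : R := \sum_j `|x 0 j|.
Let h x : R := expR (eps * S x).
Hypothesis eps0 : 0 < eps.
Hypothesis ih : mu.-integrable setT (EFin \o (fun x : borel R d => expR (eps * \sum_j `|(x : 'rV[R]_d) 0 j|))).

Let S0 x : 0 <= S x. Proof. exact: sumr_ge0. Qed.

Lemma normc_cexp_cdot x z (e : R) : (forall j, normc (z 0 j) <= e) ->
  normc (cexp ('i%C * cdot x z)) <= expR (e * \sum_j `|x 0 j|).
Proof.
move=> ze; rewrite normc_cexp ler_expR.
apply: le_trans (normc_cdot_le x ze).
apply: le_trans (ler_norm _) _; apply: le_trans (Re_le_normc _) _.
by rewrite normcM normc_i mul1r.
Qed.

Let mcexp z : cmeasurable setT (fun x : borel R d => cexp ('i%C * cdot (x : 'rV[R]_d) z)).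
Proof.
apply: cmeasurable_cexp; apply: (cmeasurableM (f := fun=> 'i%C)); first exact: cmeasurable_cst.
exact: cmeasurable_cdot.
Qed.

Lemma FL_exists_small z : (forall j, normc (z 0 j) <= eps) -> FL_exists mu z.
Proof.
move=> ze; apply: (cintegrable_le _ (mcexp z) ih) => //.
by apply: aeW => x _; exact: normc_cexp_cdot.
Qed.

Let third0 : 0 < eps / 3. Proof. by rewrite divr_gt0. Qed.
Let third : eps / 3 + eps / 3 <= eps.
Proof. by rewrite -mulrDl ler_pdivrMr//; move: eps0; lra. Qed.

(** Expands the exponential in powers of w under the integral. One third of eps pays for z0, another
    for the k-th exponential term in the direction y, whose smallness leaves a factor q^k. The
    constant in the bound does not depend on q, which [FL_log_axis] exploits. *)
Lemma FL_line z0 y (q : R) : 0 < q -> q < 1 ->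
  (forall j, normc (z0 0 j) <= eps / 3) ->
  (forall j, normc (y 0 j) <= q * (eps / 3)) ->
  exists2 a : nat -> R[i],
    forall k, normc (a k) <= (2 * \int[mu]_x h x) * q ^+ k &
    forall w, normc w <= 1 -> FL mu (z0 + w *: y) = csum (fun k => a k * w ^+ k).
Proof.
move=> q0 q1 z0e ye.
pose T k x : R[i] := cexp ('i%C * cdot x z0) * (('i%C * cdot x y) ^+ k / k`!%:R).
have Tle k x : normc (T k x) <= h x * q ^+ k.
  rewrite /T normcM.
  apply: (@le_trans _ _ (expR (eps / 3 * S x) * (q ^+ k * expR (eps / 3 * S x)))).
    apply: ler_pM; rewrite ?normc_ge0//; first exact: normc_cexp_cdot.
    have := pow_fact_le k (mulr_ge0 (ltW third0) (S0 x)).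
    rewrite normcM normcX normcM normc_i mul1r normcV normc_nat => hh.
    apply: le_trans (ler_wpM2l (exprn_ge0 k (ltW q0)) hh).
    rewrite mulrA -exprMn ler_wpM2r ?invr_ge0// lerXn2r ?nnegrE ?normc_ge0//.
      by rewrite !mulr_ge0// ltW.
    by apply: le_trans (normc_cdot_le x ye) _; rewrite -[leLHS]mulrA.
  rewrite mulrCA -expRD mulrC ler_wpM2r ?exprn_ge0 ?(ltW q0)// ler_expR -mulrDl.
  by rewrite ler_wpM2r.
have mT k : cmeasurable setT (T k : borel R d -> R[i]).
  apply: cmeasurableM; first exact: mcexp.
  apply: (cmeasurableM (g := fun=> _)); last exact: cmeasurable_cst.
  apply: cmeasurableX => //.
  apply: (cmeasurableM (f := fun=> 'i%C)); first exact: cmeasurable_cst.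
  exact: cmeasurable_cdot.
have ihq k : mu.-integrable setT (EFin \o (fun x : borel R d => h x * q ^+ k)).
  by apply: eq_integrable (integrableZr measurableT (q ^+ k) ih).
have iT k : cintegrable mu setT (T k).
  apply: (cintegrable_le _ (mT k) (ihq k)) => //.
  by apply: aeW => x _; exact: Tle.
exists (fun k => cintegral mu setT (T k)).
  move=> k; rewrite -mulrA -RintegralZr//.
  apply: (normc_cintegral_le measurableT (mT k) (ihq k)).
  by apply: aeW => x _; exact: Tle.
move=> w w1.
have wk k : normc (w ^+ k) <= 1 by rewrite normcX exprn_ile1// normc_ge0.
have p0 : 0 < 1 - q by rewrite subr_gt0.
have ihq' : mu.-integrable setT (EFin \o (fun x : borel R d => (1 - q)^-1 * h x)).
  by apply: eq_integrable (integrableZl measurableT (1 - q)^-1 ih).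
have [] := @cintegral_csum _ _ _ mu setT measurableT (fun k x => w ^+ k * T k x)
   (fun x : borel R d => cexp ('i%C * cdot (x : 'rV[R]_d) (z0 + w *: y)))
   (fun x => (1 - q)^-1 * h x).
- move=> k; apply: (cmeasurableM (f := fun=> _)); first exact: cmeasurable_cst.
  exact: mT.
- exact: mcexp.
- exact: ihq'.
- apply: aeW => x _.
  have E : (fun k => w ^+ k * T k x) = (fun k => cexp ('i%C * cdot x z0) *
      ((w * ('i%C * cdot x y)) ^+ k / k`!%:R)).
    by apply/funext => k; rewrite exprMn /T; ring.
  have g := cgeo_exp (w * ('i%C * cdot x y)).
  rewrite E; split; first exact: cgeoZ.
  rewrite csumZ// csum_exp -cexpD; congr cexp.
  by rewrite cdotD cdotZ; ring.
- apply: aeW => x n _.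
  apply: (@le_trans _ _ (\sum_(k < n) h x * q ^+ k)).
    apply: ler_sum => k _; rewrite normcM; apply: le_trans (Tle k x).
    by rewrite ler_piMl// normc_ge0.
  rewrite -mulr_sumr mulrC ler_wpM2r ?expR_ge0//.
  rewrite -[leRHS]mul1r ler_pdivlMr//.
  have := subrX1 q n; rewrite -opprB => /(congr1 -%R).
  rewrite opprK -mulNr opprB [(1 - q) * _]mulrC => <-.
  by rewrite gerBl exprn_ge0// ltW.
move=> _ _ _ _ csE; rewrite /FL -csE.
by congr csum; apply/funext => k; rewrite cintegralZl// mulrC.
Qed.

(** The coefficients are the integrals of exp (i x.z0) times the product of the (i x_j)^(m_j) /
    m_j!. Over a box of multi-indices the integrands add up to a product of one-variable partial
    exponential sums, which is dominated by [h] and converges pointwise. *)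
Lemma FL_analytic z0 : (forall j, normc (z0 0 j) <= eps / 3) -> analytic_at (FL mu) z0.
Proof.
move=> z0e.
pose T (m : {ffun 'I_d -> nat}) x : R[i] :=
  cexp ('i%C * cdot x z0) * \prod_j (('i%C * (x 0 j)%:C) ^+ m j / (m j)`!%:R).
exists (fun m => cintegral mu setT (T m)), (eps / 3); split => // hh hhe.
pose G (m : {ffun 'I_d -> nat}) x : R[i] :=
  cexp ('i%C * cdot x z0) * \prod_j (('i%C * (x 0 j)%:C * hh 0 j) ^+ m j / (m j)`!%:R).
pose g (m : {ffun 'I_d -> nat}) x : R :=
  expR (eps / 3 * S x) * \prod_j ((eps / 3 * `|x 0 j|) ^+ m j / (m j)`!%:R).
have expS x : \prod_j expR (eps / 3 * `|x 0 j|) = expR (eps / 3 * S x).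
  by rewrite /S mulr_sumr expR_sum.
have exph x : expR (eps / 3 * S x) * expR (eps / 3 * S x) <= h x.
  by rewrite -expRD ler_expR -mulrDl ler_wpM2r.
have sumg s x : uniq s -> \sum_(m <- s) g m x <= h x.
  move=> us; rewrite -mulr_sumr; apply: le_trans (exph x).
  rewrite ler_wpM2l ?expR_ge0// -expS.
  by apply: sum_multi_exp => // j; rewrite mulr_ge0// ltW.
have g0 m x : 0 <= g m x.
  rewrite mulr_ge0 ?expR_ge0// prodr_ge0// => j _.
  by rewrite divr_ge0// exprn_ge0// mulr_ge0// ltW.
have gh m x : g m x <= h x.
  by have := sumg [:: m] x isT; rewrite big_seq1.
have mS : measurable_fun setT (S : borel R d -> R).
  apply: (@measurable_sum _ _ _ _ _ _ (fun j (x : borel R d) => `|(x : 'rV[R]_d) 0 j|)) => j.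
  by apply: measurableT_comp => //; exact: measurable_coord.
have mg m : measurable_fun setT (g m : borel R d -> R).
  apply: measurable_funM.
    by apply: measurableT_comp => //; exact: measurable_funM.
  apply: (@measurable_prod _ _ _ _ _ _ (fun j (x : borel R d) => (eps / 3 * `|(x : 'rV[R]_d) 0 j|) ^+ m j / (m j)`!%:R)) => j _.
  apply: measurable_funM => //; apply: measurable_funX; apply: measurable_funM => //.
  by apply: measurableT_comp => //; exact: measurable_coord.
have ig m : mu.-integrable setT (EFin \o (g m : borel R d -> R)).
  apply: le_integrable ih => //; first exact/measurable_EFinP.
  by move=> x _; rewrite /= lee_fin !ger0_norm ?g0 ?expR_ge0// gh.
have Gle m x : normc (G m x) <= g m x.
  rewrite /G normcM; apply: ler_pM; rewrite ?normc_ge0//.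
    exact: normc_cexp_cdot.
  rewrite normc_prod.
  apply: ler_prod => j _; rewrite normc_ge0/= normcM normcV normc_nat normcX.
  rewrite !normcM normc_i mul1r normc_real ler_wpM2r ?invr_ge0//.
  apply: lerXn2r.
  - by rewrite nnegrE mulr_ge0// normc_ge0.
  - by rewrite nnegrE mulr_ge0// ltW.
  - by rewrite mulrC ler_wpM2r// ltW.
have mGT (e : 'I_d -> R[i]) m : cmeasurable setT (fun x : borel R d =>
    cexp ('i%C * cdot (x : 'rV[R]_d) z0) * \prod_j (('i%C * ((x : 'rV[R]_d) 0 j)%:C * e j) ^+ m j / (m j)`!%:R)).
  apply: cmeasurableM; first exact: mcexp.
  apply: (@cmeasurable_prod _ _ _ _ _ _ (fun j (x : borel R d) => (('i%C * ((x : 'rV[R]_d) 0 j)%:C * e j) ^+ m j / (m j)`!%:R))) => j.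
  apply: (cmeasurableM (g := fun=> _)); last exact: cmeasurable_cst.
  apply: cmeasurableX => //.
  apply: (cmeasurableM (g := fun=> _)); last exact: cmeasurable_cst.
  apply: (cmeasurableM (f := fun=> _)); first exact: cmeasurable_cst.
  by apply: cmeasurable_real; exact: measurable_coord.
have mG m : cmeasurable setT (G m : borel R d -> R[i]) by exact: mGT.
have iG m : cintegrable mu setT (G m).
  apply: (cintegrable_le _ (mG m) (ig m)) => //.
  by apply: aeW => x _; exact: Gle.
have iT m : cintegrable mu setT (T m).
  (* Integrability of [T m] cannot be read off [G m], since [hh] may have zero coordinates; with
     every coordinate set to eps / 3 the integrand becomes a nonzero multiple of [T m]. *)
  pose c0 : R[i] := \prod_j ((eps / 3)^-1)%:C ^+ m j.
  pose H x : R[i] := cexp ('i%C * cdot x z0) *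
    \prod_j (('i%C * (x 0 j)%:C * (eps / 3)%:C) ^+ m j / (m j)`!%:R).
  have iH : cintegrable mu setT H.
    apply: (cintegrable_le _ (mGT (fun=> (eps / 3)%:C) m) (ig m)) => //.
    apply: aeW => x _; rewrite normcM; apply: ler_pM; rewrite ?normc_ge0//.
      exact: normc_cexp_cdot.
    rewrite normc_prod.
    apply: ler_prod => j _; rewrite normc_ge0/= normcM normcV normc_nat normcX.
    by rewrite !normcM normc_i mul1r !normc_real (ger0_norm (ltW third0)) mulrC [`|_| * _]mulrC [leRHS]mulrC.
  have -> : (T m : borel R d -> R[i]) = (fun x => c0 * H x).
    apply/funext => x; rewrite /T /H /c0 mulrCA -big_split/=; congr (_ * _).
    apply: eq_bigr => j _; rewrite [in RHS]exprMn mulrA mulrCA -[in RHS]exprMn.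
    by rewrite -rmorphM/= mulVf ?gt_eqF// expr1n mulr1.
  exact: cintegrableZl.
have cG m : cintegral mu setT (T m) * monomial m hh = cintegral mu setT (G m).
  rewrite mulrC -cintegralZl//; congr cintegral; apply/funext => x.
  rewrite /T /G /monomial mulrCA -big_split/=; congr (_ * _).
  by apply: eq_bigr => j _; rewrite [in RHS]exprMn; ring.
split.
  rewrite /summable; apply: (@le_lt_trans _ _ (2 * \int[mu]_x h x)%:E); last exact: ltry.
  apply: ge_ereal_sup => _ [A [finA _] <-]; rewrite fsbig_finite//=.
  under eq_bigr do rewrite cG ger0_norm ?normc_ge0//.
  rewrite sumEFin lee_fin.
  apply: (@le_trans _ _ (\sum_(m <- finmap.enum_fset (fset_set A)) 2 * (\int[mu]_x g m x))).
    apply: ler_sum => m _; apply: (normc_cintegral_le measurableT (mG m) (ig m)).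
    by apply: aeW => x _; exact: Gle.
  rewrite -mulr_sumr ler_wpM2l//.
  have [iS <-] := Rintegral_sum measurableT (finmap.enum_fset (fset_set A)) ig.
  apply: le_Rintegral => // x _; apply: sumg; exact: finmap.fset_uniq.
apply: cvg_complex.
pose P n x : R[i] := cexp ('i%C * cdot x z0) *
  \prod_j \sum_(k < n) (('i%C * (x 0 j)%:C * hh 0 j) ^+ k / k`!%:R).
have PE n x : P n x = \sum_(f : {ffun 'I_d -> 'I_n}) G [ffun j => f j : nat] x.
  rewrite /P (bigA_distr_bigA (fun j (k : 'I_n) => ('i%C * (x 0 j)%:C * hh 0 j) ^+ k / k`!%:R)).
  rewrite mulr_sumr; apply: eq_bigr => f _; congr (_ * _).
  by apply: eq_bigr => j _; rewrite ffunE.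
have mP n : cmeasurable setT (P n : borel R d -> R[i]).
  rewrite (_ : P n = fun x => \sum_(f : {ffun 'I_d -> 'I_n}) G [ffun j => f j : nat] x); last exact/funext.
  by apply: cmeasurable_sum => f; exact: mG.
have Pcvg x : ccvg (P ^~ x) (cexp ('i%C * cdot x (z0 + hh))).
  rewrite cdotD mulrDr cexpD; apply: ccvgM; first exact: ccvg_cst.
  have -> : cexp ('i%C * cdot x hh) = \prod_j cexp ('i%C * (x 0 j)%:C * hh 0 j).
    rewrite /cdot mulr_sumr (big_morph _ (@cexpD R) (@cexp0 R)).
    by apply: eq_bigr => j _; rewrite mulrA.
  apply: ccvg_prod => j; rewrite -csum_exp; apply: ccvg_csum; exact: cgeo_exp.
have Ph n x : normc (P n x) <= h x.
  rewrite normcM; apply: le_trans (exph x); apply: ler_pM; rewrite ?normc_ge0//.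
    exact: normc_cexp_cdot.
  rewrite normc_prod -expS.
  apply: ler_prod => j _; rewrite normc_ge0/=; apply: le_trans (partial_exp_le _ _) _.
  rewrite ler_expR !normcM normc_i mul1r normc_real mulrC ler_wpM2r// ltW//.
have E n : \sum_(m : {ffun 'I_d -> 'I_n}) (let k := [ffun j => m j : nat] in
    cintegral mu setT (T k) * monomial k hh) = cintegral mu setT (P n).
  rewrite (_ : (P n : borel R d -> R[i]) = fun x => \sum_(f : {ffun 'I_d -> 'I_n}) G [ffun j => f j : nat] x); last exact/funext.
  rewrite cintegral_sum//; apply: eq_bigr => f _ /=; exact: cG.
split.
- under eq_fun do rewrite E.
  apply: (Rintegral_cvg measurableT _ _ ih).
  + by move=> n; have [] := mP n.
  + by have [] := mcexp (z0 + hh).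
  + by apply: aeW => x _; have [] := Pcvg x.
  + by apply: aeW => x n _; apply: le_trans (Re_le_normc _) (Ph n x).
- under eq_fun do rewrite E.
  apply: (Rintegral_cvg measurableT _ _ ih).
  + by move=> n; have [] := mP n.
  + by have [] := mcexp (z0 + hh).
  + by apply: aeW => x _; have [] := Pcvg x.
  + by apply: aeW => x n _; apply: le_trans (Im_le_normc _) (Ph n x).
Qed.

End fourier_laplace.

Section series_shift.
Context {R : realType}.
Local Notation Re := complex.Re.
Local Notation Im := complex.Im.

Lemma cgeo_shift (a : nat -> R[i]) : cgeo a -> cgeo (fun k => a k.+1).
Proof.
move=> [K [q [K0 q0 q1 aK]]]; exists (K * q), q; split => //.
  by rewrite mulr_ge0// ltW.
by move=> k; rewrite -mulrA -exprS.
Qed.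

Lemma csum_shift (a : nat -> R[i]) : cgeo a -> csum a = a 0%N + csum (fun k => a k.+1).
Proof.
move=> ga; apply: csum_unique.
have [h1 h2] := ccvg_csum (cgeo_shift ga).
have c n : \sum_(k < n.+1) a k = a 0%N + \sum_(k < n) a k.+1 by rewrite big_ord_recl.
split.
- rewrite -(cvg_shiftn 1) Re_add.
  under eq_fun do rewrite addn1 c Re_add.
  by apply: cvgD => //; exact: cvg_cst.
- rewrite -(cvg_shiftn 1) Im_add.
  under eq_fun do rewrite addn1 c Im_add.
  by apply: cvgD => //; exact: cvg_cst.
Qed.

Lemma csum_log_shift (u : R[i]) : normc u <= 4^-1 ->
  csum (log_coeff u) = csum (fun k => log_coeff u k.+1).
Proof. by move=> u4; rewrite (csum_shift (cgeo_log u4)) log_coeff0 add0r. Qed.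

End series_shift.

(** * The exponent of a Gamma distribution *)

Section frullani.
Context {R : realType}.
Notation leb := (@lebesgue_measure R).

Lemma gamma_integrable (b : R) k : 0 < b ->
  leb.-integrable `[0%R, +oo[ (EFin \o (fun r => expR (- b * r) * (r ^+ k / k`!%:R))).
Proof.
move=> b0; apply/integrableP; split.
  apply/measurable_EFinP; apply: measurable_funTS.
  apply: measurable_funM.
    by apply: measurableT_comp => //; exact: measurable_funM.
  by apply: measurable_funM => //; exact: measurable_funX.
under eq_integral => r r0.
  rewrite /= ger0_norm; last first.
    rewrite mulr_ge0 ?expR_ge0// divr_ge0// exprn_ge0//.
    by move: r0; rewrite inE/= in_itv/= andbT.
  over.
by rewrite gamma_integral// ltry.
Qed.

(** Frullani's integral by series: (exp (i r s) - 1) / r is expanded in powers of r, and the k-th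
    term against exp (-b r) is a Gamma integral with value (i s / b)^(k+1) / (k+1). The norms of the
    terms add up to at most |s| exp (-(b - |s|) r), integrable because |s| < b. *)
Lemma cexp_log_integral (b s : R) : 0 < b -> normc ('i%C * (s / b)%:C) <= 4^-1 ->
  cintegral leb `[0%R, +oo[ (fun r => (cexp ('i%C * r%:C * s%:C) - 1) * (expR (- b * r) / r)%:C) =
  csum (log_coeff ('i%C * (s / b)%:C)).
Proof.
move=> b0 u4; have mD : measurable (`[0%R, +oo[ : set R) by exact: measurable_itv.
have sb : `|s| < b.
  move: u4; rewrite normcM normc_i mul1r normc_real normrM normfV (gtr0_norm b0).
  by rewrite ler_pdivrMr// => /le_lt_trans; apply; rewrite gtr_pMl// invf_lt1 ?ltr1n.
pose a (k : nat) (r : R) : R[i] := ('i%C * s%:C) ^+ k.+1 / k.+1%:R * (expR (- b * r) * (r ^+ k / k`!%:R))%:C.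
have bs0 : 0 < b - `|s| by rewrite subr_gt0.
have mreal (g : R -> R) : measurable_fun setT g -> cmeasurable (`[0%R, +oo[ : set R) (fun r => (g r)%:C).
  by move=> mg; apply: cmeasurable_real; exact: measurable_funTS.
have me : measurable_fun setT (fun r : R => expR (- b * r)).
  by apply: measurableT_comp => //; exact: measurable_funM.
have [] := @cintegral_csum _ _ _ leb `[0%R, +oo[ mD a
  (fun r => (cexp ('i%C * r%:C * s%:C) - 1) * (expR (- b * r) / r)%:C)
  (fun r => `|s| * (expR (- (b - `|s|) * r) * (r ^+ 0 / 0`!%:R))).
- move=> k; apply: cmeasurableM; first exact: cmeasurable_cst.
  apply: mreal; apply: measurable_funM => //.
  by apply: measurable_funM => //; exact: measurable_funX.
- apply: cmeasurableM.
    apply: cmeasurableB; last exact: cmeasurable_cst.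
    apply: cmeasurable_cexp; apply: cmeasurableM; last exact: cmeasurable_cst.
    apply: cmeasurableM; first exact: cmeasurable_cst.
    by apply: mreal; exact: measurable_id.
  apply: mreal; apply: measurable_funM => //.
  by apply: measurable_inv => //; exact: measurable_id.
- exact: (@integrable_scale _ _ _ leb _ mD _ _ (gamma_integrable 0 bs0)).
(* The null set {0} has to be excluded: there division by zero makes the integrand 0, while the term
   k = 0 equals i s. *)
- exists [set (0 : R)]; split; first exact: measurable_set1.
    exact: lebesgue_measure_set1.
  move=> r /= nH; apply: contrapT => r0; apply: nH => r1.
  have rne : r != 0 by apply/eqP.
  have rne' : r%:C != 0 by rewrite fmorph_eq0.
  pose z := 'i%C * r%:C * s%:C.
  have aE k : a k r = (expR (- b * r) / r)%:C * (z ^+ k.+1 / k.+1`!%:R).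
    rewrite /a !rmorphM/= !rmorphXn fmorphV/= fmorphV/= rmorph_nat /z.
    rewrite factS natrM !exprMn exprS.
    have k1 : k.+1%:R != 0 :> R[i] by rewrite pnatr_eq0.
    have k2 : k`!%:R != 0 :> R[i] by rewrite pnatr_eq0 -lt0n fact_gt0.
    move: (k.+1%:R) (k`!%:R) k1 k2 => c1 c2 k1 k2.
    rewrite [r%:C ^+ k.+1]exprS.
    by field; rewrite k1 k2 rne'.
  have -> : a^~ r = (fun k => (expR (- b * r) / r)%:C * (z ^+ k.+1 / k.+1`!%:R)).
    by apply/funext => k; exact: aE.
  have ge := cgeo_exp z; have ges := cgeo_shift ge.
  split; first exact: cgeoZ.
  rewrite csumZ// mulrC; congr (_ * _).
  by rewrite -csum_exp (csum_shift ge) expr0 fact0 divr1 addrC addKr.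
- apply: aeW => r n; rewrite /= in_itv/= andbT => r0.
  rewrite expr0 fact0 divr1 mulr1.
  apply: (@le_trans _ _ (\sum_(k < n) `|s| * (expR (- b * r) * ((`|s| * r) ^+ k / k`!%:R)))).
    apply: ler_sum => k _; rewrite /a normcM normc_real normcM normcX normcM normc_i mul1r normc_real.
    rewrite normcV normc_nat [`|expR _ * _|]ger0_norm; last first.
      by rewrite mulr_ge0 ?expR_ge0// divr_ge0// exprn_ge0.
    have -> : `|s| ^+ k.+1 / k.+1%:R * (expR (- b * r) * (r ^+ k / k`!%:R)) =
      `|s| * (expR (- b * r) * ((`|s| * r) ^+ k / k`!%:R)) / k.+1%:R.
      by rewrite exprMn exprS; move: (k.+1%:R^-1) (k`!%:R^-1) => c1 c2; ring.
    rewrite ler_pdivrMr ?ltr0n// ler_peMr ?ler1n//.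
    rewrite mulr_ge0// mulr_ge0 ?expR_ge0// divr_ge0// exprn_ge0// mulr_ge0//.
  rewrite -mulr_sumr ler_wpM2l// -mulr_sumr.
  have -> : - (b - `|s|) * r = - b * r + `|s| * r by ring.
  rewrite expRD ler_wpM2l ?expR_ge0//.
  have sr0 : 0 <= `|s| * r by rewrite mulr_ge0.
  have := partial_exp_le (`|s| * r)%:C n.
  rewrite normc_real (ger0_norm sr0); apply: le_trans.
  have -> : \sum_(k < n) (`|s| * r)%:C ^+ k / k`!%:R = (\sum_(k < n) (`|s| * r) ^+ k / k`!%:R)%:C.
    rewrite rmorph_sum; apply: eq_bigr => k _.
    move: (`|s| * r) => x.
    by rewrite -[RHS]/((_ / _)%:C) rmorphM rmorphXn fmorphV/= rmorph_nat.
  by rewrite normc_real ler_norm.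
move=> ia _ _ _ <-.
rewrite csum_log_shift//; congr csum; apply/funext => k.
rewrite /a cintegralZl//; last first.
  by apply: cintegrable_real => //; exact: gamma_integrable.
rewrite cintegral_real /Rintegral gamma_integral//=.
rewrite /log_coeff.
have -> : (s / b)%:C = s%:C / b%:C by rewrite rmorphM fmorphV.
have -> : (b ^- k.+1)%:C = b%:C ^- k.+1 by rewrite fmorphV rmorphXn.
rewrite [X in _ = X ^+ _ / _]mulrA [in RHS]exprMn exprVn.
by move: (k.+1%:R^-1) => c; ring.
Qed.

End frullani.

Section gamma_exponent.
Context {R : realType} {d : nat}.
Variables (N : 'rV[R]_d -> R) (N_norm : is_norm N).
Variable alpha : {finite_measure set (borel R d) -> \bar R}.
Variable beta : 'rV[R]_d -> R.
Hypothesis beta_meas : measurable_fun (unit_sphere N : set (borel R d)) (beta : borel R d -> R).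
Variable kappa : R.
Hypothesis kappa0 : 0 < kappa.
Hypothesis beta_kappa : {ae (alpha : {measure set (borel R d) -> \bar R}), forall v, unit_sphere N v -> kappa <= beta v}.
Implicit Types (v : 'rV[R]_d) (x y z : 'rV[R[i]]_d) (w : R[i]).
Local Notation Re := complex.Re.
Local Notation Im := complex.Im.
Local Notation S := (unit_sphere N).
Local Notation toC := (map_mx (real_complex R)).

Let mS : measurable (S : set (borel R d)) := measurable_unit_sphere N_norm.

Let E z v : R[i] := cLn ((beta v)%:C / ((beta v)%:C - 'i%C * cdot v z)).
Let U z v : R[i] := 'i%C * cdot v z / (beta v)%:C.

Lemma cLn_ratio z v : beta v != 0 -> E z v = cLn (1 - U z v)^-1.
Proof.
move=> b0; rewrite /E /U; congr cLn.
have bC : (beta v)%:C != 0 by rewrite fmorph_eq0.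
have -> : 1 - 'i%C * cdot v z / (beta v)%:C = ((beta v)%:C - 'i%C * cdot v z) / (beta v)%:C.
  by rewrite mulrBl divff.
by rewrite invfM invrK mulrC.
Qed.

(** Coordinates are bounded on the sphere by some C and beta v from below by kappa, whence L = d C /
    kappa. *)
Lemma ratio_bound : exists2 L : R, 0 <= L & forall z (e : R),
  (forall j, normc (z 0 j) <= e) -> forall v, S v -> kappa <= beta v ->
  normc (U z v) <= e * L.
Proof.
have [C C0 SC] := unit_sphere_bounded N_norm.
exists (d%:R * C / kappa); first by rewrite divr_ge0 ?(ltW kappa0)// mulr_ge0// ltW.
move=> z e ze v Sv kb.
have b0 : 0 < beta v by exact: lt_le_trans kb.
rewrite /U !normcM normc_i mul1r normcV normc_real (gtr0_norm b0).
rewrite mulrA ler_pM ?normc_ge0 ?invr_ge0 ?(ltW b0)//; last by rewrite lef_pV2.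
(* For d = 0 the assumption on z is vacuous and e may be negative. *)
have [[j _]|nj] := pselect (exists j : 'I_d, True); last first.
  rewrite /cdot big1 ?normc0; last by move=> j _; exfalso; apply: nj; exists j.
  have -> : d%:R = 0 :> R.
    case: d nj {ze} => // n nj; exfalso; apply: nj; by exists ord0.
  by rewrite mul0r mulr0.
have e0 : 0 <= e by apply: le_trans (ze j); exact: normc_ge0.
apply: le_trans (normc_cdot_le v ze) _; rewrite ler_wpM2l//.
apply: (@le_trans _ _ (\sum_(k < d) C)); first by apply: ler_sum => k _; exact: SC.
by rewrite sumr_const card_ord -[leLHS]mulr_natl.
Qed.

Lemma cmeasurable_beta : cmeasurable (S : set (borel R d)) (fun v : borel R d => (beta v)%:C).
Proof. exact: cmeasurable_real. Qed.

Lemma cmeasurable_icdot z : cmeasurable (S : set (borel R d)) (fun v : borel R d => 'i%C * cdot (v : 'rV[R]_d) z).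
Proof.
apply: (cmeasurableM (f := fun=> 'i%C)); first exact: cmeasurable_cst.
exact: cmeasurable_cdot.
Qed.

Lemma cmeasurable_E z : cmeasurable (S : set (borel R d)) (E z : borel R d -> R[i]).
Proof.
apply: cmeasurable_cLn => //; apply: cmeasurableM; first exact: cmeasurable_beta.
apply: cmeasurableV => //.
apply: (cmeasurableB (f := fun v : borel R d => (beta v)%:C)); first exact: cmeasurable_beta.
exact: cmeasurable_icdot.
Qed.

Lemma cmeasurable_U z : cmeasurable (S : set (borel R d)) (U z : borel R d -> R[i]).
Proof.
apply: cmeasurableM; first exact: cmeasurable_icdot.
by apply: cmeasurableV => //; exact: cmeasurable_beta.
Qed.

Variables (L delta : R).
Hypothesis L0 : 0 <= L.
Hypothesis ratioL : forall z (e : R),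
  (forall j, normc (z 0 j) <= e) -> forall v, S v -> kappa <= beta v ->
  normc (U z v) <= e * L.
Hypothesis delta0 : 0 < delta.
Hypothesis deltaL : delta * (L + 1) <= 8^-1.

(** By 1 - U(x + w y) = (1 - U x) (1 - w V) with V = U y / (1 - U x), the logarithm splits into its
    value at x and a power series in w, both small enough for the main branch to be additive. Since
    |1 - U x| >= 1/2, |V| is at most 2 delta (L + 1); writing L + 1 keeps this ratio positive when L
    = 0. *)
Lemma exponent_line x y : (forall j, normc (x 0 j) <= delta) ->
  (forall j, normc (y 0 j) <= delta) ->
  exists b : nat -> R[i],
  [/\ b 0%N = cintegral alpha S (E x),
     forall k, k.+1%:R * normc (b k.+1) <=
       2 * fine (alpha S) * (2 * (delta * (L + 1))) ^+ k.+1 &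
     forall w, normc w <= 1 ->
       cintegrable alpha S (E (x + w *: y)) /\
       cintegral alpha S (E (x + w *: y)) = csum (fun k => b k * w ^+ k)].
Proof.
move=> xd yd.
pose B := 2 * (delta * (L + 1)).
have dL0 : 0 < delta * (L + 1) by rewrite mulr_gt0// ltr_wpDl.
have B0 : 0 < B by rewrite mulr_gt0.
have B4 : B <= 4^-1 by rewrite /B; have := deltaL; lra.
pose V v : R[i] := U y v / (1 - U x v).
have dL : delta * L <= delta * (L + 1) by rewrite ler_pM2l// lerDl.
have Ux v : S v -> kappa <= beta v -> normc (U x v) <= delta * (L + 1).
  by move=> Sv kb; apply: le_trans dL; exact: ratioL.
have Uy v : S v -> kappa <= beta v -> normc (U y v) <= delta * (L + 1).
  by move=> Sv kb; apply: le_trans dL; exact: ratioL.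
have Ux4 v : S v -> kappa <= beta v -> normc (U x v) <= 4^-1.
  by move=> Sv kb; apply: le_trans (Ux v Sv kb) _; have := deltaL; lra.
have VB v : S v -> kappa <= beta v -> normc (V v) <= B.
  move=> Sv kb; rewrite /V normcM normcV.
  have h : 2^-1 <= normc (1 - U x v).
    have := normcD (1 - U x v) (U x v); rewrite subrK normc1.
    have := Ux v Sv kb; have := deltaL; lra.
  rewrite ler_pdivrMr; last by rewrite (lt_le_trans _ h)// inv2_gt0.
  apply: le_trans (Uy v Sv kb) _; rewrite /B.
  by rewrite mulrAC; apply: ler_peMl; [exact: ltW|lra].
pose a k v : R[i] := if k is k'.+1 then log_coeff (V v) k else E x v.
pose b k := cintegral alpha S (a k).
have mV : cmeasurable (S : set (borel R d)) (V : borel R d -> R[i]).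
  apply: cmeasurableM; first exact: cmeasurable_U.
  apply: cmeasurableV => //; apply: cmeasurableB; first exact: cmeasurable_cst.
  exact: cmeasurable_U.
have ma k : cmeasurable (S : set (borel R d)) (a k : borel R d -> R[i]).
  case: k => [|k]; first exact: cmeasurable_E.
  apply: (cmeasurableM (g := fun=> _)); last exact: cmeasurable_cst.
  exact: cmeasurableX.
have ic (c : R) : alpha.-integrable S (EFin \o (fun=> c)) by exact: finite_measure_integrable_cst.
have wV v w : normc w <= 1 -> S v -> kappa <= beta v -> normc (w * V v) <= 4^-1.
  move=> w1 Sv kb; rewrite normcM; apply: le_trans B4; apply: le_trans (VB v Sv kb).
  by rewrite ler_piMl// normc_ge0.
have E0 v : S v -> kappa <= beta v -> E x v = csum (log_coeff (U x v)).
  move=> Sv kb; rewrite cLn_ratio ?gt_eqF ?(lt_le_trans _ kb)//.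
  by rewrite cLn_log1// Ux4.
have E01 v : S v -> kappa <= beta v -> normc (E x v) <= 1.
  move=> Sv kb; rewrite E0//; have [h1 h2] := Re_Im_log (Ux4 v Sv kb).
  apply: le_trans (normc_le_ReIm _) _; lra.
exists b; split => //.
  move=> k.
  have kp : 0 < k.+1%:R :> R by [].
  have : normc (b k.+1) <= 2 * \int[alpha]_(v in S) (B ^+ k.+1 / k.+1%:R).
    apply: (@normc_cintegral_le _ _ _ alpha S mS (a k.+1) (fun=> B ^+ k.+1 / k.+1%:R)) => //.
    apply: (@aeS _ _ _ alpha _ _ beta_kappa) => v kb Sv; rewrite /a /log_coeff normcM normcV normc_nat normcX.
    rewrite ler_wpM2r ?invr_ge0// lerXn2r ?nnegrE ?normc_ge0 ?(ltW B0)//.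
    by apply: VB => //; exact: kb.
  rewrite Rintegral_cst// => h.
  apply: le_trans (ler_wpM2l (ltW kp) h) _.
  rewrite -/B le_eqVlt; apply/orP; left; apply/eqP.
  by field; rewrite gt_eqF.
move=> w w1.
have [] := @cintegral_csum _ _ _ alpha S mS (fun k v => w ^+ k * a k v) (E (x + w *: y)) (fun=> 3).
- by move=> k; apply: cmeasurableM => //; exact: cmeasurable_cst.
- exact: cmeasurable_E.
- exact: ic.
- apply: (@aeS _ _ _ alpha _ _ beta_kappa) => v kb Sv; have {}kb := kb Sv.
  have bne : beta v != 0 by rewrite gt_eqF ?(lt_le_trans _ kb).
  have wv4 := wV v w w1 Sv kb.
  have ga : cgeo (fun k => w ^+ k * a k v).
    exists 1, 4^-1; split => //; first exact: inv4_lt1.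
    case=> [|k]; first by rewrite !expr0 !mul1r E01.
    rewrite /a /log_coeff mulrA -exprMn; apply: (log_coeff_quarter k.+1 wv4).
  split => //; rewrite (csum_shift ga) expr0 mul1r.
  have -> : (fun k => w ^+ k.+1 * a k.+1 v) = (fun k => log_coeff (w * V v) k.+1).
    by apply/funext => k; rewrite /a /log_coeff mulrA -exprMn.
  rewrite -csum_log_shift// /a E0// -cLn_log ?Ux4// cLn_ratio//; congr cLn.
  rewrite -invfM; congr (_^-1).
  have u1 : 1 - U x v != 0 by apply: normc_quarter_neq1; exact: Ux4.
  have -> : (1 - U x v) * (1 - w * V v) = 1 - U x v - w * (U y v).
    by rewrite /V mulrBr mulr1 mulrCA [(1 - U x v) * _]mulrC divfK.
  by rewrite /U cdotD cdotZ; ring.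
- apply: (@aeS _ _ _ alpha _ _ beta_kappa) => v kb n Sv; have {}kb := kb Sv.
  have wv4 := wV v w w1 Sv kb.
  have le k : normc (w ^+ k * a k v) <= 4^-1 ^+ k.
    case: k => [|k]; first by rewrite !expr0 mul1r E01.
    rewrite /a /log_coeff mulrA -exprMn -[leRHS]mul1r.
    exact: (log_coeff_quarter k.+1 wv4).
  apply: (@le_trans _ _ (\sum_(k < n) 4^-1 ^+ k)); first by apply: ler_sum.
  have := subrX1 (4^-1 : R) n => h.
  have : 0 <= (4^-1 : R) ^+ n by rewrite exprn_ge0.
  lra.
move=> _ iE _ _ cE; split => //; rewrite -cE; congr csum; apply/funext => k.
rewrite cintegralZl//; first by rewrite mulrC.
apply: (cintegrable_le _ (ma k) (ic 1)) => //.
apply: (@aeS _ _ _ alpha _ _ beta_kappa) => v kb Sv; have {}kb := kb Sv.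
case: k => [|k]; first exact: E01.
apply: le_trans (log_coeff_le _ _) _; rewrite exprn_ile1 ?normc_ge0//.
by apply: le_trans (VB v Sv kb) _; apply: le_trans B4 _; exact: (ltW inv4_lt1).
Qed.

End gamma_exponent.

Section pseries_moments.
Context {dd : measure_display} {T : measurableType dd} {R : realType}.
Local Notation Re := complex.Re.

(** A general measure and weight allow two applications: to mu with weight 1, and to alpha times
    Lebesgue measure weighted by the Levy density. *)
Lemma pseries_even_moment (mu : {measure set T -> \bar R}) (W X : T -> R) (g : nat -> R[i]) :
  measurable_fun setT W -> measurable_fun setT X -> (forall x, 0 <= W x) ->
  cgeo g -> g 0%N = 0 ->
  (forall t : R, `|t| <= 1 ->
    mu.-integrable setT (EFin \o (fun x => W x * (1 - cos (t * X x)))) /\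
    \int[mu]_x (W x * (1 - cos (t * X x))) = - Re (csum (fun k => g k * t%:C ^+ k))) ->
  exists K q : R, [/\ 0 <= K, 0 < q, q < 1 & forall n,
    mu.-integrable setT (EFin \o (fun x => W x * (X x ^+ (2 * n.+1) / (2 * n.+1)`!%:R))) /\
    \int[mu]_x (W x * (X x ^+ (2 * n.+1) / (2 * n.+1)`!%:R)) <= K * q ^+ (2 * n.+1)].
Proof.
move=> mW mX W0 gg g0 H; have [K [q [K0 q0 q1 gK]]] := gg.
pose p k := - Re (g k).
pose f (t : R) := \int[mu]_x (W x * (1 - cos (t * X x))).
have pK k : `|p k| <= K * q ^+ k.
  by rewrite normrN; apply: le_trans (Re_le_normc _) (gK k).
have p0 : p 0%N = 0 by rewrite /p g0 oppr0.
have fp (t : R) : `|t| <= 1 -> f t = limn (pseries p t).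
  move=> t1; have [_] := H t t1; rewrite -/(f t) => ->.
  have tc : normc t%:C <= 1 by rewrite normc_real.
  have := geo_cvg (cgeo_Re (cgeo_scale tc gg)).
  rewrite /csum/= => cv; rewrite -limN//; congr (lim (_ @ \oo)).
  apply/funext => n; rewrite /pseries /series/= -[LHS]/(- (\sum_(0 <= k < n) Re (g k * t%:C ^+ k))).
  rewrite -sumrN; apply: eq_bigr => k _.
  by rewrite /p mulNr -rmorphXn/= Re_mul/= mulr0 subr0.
have fN (t : R) : f (- t) = f t.
  by rewrite /f; congr (Rintegral _ _ _); apply/funext => x; rewrite mulNr cosN.
have ap := even_pseries_approx K0 q0 q1 pK p0 fp fN.
have fint (t : R) : 0 < t <= 1 ->
    mu.-integrable setT (EFin \o (fun x => W x * (1 - cos (t * X x)))) /\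
    \int[mu]_x (W x * (1 - cos (t * X x))) = f t.
  by move=> /andP[t0 t1]; split => //; apply: (H t _).1; rewrite ger0_norm// ltW.
exists (K / (1 - q)), q; split => //.
  by rewrite divr_ge0// subr_ge0 ltW.
move=> n; have [h1 _ h3] := even_moment mW mX W0 fint (c := fun k => p (2 * k.+1)%N) ap n.
by split.
Qed.

End pseries_moments.

Section imaginary_axis.
Context {R : realType} {d : nat}.
Local Notation Re := complex.Re.
Implicit Types (mu : probability (borel R d) R) (x y : 'rV[R]_d).
Local Notation toC := (map_mx (real_complex R)).

Lemma cexp_i (s : R) : cexp ('i%C * s%:C) = cos s +i* sin s.
Proof.
apply: eqcP; rewrite /cexp Re_mul Im_mul/=.
all: by rewrite !mul0r !mul1r subrr expR0 mul1r ?addr0 ?add0r.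
Qed.

Lemma toC_delta (a : R) (j : 'I_d) : toC (a *: delta_mx 0 j : 'rV[R]_d) = a%:C *: delta_mx 0 j.
Proof. by apply/rowP => k; rewrite !mxE rmorphM rmorph_nat. Qed.

Lemma ReFL_axis mu (a : R) (j : 'I_d) :
  mu.-integrable setT (EFin \o (fun x : borel R d => 1 - cos (a * (x : 'rV[R]_d) 0 j))) /\
  \int[mu]_x (1 - cos (a * (x : 'rV[R]_d) 0 j)) = 1 - Re (FL mu (toC (a *: delta_mx 0 j : 'rV[R]_d))).
Proof.
have mc : measurable_fun setT (fun x : borel R d => cos (a * (x : 'rV[R]_d) 0 j)).
  apply: (measurableT_comp (f := @cos R)); last first.
    by apply: measurable_funM => //; exact: measurable_coord.
  by apply: continuous_measurable_fun; exact: continuous_cos.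
have ic : mu.-integrable setT (EFin \o (fun x : borel R d => cos (a * (x : 'rV[R]_d) 0 j))).
  apply: (@le_integrable _ _ _ mu setT measurableT _ (EFin \o (fun=> 1 : R))).
  - exact/measurable_EFinP.
  - by move=> x _ /=; rewrite lee_fin normr1 ler_norml cos_geN1 cos_le1.
  - exact: finite_measure_integrable_cst.
have i1 : mu.-integrable setT (EFin \o (fun=> 1 : R)) by exact: finite_measure_integrable_cst.
split; first by have := integrableB measurableT i1 ic.
rewrite RintegralB// Rintegral_cst//= probability_setT mulr1; congr (_ - _).
rewrite /FL/=; congr (Rintegral _ _ _); apply/funext => x.
rewrite -[RHS]/(Re (cexp ('i%C * cdot (x : 'rV[R]_d) (toC (a *: delta_mx 0 j : 'rV[R]_d))))).
by rewrite toC_delta cdot_delta -rmorphM cexp_i.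
Qed.

End imaginary_axis.

Section polydisc.
Context {R : realType} {d : nat}.

Lemma ball0P (r : R) (z : 'rV[R[i]]_d) : 0 < r ->
  ball (0 : 'rV[R[i]]_d) r%:C z <-> forall j, normc (z 0 j) < r.
Proof.
move=> r0; have rC : 0 < r%:C by rewrite ltcR.
have e (u : R[i]) : ball (0 : R[i]) r%:C u <-> normc u < r.
  have -> : ball (0 : R[i]) r%:C u = (`|0 - u| < r%:C) by [].
  rewrite sub0r normrN.
  by rewrite -[`|u|]/((normc u)%:C) ltcR.
split=> [[_ h] j|h]; first by apply/e; have := h 0 j; rewrite mxE.
by split => // i j; rewrite mxE (ord1 i); apply/e.
Qed.

Lemma csum_pseries0 (e : nat -> R[i]) : csum (fun k => e k * 0 ^+ k) = e 0%N.
Proof.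
apply: csum_unique; split.
all: apply: (@cvg_near_cst _ _ _ _ _ _ _); exists 1%N => // -[//|n] _ /=.
all: by rewrite big_ord_recl/= expr0 mulr1 big1 ?addr0// => k _; rewrite exprS mul0r mulr0.
Qed.

Lemma FL0 (mu : probability (borel R d) R) : FL mu 0 = 1.
Proof.
rewrite /FL; have -> : (fun x : borel R d => cexp ('i%C * cdot (x : 'rV[R]_d) 0)) = (fun=> 1%:C).
  apply/funext => x; rewrite /cdot big1; first by rewrite mulr0 cexp0.
  by move=> j _; rewrite mxE mulr0.
rewrite cintegral_real Rintegral_cst//.
rewrite mul1r; congr (_%:C); rewrite -[RHS]/(fine 1%E); congr fine; exact: probability_setT.
Qed.

End polydisc.

(** * Scale bounded below *)

Section bounded_below.
Context {R : realType} {d : nat}.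
Variables (N : 'rV[R]_d -> R) (N_norm : is_norm N).
Variable alpha : {finite_measure set (borel R d) -> \bar R}.
Variable beta : 'rV[R]_d -> R.
Hypothesis beta_meas : measurable_fun (unit_sphere N : set (borel R d)) (beta : borel R d -> R).
Variable mu : probability (borel R d) R.
Hypothesis mu_gamma : is_gamma N alpha beta mu.
Variable kappa : R.
Hypothesis kappa0 : 0 < kappa.
Hypothesis beta_kappa : {ae (alpha : {measure set (borel R d) -> \bar R}), forall v, unit_sphere N v -> kappa <= beta v}.
Implicit Types (v : 'rV[R]_d) (x y z : 'rV[R[i]]_d) (w : R[i]).
Local Notation Re := complex.Re.
Local Notation Im := complex.Im.
Local Notation S := (unit_sphere N).
Local Notation toC := (map_mx (real_complex R)).

Let mS : measurable (S : set (borel R d)) := measurable_unit_sphere N_norm.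

Let E z v : R[i] := cLn ((beta v)%:C / ((beta v)%:C - 'i%C * cdot v z)).

Variables (L delta : R).
Hypothesis L0 : 0 <= L.
Hypothesis ratioL : forall z (e : R),
  (forall j, normc (z 0 j) <= e) -> forall v, S v -> kappa <= beta v ->
  normc ('i%C * cdot v z / (beta v)%:C) <= e * L.
Hypothesis delta0 : 0 < delta.
Hypothesis deltaL : delta * (L + 1) <= 8^-1.
Hypothesis deltaA : 2 * (delta * (L + 1)) * (1 + 2 * fine (alpha S)) < 1.

Let small_U z v : (forall j, normc (z 0 j) <= 2 * delta) -> S v -> kappa <= beta v ->
  normc ('i%C * cdot v z / (beta v)%:C) <= 4^-1.
Proof.
move=> zd Sv kb; apply: le_trans (ratioL zd Sv kb) _.
have : delta * L <= delta * (L + 1) by rewrite ler_pM2l// lerDl.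
by have := deltaL; lra.
Qed.

(** Frullani's integral at a fixed v. The radius 2 delta covers the real points x + t y with |t| <=
    1 and both vectors bounded by delta. *)
Lemma gamma_inner_log (x : 'rV[R]_d) v : (forall j, `|x 0 j| <= 2 * delta) ->
  S v -> kappa <= beta v -> gamma_inner beta x v = E (toC x) v.
Proof.
move=> xd Sv kb; have b0 : 0 < beta v by exact: lt_le_trans kb.
have u4 : normc ('i%C * cdot v (toC x) / (beta v)%:C) <= 4^-1.
  by apply: small_U => // j; rewrite mxE normc_real.
rewrite -[RHS]/(cLn ((beta v)%:C / ((beta v)%:C - 'i%C * cdot v (toC x)))).
rewrite cLn_ratio ?gt_eqF// cLn_log1//.
have e : 'i%C * cdot v (toC x) / (beta v)%:C =
    'i%C * ((\sum_j v 0 j * x 0 j) / beta v)%:C.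
  by rewrite cdot_real rmorphM fmorphV/= mulrA.
rewrite e -cexp_log_integral// -?e// /gamma_inner.
by congr cintegral; apply/funext => r; rewrite /gamma_integrand cdot_real.
Qed.

Lemma FL_real (x : 'rV[R]_d) : (forall j, `|x 0 j| <= 2 * delta) ->
  FL mu (toC x) = cexp (cintegral alpha S (E (toC x))).
Proof.
move=> xd; have [_ H] := mu_gamma; have [_ ig ->] := H x; congr cexp.
apply: (@cintegral_ae_eq _ _ _ alpha S mS).
- exact: cintegrable_cmeasurable ig.
- exact: cmeasurable_E.
- apply: (@aeS _ _ _ alpha _ _ beta_kappa) => v kb Sv; apply: gamma_inner_log => //.
  exact: kb.
Qed.

Lemma exponent_series x y : (forall j, normc (x 0 j) <= delta) ->
  (forall j, normc (y 0 j) <= delta) ->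
  exists2 e : nat -> R[i], cgeo e &
    forall w, normc w <= 1 ->
      cexp (cintegral alpha S (E (x + w *: y))) = csum (fun k => e k * w ^+ k).
Proof.
move=> xd yd.
have [b [_ bB bE]] := exponent_line N_norm beta_meas kappa0 beta_kappa L0 ratioL delta0 deltaL xd yd.
have a0 : 0 <= 2 * fine (alpha S) by rewrite mulr_ge0// fine_ge0.
have B0 : 0 < 2 * (delta * (L + 1)) by rewrite !mulr_gt0// ltr_wpDl.
have [e ge eE] := exp_pseries a0 B0 deltaA bB.
by exists e => // w w1; rewrite (bE w w1).2 eE.
Qed.

(** Along each axis the transform is a power series, and one minus its real part is the integral of
    1 - cos (t delta x_j); the resulting even-moment bounds give an exponential moment of each
    coordinate. *)
Lemma gamma_exp_moment : exists2 eps : R, 0 < eps &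
  mu.-integrable setT (EFin \o (fun x : borel R d => expR (eps * \sum_j `|(x : 'rV[R]_d) 0 j|))).
Proof.
apply: (integrable_expR_sum delta0) => j.
have nd (a : R) : `|a| <= delta -> forall k, normc ((a%:C *: delta_mx 0 j : 'rV[R[i]]_d) 0 k) <= delta.
  move=> ad k; rewrite !mxE normcM normc_real.
  case: (k == j); rewrite ?andbF normc_nat ?mulr1 ?mulr0 ?(ltW delta0)//.
have z0 k : normc ((0 : 'rV[R[i]]_d) 0 k) <= delta by rewrite mxE normc0 ltW.
have yd := nd delta; rewrite ger0_norm ?(ltW delta0)// in yd.
have [e ge eE] := exponent_series z0 (yd (lexx _)).
have eF (t : R) : `|t| <= 1 ->
    FL mu (toC ((t * delta) *: delta_mx 0 j : 'rV[R]_d)) = csum (fun k => e k * t%:C ^+ k).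
  move=> t1; rewrite FL_real.
    have -> : toC ((t * delta) *: delta_mx 0 j : 'rV[R]_d) = 0 + t%:C *: (delta%:C *: delta_mx 0 j).
      by rewrite add0r scalerA -rmorphM toC_delta.
    by apply: eE; rewrite normc_real.
  move=> k; have := nd (t * delta); rewrite -toC_delta.
  have td : `|t * delta| <= delta by rewrite normrM (ger0_norm (ltW delta0)) ler_piMl// ltW.
  by move=> /(_ td k); rewrite !mxE normc_real => /le_trans; apply; have := delta0; lra.
have e0 : e 0%N = 1.
  rewrite -csum_pseries0; have := eF 0; rewrite normr0 => <- //.
  by rewrite mul0r scale0r; have -> : toC (0 : 'rV[R]_d) = 0; [apply/rowP => k; rewrite !mxE|exact: FL0].
(* Dropping the constant term e 0 = 1 makes minus the real part of the sum equal to one minus the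
   real part of the transform. *)
pose g k : R[i] := if k is 0%N then 0 else e k.
have gg : cgeo g.
  by apply: cgeo_leq ge => -[|k] //; rewrite normc0 normc_ge0.
have gE w : normc w <= 1 -> csum (fun k => g k * w ^+ k) = csum (fun k => e k * w ^+ k) - 1.
  move=> w1; rewrite (csum_shift (cgeo_scale w1 gg)) (csum_shift (cgeo_scale w1 ge)).
  by rewrite /= mul0r add0r expr0 mulr1 e0 addrC addKr.
pose X (x : borel R d) : R := delta * (x : 'rV[R]_d) 0 j.
have mX : measurable_fun setT X by apply: measurable_funM => //; exact: measurable_coord.
have [] := @pseries_even_moment _ _ _ mu (fun=> 1) X g _ mX _ gg erefl _ => //.
  move=> t t1; have [h1 h2] := ReFL_axis mu (t * delta) j.
  rewrite gE ?normc_real// -eF//; split.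
    by apply: eq_integrable h1 => // x _ /=; rewrite mul1r /X mulrA.
  rewrite Re_add Re_opp/= opprB -h2; apply: eq_Rintegral => x _.
  by rewrite mul1r /X mulrA.
move=> K [q [K0 q0 q1 H]].
have := @integrable_expR_abs _ _ _ mu X mX K q K0 q0 q1.
move=> h; apply: eq_integrable (h _) => // [x _|n].
  by rewrite /= /X normrM (ger0_norm (ltW delta0)).
have [h1 h2] := H n; split.
  by apply: eq_integrable h1 => // x _ /=; rewrite mul1r.
by apply: le_trans h2; rewrite le_eqVlt; apply/orP; left; apply/eqP; apply: eq_Rintegral => x _; rewrite mul1r.
Qed.

Lemma gamma_FL_formula (eps : R) z : 0 < eps ->
  mu.-integrable setT (EFin \o (fun x : borel R d => expR (eps * \sum_j `|(x : 'rV[R]_d) 0 j|))) ->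
  (forall j, normc (z 0 j) <= delta) -> (forall j, normc (z 0 j) <= eps / 6) ->
  FL mu z = cexp (cintegral alpha S (E z)).
Proof.
move=> eps0 ih zd ze.
have [x [y zE]] : exists x y : 'rV[R]_d, z = toC x + 'i%C *: toC y.
  by exists (map_mx (@complex.Re R) z), (map_mx (@complex.Im R) z); exact: complex_vector.
have xz j : `|x 0 j| <= normc (z 0 j).
  by apply: le_trans (Re_le_normc _); rewrite zE !mxE Re_add Re_mul/= !mul0r mul1r subr0 addr0.
have yz j : `|y 0 j| <= normc (z 0 j).
  by apply: le_trans (Im_le_normc _); rewrite zE !mxE Im_add Im_mul/= !mul0r mul1r !add0r.
have xd j : normc ((toC x) 0 j) <= delta by rewrite mxE normc_real (le_trans (xz j)).
have yd j : normc ((toC y) 0 j) <= delta by rewrite mxE normc_real (le_trans (yz j)).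
have [e ge eE] := exponent_series xd yd.
have xe j : normc ((toC x) 0 j) <= eps / 3.
  by rewrite mxE normc_real (le_trans (xz j))// (le_trans (ze j))//; move: eps0; lra.
(* The bound eps / 6 on z is what [FL_line] requires of the direction for q = 1/2. *)
have ye j : normc ((toC y) 0 j) <= 2^-1 * (eps / 3).
  by rewrite mxE normc_real (le_trans (yz j))// (le_trans (ze j))//; move: eps0; lra.
have h0 : 0 < 2^-1 :> R by [].
have h1 : 2^-1 < 1 :> R by rewrite invf_lt1// ltr1n.
have [a aM aE] := FL_line eps0 ih h0 h1 xe ye.
have ga : cgeo a.
  eexists; eexists; split; last exact: aM; [|exact: h0|exact: h1].
  by have := aM 0%N; rewrite expr0 mulr1; apply: le_trans; exact: normc_ge0.
have i1 : normc ('i%C : R[i]) <= 1 by rewrite normc_i.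
rewrite zE aE// eE//; congr csum; apply/funext => k; congr (_ * _).
apply: csum_pseries_inj k => // t /andP[t0 t1].
have tn : normc t%:C <= 1 by rewrite normc_real ger0_norm// ltW.
rewrite -aE// -eE//.
have -> : toC x + t%:C *: toC y = toC (x + t *: y).
  by apply/rowP => j; rewrite !mxE rmorphD rmorphM.
rewrite FL_real// => j; rewrite !mxE (le_trans (ler_normD _ _))// mulr_natl mulr2n lerD//.
  by rewrite (le_trans (xz j)).
rewrite normrM (ger0_norm (ltW t0)) (le_trans _ (zd j))// (le_trans _ (yz j))//.
by rewrite ler_piMl.
Qed.

End bounded_below.

Section gamma_bounded_below.
Context {R : realType} {d : nat}.
Variables (N : 'rV[R]_d -> R) (N_norm : is_norm N).
Variable alpha : {finite_measure set (borel R d) -> \bar R}.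
Variable beta : 'rV[R]_d -> R.
Hypothesis beta_meas : measurable_fun (unit_sphere N : set (borel R d)) (beta : borel R d -> R).
Variable mu : probability (borel R d) R.
Hypothesis mu_gamma : is_gamma N alpha beta mu.
Local Notation S := (unit_sphere N).

Lemma gamma_bounded_below (kappa : R) : 0 < kappa ->
  {ae (alpha : {measure set (borel R d) -> \bar R}), forall v, S v -> kappa <= beta v} ->
  exists U : set 'rV[R[i]]_d,
      [/\ open U, U 0,
          (forall z, U z -> FL_exists mu z),
          (forall z, U z -> analytic_at (FL mu) z) &
          forall z, U z ->
            [/\ {ae (alpha : {measure set (borel R d) -> \bar R}), forall v, S v ->
                   (beta v)%:C - 'i%C * cdot v z != 0},
                cintegrable alpha S
                  (fun v => cLn ((beta v)%:C / ((beta v)%:C - 'i%C * cdot v z))) &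
                FL mu z = cexp (cintegral alpha S
                  (fun v => cLn ((beta v)%:C / ((beta v)%:C - 'i%C * cdot v z))))]].
Proof.
move=> kappa0 beta_kappa.
have [L L0 ratioL] := ratio_bound N_norm beta kappa0.
pose A := 2 * fine (alpha S).
have A0 : 0 <= A by rewrite mulr_ge0// fine_ge0.
(* Makes delta (L + 1) (1 + A) equal to 1/8: the ratios i v.z / beta v stay within reach of the
   logarithm series, and the ratio in [exp_pseries] becomes 1/4. *)
pose delta := (8 * (L + 1) * (1 + A))^-1.
have L1 : 0 < L + 1 by rewrite ltr_wpDl.
have A1 : 0 < 1 + A by rewrite ltr_wpDr.
have delta0 : 0 < delta by rewrite invr_gt0 !mulr_gt0.
have dLA : delta * (L + 1) * (1 + A) = 8^-1.
  by rewrite /delta; field; rewrite !gt_eqF.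
have deltaL : delta * (L + 1) <= 8^-1.
  by rewrite -dLA ler_peMr ?lerDl// ltW// mulr_gt0.
have deltaA : 2 * (delta * (L + 1)) * (1 + A) < 1.
  by rewrite -mulrA dLA; lra.
have [eps eps0 ih] := gamma_exp_moment N_norm beta_meas mu_gamma kappa0 beta_kappa L0 ratioL delta0 deltaL deltaA.
pose r := Num.min delta (eps / 6).
have r0 : 0 < r by rewrite lt_min delta0 divr_gt0.
have small z : ball (0 : 'rV[R[i]]_d) r%:C z -> forall j, normc (z 0 j) <= delta /\ normc (z 0 j) <= eps / 6.
  by move=> /(ball0P _ r0) zr j; have := ltW (zr j); rewrite le_min => /andP[].
exists (ball 0 r%:C); split.
- exact: ball_open.
- by apply: ballxx; rewrite ltcR.
- move=> z /small zr; apply: (FL_exists_small ih) => j.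
  by have [_] := zr j; move: eps0; lra.
- move=> z /small zr; apply: (FL_analytic eps0 ih) => j.
  by have [_] := zr j; move: eps0; lra.
move=> z /small zr; split.
- apply: (@aeS _ _ _ alpha _ _ beta_kappa) => v kb Sv; have {}kb := kb Sv.
  have bC : (beta v)%:C != 0 by rewrite fmorph_eq0 gt_eqF// (lt_le_trans _ kb).
  have : normc ('i%C * cdot v z / (beta v)%:C) <= 4^-1.
    apply: le_trans (ratioL z delta _ v Sv kb) _; first by move=> j; have [] := zr j.
    have : delta * L <= delta * (L + 1) by rewrite ler_pM2l// lerDl.
    by move: deltaL; lra.
  (* A zero of beta v - i v.z would make the ratio equal to 1, but its modulus is at most 1/4. *)
  move=> /normc_quarter_neq1; apply: contraNN => /eqP/subr0_eq <-.
  by rewrite divff// subrr.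
- have z0 j : normc ((0 : 'rV[R[i]]_d) 0 j) <= delta by rewrite mxE normc0 ltW.
  have zd j : normc (z 0 j) <= delta by have [] := zr j.
  have [b [_ _ bE]] := exponent_line N_norm beta_meas kappa0 beta_kappa L0 ratioL delta0 deltaL z0 zd.
  have [] := bE 1 _; first by rewrite normc1.
  by rewrite add0r scale1r.
- apply: (gamma_FL_formula N_norm beta_meas mu_gamma kappa0 beta_kappa L0 ratioL delta0 deltaL deltaA eps0 ih).
    by move=> j; have [] := zr j.
  by move=> j; have [] := zr j.
Qed.

End gamma_bounded_below.

(** * Consequences of a transform existing near zero *)

Section transform_near_zero.
Context {R : realType} {d : nat}.
Variable mu : probability (borel R d) R.
Local Notation Re := complex.Re.
Local Notation toC := (map_mx (real_complex R)).

(** At z = - i s times the j-th unit vector the integrand is exp (s x_j); the values s = e and s = -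
    e together dominate exp (e |x_j|). *)
Lemma FL_exists_moment (r : R) : 0 < r ->
  (forall z : 'rV[R[i]]_d, (forall j, normc (z 0 j) < r) -> FL_exists mu z) ->
  exists2 eps : R, 0 < eps &
    mu.-integrable setT (EFin \o (fun x : borel R d => expR (eps * \sum_j `|(x : 'rV[R]_d) 0 j|))).
Proof.
move=> r0 H; pose e := r / 2.
have e0 : 0 < e by rewrite divr_gt0.
have er : e < r by rewrite ltr_pdivrMr// mulr_natr mulr2n ltrDl.
apply: (integrable_expR_sum e0) => j.
have ie (s : R) : `|s| <= e -> mu.-integrable setT (EFin \o (fun x : borel R d => expR (s * (x : 'rV[R]_d) 0 j))).
  move=> se; have zr : forall k, normc (((- 'i%C * s%:C) *: delta_mx 0 j : 'rV[R[i]]_d) 0 k) < r.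
    move=> k; rewrite !mxE !normcM normcN normc_i normc_real normc_nat mul1r.
    by case: (_ && _); rewrite ?mulr1 ?mulr0// (le_lt_trans se).
  have [h _] := cintegrable_ReIm measurableT (H _ zr).
  apply: eq_integrable h => // x _; rewrite -[LHS]/((Re (cexp ('i%C * cdot (x : 'rV[R]_d) ((- 'i%C * s%:C) *: delta_mx 0 j))))%:E) cdot_delta !mulrA.
  have -> : 'i%C * - 'i%C = 1 :> R[i] by apply: eqcP; rewrite ?Re_mul ?Im_mul/=; ring.
  by rewrite mul1r -rmorphM cexp_real.
have i1 := ie e; rewrite ger0_norm ?(ltW e0)// in i1; have {}i1 := i1 (lexx _).
have i2 := ie (- e); rewrite normrN ger0_norm ?(ltW e0)// in i2; have {}i2 := i2 (lexx _).
apply: (le_integrable measurableT _ _ (integrableD measurableT i1 i2)).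
  apply/measurable_EFinP; apply: measurableT_comp => //; apply: measurable_funM => //.
  by apply: measurableT_comp => //; exact: measurable_coord.
move=> x _ /=; rewrite lee_fin (ger0_norm (expR_ge0 _)) (ger0_norm (addr_ge0 (expR_ge0 _) (expR_ge0 _))).
by case: (ler0P ((x : 'rV[R]_d) 0 j)) => h; rewrite ?mulrN ?mulNr ?lerDl ?lerDr expR_ge0.
Qed.

(** The constant M of [FL_line] does not depend on the ratio there, so the ratio Q can be chosen
    afterwards with Q (2 + M) = 1/2 to meet the condition of [log_pseries]. The resulting delta
    serves all axes. *)
Lemma FL_log_axis (eps : R) : 0 < eps ->
  mu.-integrable setT (EFin \o (fun x : borel R d => expR (eps * \sum_j `|(x : 'rV[R]_d) 0 j|))) ->
  exists2 delta : R, 0 < delta & forall j : 'I_d, exists b : nat -> R[i],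
    [/\ b 0%N = 0, cgeo b & forall t : R, `|t| <= 1 ->
      FL mu (toC ((t * delta) *: delta_mx 0 j : 'rV[R]_d)) = cexp (csum (fun k => b k * t%:C ^+ k))].
Proof.
move=> eps0 ih; pose M := 2 * \int[mu]_x (fun x : borel R d => expR (eps * \sum_j `|(x : 'rV[R]_d) 0 j|)) x.
have M0 : 0 <= M by rewrite mulr_ge0// Rintegral_ge0// => x _; exact: expR_ge0.
have M2 : 0 < 2 + M by rewrite ltr_wpDr.
pose Q := (2 * (2 + M))^-1.
have Q0 : 0 < Q by rewrite invr_gt0 mulr_gt0.
have QM : Q * (2 + M) < 1.
  have -> : Q * (2 + M) = 2^-1 by rewrite /Q; field; rewrite gt_eqF.
  by lra.
have Q1 : Q < 1 by apply: le_lt_trans QM; rewrite ler_peMr// ?(ltW Q0)//; move: M0; lra.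
exists (Q * (eps / 3)); first by rewrite mulr_gt0// divr_gt0.
move=> j; pose y : 'rV[R[i]]_d := (Q * (eps / 3))%:C *: delta_mx 0 j.
have z0 k : normc ((0 : 'rV[R[i]]_d) 0 k) <= eps / 3 by rewrite mxE normc0 divr_ge0// ltW.
have q0 : 0 <= Q * (eps / 3) by rewrite mulr_ge0 ?(ltW Q0)// divr_ge0// ltW.
have yd k : normc (y 0 k) <= Q * (eps / 3).
  rewrite !mxE normcM normc_real normc_nat (ger0_norm q0).
  by case: (_ && _); rewrite ?mulr1 ?mulr0.
have [a aM aE] := FL_line eps0 ih Q0 Q1 z0 yd.
have a0 : a 0%N = 1.
  rewrite -csum_pseries0 -(FL0 mu) -aE ?normc0//.
  by rewrite scale0r addr0.
have [b [b0 gb bE]] := log_pseries M0 Q0 QM a0 aM.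
exists b; split => // t t1; have tn : normc t%:C <= 1 by rewrite normc_real.
rewrite -bE// -aE//; congr (FL mu _).
by rewrite add0r toC_delta /y scalerA -rmorphM.
Qed.

End transform_near_zero.

Lemma measurable_point (R : realType) (d : nat) (v : 'rV[R]_d) :
  measurable ([set v] : set (borel R d)).
Proof.
apply: measurable_closed; apply: accessible_closed_set1.
by apply: hausdorff_accessible; exact: norm_hausdorff.
Qed.

(** * Atoms with vanishing scale *)

Section levy_measure.
Context {R : realType} {d : nat}.
Variables (N : 'rV[R]_d -> R) (N_norm : is_norm N).
Variable alpha : {finite_measure set (borel R d) -> \bar R}.
Variable beta : 'rV[R]_d -> R.
Hypothesis beta_meas : measurable_fun (unit_sphere N : set (borel R d)) (beta : borel R d -> R).
Hypothesis beta_ge0 : forall v, unit_sphere N v -> 0 <= beta v.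
Variable mu : probability (borel R d) R.
Hypothesis mu_gamma : is_gamma N alpha beta mu.
Local Notation Re := complex.Re.
Local Notation S := (unit_sphere N).
Local Notation toC := (map_mx (real_complex R)).
Notation leb := (@lebesgue_measure R).

Let mS : measurable (S : set (borel R d)) := measurable_unit_sphere N_norm.

Local Notation levy := (product_measure1 alpha leb).

Let Rp : set R := `[0%R, +oo[.

(** Extended by 0 off the sphere, so that the density below is measurable on the whole product. *)
Let b0 : borel R d -> R := patch (fun=> 0) S beta.

(** The density of the Levy measure in polar coordinates (v, r), with respect to alpha times
    Lebesgue measure. *)
Let W (p : borel R d * measurableTypeR R) : R :=
  (\1_(S : set (borel R d)) p.1 : R) * (\1_Rp p.2 : R) * (expR (- b0 p.1 * p.2) / p.2).

Let mW : measurable_fun setT W.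
Proof.
have m1 : measurable_fun setT (fst : borel R d * measurableTypeR R -> _) by exact: measurable_fst.
have m2 : measurable_fun setT (snd : borel R d * measurableTypeR R -> _) by exact: measurable_snd.
have mb : measurable_fun setT (fun p : borel R d * measurableTypeR R => b0 p.1).
  have mbS : measurable_fun setT b0 by exact: (measurable_restrictT _ mS).1 beta_meas.
  exact: (measurableT_comp mbS m1).
apply: measurable_funM.
  apply: measurable_funM; first exact: measurableT_comp (measurable_indic mS) m1.
  by apply: measurableT_comp m2; apply: measurable_indic; exact: measurable_itv.
apply: measurable_funM; last exact: measurable_inv.
apply: measurableT_comp => //; apply: measurable_funM => //.
exact: measurableT_comp.
Qed.

Let W0 p : 0 <= W p.
Proof.
rewrite /W !indicE; case: (boolP (p.2 \in Rp)) => [|_]; last by rewrite mulr0 mul0r.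
move=> pR; have p0 : 0 <= (p.2 : R) by move: pR; rewrite inE /Rp/= in_itv/= andbT.
by rewrite mulr_ge0// divr_ge0// expR_ge0.
Qed.

Let WE v r : S v -> 0 <= r -> W (v, r) = expR (- beta v * r) / r.
Proof.
move=> Sv r0; rewrite /W/= !indicE /b0 patchE !mem_set// ?mul1r//.
by rewrite /Rp/= in_itv/= r0.
Qed.

Variables (delta : R) (j : 'I_d).

(** In polar coordinates, delta times the j-th coordinate of the point r v. *)
Let X (p : borel R d * measurableTypeR R) : R := p.2 * (delta * (p.1 : 'rV[R]_d) 0 j).

Let mX : measurable_fun setT X.
Proof.
apply: measurable_funM; first exact: measurable_snd.
apply: measurable_funM => //.
by apply: (measurableT_comp (measurable_coord j)); exact: measurable_fst.
Qed.

Lemma levy_tonelli (h : borel R d * measurableTypeR R -> R) :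
  measurable_fun setT h -> (forall p, 0 <= h p) ->
  (\int[levy]_p (W p * h p)%:E =
   \int[alpha]_v \int[leb]_r (W (v, r) * h (v, r))%:E)%E /\
  measurable_fun setT (fun v : borel R d => \int[leb]_r (W (v, r) * h (v, r))%:E)%E.
Proof.
move=> mh h0.
have mf : measurable_fun setT (fun p : borel R d * measurableTypeR R => (W p * h p)%:E).
  by apply/measurable_EFinP; exact: measurable_funM.
have f0 p : (0 <= (W p * h p)%:E)%E by rewrite lee_fin mulr_ge0.
split; first exact: (@fubini_tonelli1 _ _ _ _ _ alpha leb _ mf f0).
exact: (@measurable_fun_fubini_tonelli_F _ _ _ _ _ leb _ mf f0).
Qed.

Lemma levy_inner (h : R -> R) v : S v ->
  (\int[leb]_r (W (v, r) * h r)%:E =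
   \int[leb]_(r in Rp) (expR (- beta v * r) / r * h r)%:E)%E.
Proof.
move=> Sv; rewrite [RHS]integral_mkcond; apply: eq_integral => r _.
rewrite patchE; case: ifPn => [|rR].
  by rewrite inE /Rp/= in_itv/= andbT => r0; rewrite WE.
by rewrite /W/= [\1_Rp r]indicE (negbTE rR) mulr0 !mul0r.
Qed.

Lemma levy_outer (h : R -> R) v : ~ S v -> (\int[leb]_r (W (v, r) * h r)%:E = 0)%E.
Proof.
move=> Sv; apply: integral0_eq => r _.
by rewrite /W/= indicE memNset// !mul0r.
Qed.

(** The integrand is nonnegative, so Tonelli's theorem reduces it to the iterated integral in the
    exponent, and integrability follows because that value is finite. The inner identity holds for
    almost every v only, and off the sphere both sides vanish. *)
Lemma levy_cos (t : R) :
  levy.-integrable setT (EFin \o (fun p => W p * (1 - cos (t * X p)))) /\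
  \int[levy]_p (W p * (1 - cos (t * X p))) =
    - Re (cintegral alpha S (gamma_inner beta ((t * delta) *: delta_mx 0 j))).
Proof.
pose z : 'rV[R]_d := (t * delta) *: delta_mx 0 j.
have mc : measurable_fun setT (fun p => 1 - cos (t * X p)).
  apply: measurable_funB => //.
  apply: (measurableT_comp (f := @cos R)); last exact: measurable_funM.
  by apply: continuous_measurable_fun; exact: continuous_cos.
have c0 p : 0 <= 1 - cos (t * X p) by rewrite subr_ge0 cos_le1.
have [T1 T2] := levy_tonelli mc c0.
have [_ H] := mu_gamma; have [ag ig _] := H z.
have mD : measurable (Rp : set R) by exact: measurable_itv.
have [i1 _] := cintegrable_ReIm mS ig.
have inner v : S v -> cintegrable leb Rp (gamma_integrand beta z v) ->
    (\int[leb]_r (W (v, r) * (1 - cos (t * X (v, r))))%:E = (- 1 * Re (gamma_inner beta z v))%:E)%E.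
  move=> Sv iv; rewrite (levy_inner (fun r => 1 - cos (t * X (v, r)))) //.
  have [k1 _] := @cintegrable_ReIm _ _ _ leb Rp mD _ iv.
  have k2 := @integrable_scale _ _ _ leb _ mD (-1) _ k1.
  rewrite -[Re (gamma_inner _ _ _)]/(\int[leb]_(r in Rp) Re (gamma_integrand beta z v r)).
  rewrite -RintegralZl// /Rintegral fineK ?(integrable_fin_num _ k2)//.
  apply: eq_integral => r _; congr EFin.
  rewrite /gamma_integrand toC_delta cdot_delta -!mulrA -!rmorphM cexp_i Re_mul/= mulr0 subr0.
  have -> : t * X (v, r) = r * (t * delta * v 0 j) by rewrite /X/=; ring.
  by ring.
have eqF : (\int[alpha]_v \int[leb]_r (W (v, r) * (1 - cos (t * X (v, r))))%:E =
    (- Re (cintegral alpha S (gamma_inner beta z)))%:E)%E.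
  have j1 := @integrable_scale _ _ _ alpha _ mS (-1) _ i1.
  have -> : (- Re (cintegral alpha S (gamma_inner beta z)))%:E =
      (\int[alpha]_(v in S) (- 1 * Re (gamma_inner beta z v))%:E)%E.
    have -> : - Re (cintegral alpha S (gamma_inner beta z)) =
        \int[alpha]_(v in S) (- 1 * Re (gamma_inner beta z v)).
      by rewrite -[LHS]mulN1r; apply: esym; exact: (@RintegralZl _ _ _ alpha _ _ (-1) mS i1).
    by rewrite /Rintegral fineK//; exact: integrable_fin_num j1.
  rewrite [RHS]integral_mkcond; apply: ae_eq_integral => //.
    apply: (measurable_restrictT _ mS).1; exact: measurable_int j1.
  apply: (@aeS _ _ _ alpha _ _ ag) => v cv _; rewrite patchE.
  case: ifPn => [|/negP vS]; first by rewrite inE => Sv; apply: inner => //; exact: cv.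
  apply: levy_outer => Sv; apply: vS; by rewrite inE.
have mW1 : measurable_fun setT (EFin \o (fun p => W p * (1 - cos (t * X p)))).
  by apply/measurable_EFinP; exact: measurable_funM.
split; last by rewrite /Rintegral T1 eqF.
apply/integrableP; split => //.
rewrite (eq_integral (fun p => (W p * (1 - cos (t * X p)))%:E)); last first.
  by move=> p _; rewrite gee0_abs//= lee_fin mulr_ge0.
by rewrite T1 eqF ltry.
Qed.

(** Only the atom is kept in the outer integral. The rate beta v is enlarged to b because beta v may
    be 0, where the Gamma integral would be infinite; a larger rate only decreases the integrand. *)
Lemma atom_moment n v (b C : R) : S v -> beta v < b ->
  levy.-integrable setT
    (EFin \o (fun p => W p * (X p ^+ (2 * n.+1) / (2 * n.+1)`!%:R))) ->
  \int[levy]_p (W p * (X p ^+ (2 * n.+1) / (2 * n.+1)`!%:R)) <= C ->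
  fine (alpha [set v]) * ((delta * v 0 j / b) ^+ (2 * n.+1) / (2 * n.+1)%:R) <= C.
Proof.
move=> Sv bb iG GC; have b0' : 0 < b by exact: le_lt_trans (beta_ge0 Sv) bb.
have mD : measurable (Rp : set R) by exact: measurable_itv.
pose h p := X p ^+ (2 * n.+1) / (2 * n.+1)`!%:R.
have mh : measurable_fun setT h by apply: measurable_funM => //; exact: measurable_funX.
have h0 p : 0 <= h p by rewrite divr_ge0// exprM exprn_ge0// sqr_ge0.
have [T1 T2] := levy_tonelli mh h0.
have mv := measurable_point v.
pose s := delta * v 0 j.
(* The divisor 2n+2 is (2n+2)! / (2n+1)!: the factor 1/r of the density lowers the power of r by
   one. *)
pose c := s ^+ (2 * n.+1) / (2 * n.+1)%:R.
have c0 : 0 <= c by rewrite divr_ge0// exprM exprn_ge0// sqr_ge0.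
have E2 : (2 * n.+1)%N = (2 * n).+2 by rewrite mulnS.
have lower : ((c * (b ^+ (2 * n.+1))^-1)%:E <= \int[leb]_r (W (v, r) * h (v, r))%:E)%E.
  rewrite (levy_inner (fun r => h (v, r)))//.
  have ig := @integrable_scale _ _ _ leb _ mD c _ (gamma_integrable (2 * n).+1 b0').
  have -> : (c * (b ^+ (2 * n.+1))^-1)%:E =
     (\int[leb]_(r in Rp) (c * (expR (- b * r) * (r ^+ (2 * n).+1 / (2 * n).+1`!%:R)))%:E)%E.
    under eq_integral => r _ do rewrite EFinM.
    rewrite ge0_integralZl_EFin//.
    - by rewrite gamma_integral// E2 EFinM.
    - move=> r; rewrite /Rp/= in_itv/= andbT => r0.
      by rewrite lee_fin mulr_ge0 ?expR_ge0// divr_ge0// exprn_ge0.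
    - exact: measurable_int (gamma_integrable (2 * n).+1 b0').
  apply: ge0_le_integral => //.
  - move=> r; rewrite /Rp/= in_itv/= andbT => r0.
    by rewrite lee_fin mulr_ge0// mulr_ge0 ?expR_ge0// divr_ge0// exprn_ge0.
  - exact: measurable_int ig.
  - apply/measurable_EFinP; apply: measurable_funTS; apply: measurable_funM.
      apply: measurable_funM; last exact: measurable_inv.
      by apply: measurableT_comp => //; exact: measurable_funM.
    apply: measurable_funM => //; apply: measurable_funX.
    by rewrite /X/=; exact: measurable_funM.
  move=> r; rewrite /Rp/= in_itv/= andbT => r0; rewrite lee_fin.
  have [->|rne] := eqVneq r 0.
    have z0 : (0 : R) ^+ (2 * n).+1 = 0 by rewrite exprS mul0r.
    by rewrite z0 mul0r !mulr0 invr0 mulr0 mul0r.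
  have -> : expR (- beta v * r) / r * h (v, r) =
      c * (expR (- beta v * r) * (r ^+ (2 * n).+1 / (2 * n).+1`!%:R)).
    rewrite /h /c /X/= -/s E2 factS natrM !exprMn [r ^+ (2 * n).+2]exprS.
    have k1 : (2 * n).+2%:R != 0 :> R by rewrite pnatr_eq0.
    have k2 : (2 * n).+1`!%:R != 0 :> R by rewrite pnatr_eq0 -lt0n fact_gt0.
    move: ((2 * n).+2%:R) ((2 * n).+1`!%:R) (r ^+ (2 * n).+1) (s ^+ (2 * n).+2) k1 k2 => c1 c2 c3 c4 k1 k2.
    by field; rewrite k1 k2 rne.
  rewrite ler_wpM2l// ler_wpM2r ?divr_ge0 ?exprn_ge0// ler_expR.
  by rewrite !mulNr lerN2 ler_wpM2r// ltW.
have fa : alpha [set v] \is a fin_num by exact: fin_num_measure.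
rewrite -/s exprMn exprVn.
have -> : s ^+ (2 * n.+1) / b ^+ (2 * n.+1) / (2 * n.+1)%:R = c * (b ^+ (2 * n.+1))^-1.
  by rewrite /c mulrAC.
apply: le_trans GC; rewrite mulrC -lee_fin EFinM fineK//.
rewrite /Rintegral fineK ?(integrable_fin_num _ iG)//; rewrite -[leRHS]/(\int[levy]_p (W p * h p)%:E)%E T1.
apply: (@le_trans _ _ (\int[alpha]_(u in [set v]) \int[leb]_r (W (u, r) * h (u, r))%:E)%E).
  rewrite (eq_integral (fun=> \int[leb]_r (W (v, r) * h (v, r))%:E)%E); last first.
    by move=> u; rewrite inE/= => ->.
  by rewrite integral_cst// lee_wpmul2r.
apply: ge0_subset_integral => //.
by move=> u _; apply: integral_ge0 => r _; rewrite lee_fin mulr_ge0.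
Qed.

(** If delta |v_j| exceeded beta v + e, the atom alone would contribute at least alpha {v} / (2n+2)
    to the normalised moment of order 2n+2, more than the bound K q^(2n+2) allows for large n. *)
Lemma atom_bound (b_ : nat -> R[i]) v : 0 < delta ->
  b_ 0%N = 0 -> cgeo b_ -> (forall t : R, `|t| <= 1 ->
    FL mu (toC ((t * delta) *: delta_mx 0 j : 'rV[R]_d)) = cexp (csum (fun k => b_ k * t%:C ^+ k))) ->
  S v -> (0 < alpha [set v])%E -> delta * `|v 0 j| <= beta v.
Proof.
move=> delta0 bz gb bE Sv av.
have [] := @pseries_even_moment _ _ _ levy W X b_ mW mX W0 gb bz.
  move=> t t1; have [h1 h2] := levy_cos t; split => //; rewrite h2; congr (- _).
  have [_ H] := mu_gamma; have [_ _ HE] := H ((t * delta) *: delta_mx 0 j : 'rV[R]_d).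
  have E : cexp (cintegral alpha S (gamma_inner beta ((t * delta) *: delta_mx 0 j))) =
      cexp (csum (fun k => b_ k * t%:C ^+ k)) by rewrite -HE bE.
  (* The moduli determine the real parts of the exponents; their imaginary parts may differ by a
     multiple of 2 pi. *)
  have := congr1 (fun u => normc u) E; rewrite !normc_cexp.
  exact: expR_inj.
move=> K [q [K0 q0 q1 KE]]; apply/ler_addgt0Pr => e e0.
pose b := beta v + e; have bb : beta v < b by rewrite /b ltrDl.
have b00 : 0 < b by exact: le_lt_trans (beta_ge0 Sv) bb.
rewrite leNgt; apply/negP => bs.
have a0 : 0 < fine (alpha [set v]) by rewrite fine_gt0// av/= ltey_eq fin_num_measure//; exact: measurable_point.
move: (fine _) a0 (fun n C => @atom_moment n v b C Sv bb) => a a0 AM.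
(* One factor 2n+2 would suffice; the square matches [geo_sqr_cvg0]. *)
have big n : a <= K * ((2 * n.+1)%:R * (2 * n.+1)%:R * q ^+ (2 * n.+1)).
  have [i1 i2] := KE n; have := AM _ _ i1 i2.
  have p1 : 1 <= (delta * v 0 j / b) ^+ (2 * n.+1).
    rewrite exprM -real_normK ?num_real// -exprM exprn_ege1//.
    by rewrite !normrM normfV (gtr0_norm b00) (gtr0_norm delta0) ler_pdivlMr// mul1r ltW.
  have k0 : 0 < (2 * n.+1)%:R :> R by rewrite ltr0n.
  have k1 : 1 <= (2 * n.+1)%:R :> R by rewrite ler1n.
  move=> le1.
  have le2 : a / (2 * n.+1)%:R <= K * q ^+ (2 * n.+1).
    by apply: le_trans le1; rewrite mulrA ler_wpM2r ?invr_ge0 ?(ltW k0)// ler_peMr// ltW.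
  move: le2; rewrite ler_pdivrMr// => /le_trans; apply.
  rewrite -[leLHS]mulrA ler_wpM2l// [leLHS]mulrC -[leRHS]mulrA ler_peMl//.
  by rewrite mulr_ge0 ?(ltW k0)// exprn_ge0// ltW.
have cv : K * ((2 * n.+1)%:R * (2 * n.+1)%:R * q ^+ (2 * n.+1)) @[n --> \oo] --> (0 : R).
  have -> : 0 = K * 0 :> R by rewrite mulr0.
  apply: cvgM; first exact: cvg_cst.
  apply: (@cvg_comp _ _ _ (fun n : nat => (2 * n.+1)%N) _ _ \oo) (geo_sqr_cvg0 q0 q1).
  by apply/cvgnyPge => A; exists A => // n/= An; rewrite (leq_trans An)// (leq_trans (leqnSn n))// leq_pmull.
have h : a <= limn (fun n : nat => K * ((2 * n.+1)%:R * (2 * n.+1)%:R * q ^+ (2 * n.+1))).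
  by apply: limr_ge; [exact: cvgP cv|exact: nearW].
by move: h; rewrite (cvg_lim _ cv)// leNgt a0.
Qed.

End levy_measure.

Lemma gamma_unbounded (R : realType) (d : nat)
    (N : 'rV[R]_d -> R) (N_norm : is_norm N)
    (alpha : {finite_measure set (borel R d) -> \bar R})
    (beta : 'rV[R]_d -> R)
    (beta_meas : measurable_fun (unit_sphere N : set (borel R d)) (beta : borel R d -> R))
    (beta_ge0 : forall v, unit_sphere N v -> 0 <= beta v)
    (mu : probability (borel R d) R)
    (mu_gamma : is_gamma N alpha beta mu) (v_ : nat -> 'rV[R]_d) (r : R) :
  (forall n, unit_sphere N (v_ n)) -> beta (v_ n) @[n --> \oo] --> (0 : R) ->
  (forall n, (0 < alpha [set v_ n])%E) -> 0 < r ->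
  ~ (forall z : 'rV[R[i]]_d, (forall j, normc (z 0 j) < r) -> FL_exists mu z).
Proof.
move=> Sv bv av r0 H.
have [eps eps0 ih] := FL_exists_moment r0 H.
have [delta delta0 L] := FL_log_axis eps0 ih.
(* With e_j the unit vectors, 1 = N v is at most the sum of |v_j| N(e_j), and each |v_j| is at most
   beta v / delta at an atom v. *)
pose C := \sum_j N (delta_mx 0 j : 'rV[R]_d) / delta.
have bound n : 1 <= beta (v_ n) * C.
  rewrite -[leLHS](Sv n); apply: le_trans (norm_sum_le N_norm _) _.
  rewrite mulr_sumr; apply: ler_sum => j _.
  rewrite mulrC mulrCA ler_wpM2l ?(norm_ge0 N_norm)// ler_pdivlMr// mulrC.
  have [b [bz gb bE]] := L j.
  exact: (atom_bound N_norm beta_meas beta_ge0 mu_gamma delta0 bz gb bE (Sv n) (av n)).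
have cv : beta (v_ n) * C @[n --> \oo] --> (0 : R).
  have -> : 0 = 0 * C :> R by rewrite mul0r.
  by apply: cvgMl.
have h : 1 <= limn (fun n => beta (v_ n) * C).
  by apply: limr_ge; [exact: cvgP cv|exact: nearW].
by move: h; rewrite (cvg_lim _ cv)// leNgt ltr01.
Qed.

Theorem theorem3p11 (R : realType) (d : nat)
    (N : 'rV[R]_d -> R) (N_norm : is_norm N)
    (alpha : {finite_measure set (borel R d) -> \bar R})
    (alpha_sphere : alpha (~` unit_sphere N) = 0%E)
    (beta : 'rV[R]_d -> R)
    (beta_meas : measurable_fun (unit_sphere N : set (borel R d))
                   (beta : borel R d -> R))
    (beta_ge0 : forall v, unit_sphere N v -> 0 <= beta v)
    (mu : probability (borel R d) R)
    (mu_gamma : is_gamma N alpha beta mu) :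
  ((exists2 kappa : R, 0 < kappa &
      {ae alpha, forall v, unit_sphere N v -> kappa <= beta v}) ->
    exists U : set 'rV[R[i]]_d,
      [/\ open U, U 0,
          (forall z, U z -> FL_exists mu z),
          (forall z, U z -> analytic_at (FL mu) z) &
          forall z, U z ->
            [/\ {ae alpha, forall v, unit_sphere N v ->
                   (beta v)%:C - 'i%C * cdot v z != 0},
                cintegrable alpha (unit_sphere N)
                  (fun v => cLn ((beta v)%:C / ((beta v)%:C - 'i%C * cdot v z))) &
                FL mu z = cexp (cintegral alpha (unit_sphere N)
                  (fun v => cLn ((beta v)%:C / ((beta v)%:C - 'i%C * cdot v z))))]])
  /\
  ((exists v_ : nat -> 'rV[R]_d,
      [/\ forall n, unit_sphere N (v_ n),
          beta (v_ n) @[n --> \oo] --> (0 : R) &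
          forall n, (0 < alpha [set v_ n])%E]) ->
    forall U : set 'rV[R[i]]_d, nbhs (0 : 'rV[R[i]]_d) U -> ~ (forall z, U z -> FL_exists mu z)).
Proof.
split=> [[kappa kappa0 beta_kappa]|[v_ [Sv bv av]] U U0 H].
  exact: (gamma_bounded_below N_norm beta_meas mu_gamma kappa0 beta_kappa).
(* Balls in ['rV[R[i]]_d] have radii in [R[i]]; positivity forces the radius to be real. *)
have [e e0 eU] : exists2 r : R, 0 < r & ball (0 : 'rV[R[i]]_d) r%:C `<=` U.
  move/nbhs_ballP: U0 => [e /= e0 eU].
  have er : e = (complex.Re e)%:C.
    by move: e0; rewrite ltcE => /andP[/eqP i0 _]; apply: eqcP.
  by exists (complex.Re e); [rewrite -ltcR -er|rewrite -er].
apply: (gamma_unbounded N_norm beta_meas beta_ge0 mu_gamma Sv bv av e0) => z ze.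
by apply: H; apply: eU; apply/ball0P.
Qed.
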